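(* Suppose $m$ is even and $N$ is odd. Let $H_0$ and $H_1$ be the defect $0$ and defect $1$ homology of the two-loop hairy graph-complex $0\to\mathcal C_2\to\mathcal C_1\to\mathcal C_0\to 0$ with rational coefficients. Let $a_k$ and $b_k$ ($k\ge 1$) be the dimensions of the Hodge degree $k$ parts of $H_0$ and $H_1$ respectively, and let $\chi_k$ be the Euler characteristic of the Hodge degree $k$ part of the complex. Then the generating functions $h_0(t)=\sum_{k\ge1}a_kt^k$, $h_1(t)=\sum_{k\ge1}b_kt^k$, $\chi(t)=\sum_{k\ge1}\chi_kt^k$ are $$h_0(t)=\frac{t^3+t^{11}+t^{14}-t^{15}}{(1-t^4)(1-t^{12})},\qquad h_1(t)=\frac{t+t^{16}}{(1-t^4)(1-t^{12})},\qquad \chi(t)=\frac{t-t^{11}-t^{13}+t^{14}}{(1+t^2)(1-t^{12})}.$$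
   Context: Let $m,N$ be positive integers; all coefficients are in $\mathbb Q$. Graph-complex $\mathcal E^{m,N}_\pi$. It is spanned by connected graphs (self-loops and multiple edges allowed) with a non-empty finite set of unlabeled external vertices of valence $1$ and a possibly empty finite set of unlabeled internal vertices of valence $\ge3$. The orientation set of a graph is the union of its external vertices (each of degree $-m$), internal vertices (each of degree $-N$) and edges (each of degree $N-1$). An orientation of a graph is a total order of its orientation set together with an orientation of every edge. Isomorphic oriented graphs (isomorphism respecting adjacency, edge orientations and the order) are identified. One takes the quotient of the $\mathbb Q$-vector space spanned by isomorphism classes of oriented graphs by the relations: reversing the orientation of one edge multiplies by $(-1)^N$; permuting the orientation set multiplies by the Koszul sign of the permutation, computed from the degrees of the elements. The total degree of a graph is the sum of the degrees of all elements of its orientation set. The differential $\partial\Upsilon$ is the sum, over all internal vertices $v$ and all unordered partitions of the half-edges at $v$ into two sets of size $\ge2$, of the graph obtained by replacing $v$ by a new edge joining two vertices, the half-edges of one set being attached to one endpoint and those of the other set to the other endpoint; one endpoint is regarded as the old vertex $v$, the other one as the new vertex; the new vertex and the new edge are added as the first and second elements of the ordered orientation set, and the new edge is oriented from the old vertex to the new one (the choice of which endpoint is new does not matter). Hairy graphs. An edge of a connected graph is tree-type if removing it disconnects the graph into two parts, exactly one of which is a tree. The frame is the subgraph generated by the edges that are not tree-type. A hair is a tree-type edge one of whose endpoints is univalent and whose other endpoint lies in the frame and has no other tree-type edges adjacent to it. A vertex is a cut vertex if removing it (as a point of the topological space) disconnects the graph. A two-loop hairy graph is a connected graph (self-loops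 and multiple edges allowed) with a non-empty finite set of unlabeled external vertices of valence $1$ and a finite set of unlabeled internal vertices of valence $\ge3$, of first Betti number $2$, whose frame has no cut vertices and all of whose tree-type edges are hairs; its frame is a (subdivided) $\Theta$-graph. The Hodge degree is the number of external vertices (i.e. of hairs). The defect is $\sum_v(|v|-3)$ over the internal vertices $v$, where $|v|$ is the valence; for two-loop hairy graphs it is $0$, $1$ or $2$. Let $\mathcal C_i\subset\mathcal E^{m,N}_\pi$ be the span of the two-loop hairy graphs of defect $i$. The differential $\partial$ preserves Hodge degree and lowers both the defect and the total degree by $1$, giving the two-loop hairy graph-complex $0\to\mathcal C_2\xrightarrow{\partial_2}\mathcal C_1\xrightarrow{\partial_1}\mathcal C_0\to0$, with $H_i=\ker\partial_i/\operatorname{im}\partial_{i+1}$. The Euler characteristic $\chi_k$ of the Hodge degree $k$ part is taken with respect to the total degree: $\chi_k=\sum_d(-1)^d\dim(\text{part of Hodge degree }k\text{ and total degree }d)$. *)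

(* Defs.v *)
From HB Require Import structures.
From mathcomp Require Import all_boot all_order all_algebra all_fingroup.
From mathcomp Require Import zify.

Set Implicit Arguments.
Unset Strict Implicit.
Unset Printing Implicit Defensive.

Import Order.TTheory GRing.Theory Num.Theory.
Local Open Scope ring_scope.

(* Throughout, k, n and e are the numbers of external vertices, internal
   vertices and edges.  Every finite graph is isomorphic to one whose vertices
   and edges are numbered; that vertices and edges carry no labels is enforced
   by the isomorphism relations below. *)

Definition vertex (k n : nat) : finType := ('I_k + 'I_n)%type.

(* A half-edge (j, false) is the tail of edge j and (j, true) is its head, so a
   graph comes with an orientation of each of its edges. *)
Definition halfedge (e : nat) : finType := ('I_e * bool)%type.

Definition graph (k n e : nat) : finType := {ffun halfedge e -> vertex k n}.

(* The open cells of the graph as a topological space, and also the elements of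
   its orientation set. *)
Definition cell (k n e : nat) : finType := (vertex k n + 'I_e)%type.

Section Graphs.
Variables k n e : nat.
Implicit Types (G : graph k n e) (S : {set cell k n e}) (j : 'I_e).

Definition halfedges G (x : vertex k n) : {set halfedge e} :=
  [set h | G h == x].

Definition valence G x : nat := #|halfedges G x|.

Definition incident G : rel (cell k n e) := fun c d =>
  match c, d with
  | inl x, inr j | inr j, inl x => [exists b : bool, G (j, b) == x]
  | _, _ => false
  end.

Definition incident_in G S : rel (cell k n e) :=
  [rel c d | [&& c \in S, d \in S & incident G c d]].

(* The connected components of the subspace that is the union of the cells in
   S.  The set S need not be closed: an edge without its endpoints is an open
   interval. *)
Definition components G S : {set {set cell k n e}} :=
  [set [set d in S | connect (incident_in G S) c d] | c in S].

Definition connected_space G S : bool := #|components G S| == 1%N.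

Definition betti1 G S : nat :=
  (#|components G S| + #|[set j | inr j \in S]| - #|[set x | inl x \in S]|)%N.

Definition is_tree G S : bool := connected_space G S && (betti1 G S == 0%N).

Definition admissible G : bool :=
  [&& (0 < k)%N, connected_space G [set: cell k n e],
      [forall i : 'I_k, valence G (inl i) == 1%N]
    & [forall v : 'I_n, (3 <= valence G (inr v))%N]].

Definition tree_type G j : bool :=
  let parts := components G ([set: cell k n e] :\ inr j) in
  (#|parts| == 2) && (#|[set S in parts | is_tree G S]| == 1%N).

Definition frame G : {set cell k n e} :=
  [set c | match c with
           | inr j => ~~ tree_type G j
           | inl x => [exists j, ~~ tree_type G j && incident G c (inr j)]
           end].

Definition is_hair G j : bool :=
  tree_type G j &&
  [exists b : bool,
     [&& valence G (G (j, b)) == 1%N,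
         inl (G (j, ~~ b)) \in frame G
       & [forall j', tree_type G j' && incident G (inl (G (j, ~~ b))) (inr j')
                     ==> (j' == j)]]].

Definition cut_vertex G S (x : vertex k n) : bool :=
  (inl x \in S) && (1 < #|components G (S :\ inl x)|)%N.

Definition two_loop_hairy G : bool :=
  [&& admissible G, betti1 G [set: cell k n e] == 2,
      [forall x, ~~ cut_vertex G (frame G) x]
    & [forall j, tree_type G j ==> is_hair G j]].

(* The truncated subtraction is harmless, as internal vertices of admissible
   graphs have valence at least 3. *)
Definition defect G : nat := (\sum_(v < n) (valence G (inr v) - 3))%N.

Definition flip_edge G j : graph k n e :=
  [ffun h : halfedge e => if h.1 == j then G (h.1, ~~ h.2) else G h].

(* A total order, given as the set of pairs (c, d) such that c comes strictly
   before d. *)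
Definition total_order (L : {set cell k n e * cell k n e}) : bool :=
  [&& [forall c, (c, c) \notin L],
      [forall a, forall b, forall c,
         ((a, b) \in L) && ((b, c) \in L) ==> ((a, c) \in L)]
    & [forall c, forall d, (c != d) ==> ((c, d) \in L) || ((d, c) \in L)]].

Definition vertex_perm (s : 'S_k) (t : 'S_n) (x : vertex k n) : vertex k n :=
  match x with inl i => inl (s i) | inr v => inr (t v) end.

Definition cell_perm (s : 'S_k) (t : 'S_n) (u : 'S_e) (c : cell k n e) :
    cell k n e :=
  match c with inl x => inl (vertex_perm s t x) | inr j => inr (u j) end.

Definition cell_degree (m N : nat) (c : cell k n e) : int :=
  match c with
  | inl (inl _) => - m%:Z
  | inl (inr _) => - N%:Z
  | inr _ => N%:Z - 1
  end.

Definition koszul_sign (m N : nat) (L L' : {set cell k n e * cell k n e}) :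
    rat :=
  \prod_(p in L :\: L') (-1) ^ (cell_degree m N p.1 * cell_degree m N p.2).

End Graphs.

(* A graph with its edge orientations and an order of its orientation set. *)
Definition ograph (k n e : nat) : finType :=
  (graph k n e * {set cell k n e * cell k n e})%type.

Definition total_degree (m N k n e : nat) : int :=
  \sum_(c : cell k n e) cell_degree m N c.

(* The free vector space on oriented graphs.  The graph-complex with parameters
   m and N is the direct sum over k, n and e of the quotients of
   <<gen g | g admissible>> by relations m N k n e. *)
Definition chain (k n e : nat) : vectType rat := {ffun ograph k n e -> rat^o}.

Section Relations.
Variables k n e : nat.
Implicit Types (g : ograph k n e) (L : {set cell k n e * cell k n e}).

Definition gen g : chain k n e := [ffun g' => (g' == g)%:R].

Definition admissible_ograph g : bool := admissible g.1 && total_order g.2.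

Definition isomorphic g g' : bool :=
  [exists s : 'S_k, exists t : 'S_n, exists u : 'S_e,
     [forall h : halfedge e, g'.1 (u h.1, h.2) == vertex_perm s t (g.1 h)] &&
     [forall c, forall d,
        ((cell_perm s t u c, cell_perm s t u d) \in g'.2) == ((c, d) \in g.2)]].

Definition iso_relations : {vspace chain k n e} :=
  <<[seq gen p.1 - gen p.2 | p : ograph k n e * ograph k n e in
       [pred p | [&& admissible_ograph p.1, admissible_ograph p.2
                   & isomorphic p.1 p.2]]]>>%VS.

Definition flip_relations (N : nat) : {vspace chain k n e} :=
  <<[seq gen (flip_edge p.1.1 p.2, p.1.2) - (-1) ^+ N *: gen p.1
       | p : ograph k n e * 'I_e in [pred p | admissible_ograph p.1]]>>%VS.

Definition order_relations (m N : nat) : {vspace chain k n e} :=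
  <<[seq gen (p.1.1, p.2) - koszul_sign m N p.1.2 p.2 *: gen p.1
       | p : ograph k n e * {set cell k n e * cell k n e} in
         [pred p | admissible_ograph p.1 && total_order p.2]]>>%VS.

Definition relations (m N : nat) : {vspace chain k n e} :=
  (iso_relations + flip_relations N + order_relations m N)%VS.

(* Two-loop hairy graphs of defect i. *)
Definition hairy (i : nat) : {vspace chain k n e} :=
  <<[seq gen g | g : ograph k n e in
       [pred g | [&& two_loop_hairy g.1, total_order g.2
                   & defect g.1 == i]]]>>%VS.

End Relations.

Section Differential.
Variables k n e : nat.
Implicit Types (G : graph k n e) (v : 'I_n) (A : {set halfedge e}).

(* The new vertex and the new edge have number 0, the numbers of the old ones
   are shifted by one. *)
Definition old_vertex (x : vertex k n) : vertex k n.+1 :=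
  match x with inl i => inl i | inr v => inr (lift ord0 v) end.

Definition new_vertex : vertex k n.+1 := inr ord0.

Definition old_cell (c : cell k n e) : cell k n.+1 e.+1 :=
  match c with inl x => inl (old_vertex x) | inr j => inr (lift ord0 j) end.

(* The half-edges in A, all attached to v, are moved to the new vertex. *)
Definition split_graph G v A : graph k n.+1 e.+1 :=
  [ffun h : halfedge e.+1 =>
     match unlift ord0 h.1 with
     | None => if h.2 then new_vertex else old_vertex (inr v)
     | Some j => if (j, h.2) \in A then new_vertex else old_vertex (G (j, h.2))
     end].

Definition split_order (L : {set cell k n e * cell k n e}) :
    {set cell k n.+1 e.+1 * cell k n.+1 e.+1} :=
  let first : cell k n.+1 e.+1 := inl new_vertex in
  let second : cell k n.+1 e.+1 := inr ord0 in
  [set (first, second)]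
  :|: [set (first, old_cell c) | c in [set: cell k n e]]
  :|: [set (second, old_cell c) | c in [set: cell k n e]]
  :|: [set (old_cell p.1, old_cell p.2) | p in L].

Definition splitting G v (P : {set {set halfedge e}}) : bool :=
  [&& partition P (halfedges G (inr v)), #|P| == 2
    & [forall A in P, (2 <= #|A|)%N]].

(* The block going to the new vertex: either choice gives the same class modulo
   the relations. *)
Definition new_block (P : {set {set halfedge e}}) : {set halfedge e} :=
  odflt set0 [pick A in P].

Definition diff_gen (g : ograph k n e) : chain k n.+1 e.+1 :=
  \sum_(v < n) \sum_(P | splitting g.1 v P)
    gen (split_graph g.1 v (new_block P), split_order g.2).

Definition diff_fun (x : chain k n e) : chain k n.+1 e.+1 :=
  \sum_g (x g : rat) *: diff_gen g.

Lemma diff_fun_is_linear : linear diff_fun.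
Proof.
move=> a x y; rewrite /diff_fun scaler_sumr -big_split /=.
by apply: eq_bigr => g _; rewrite !ffunE scalerDl scalerA.
Qed.

HB.instance Definition _ :=
  GRing.isLinear.Build rat (chain k n e) (chain k n.+1 e.+1) _ diff_fun
    diff_fun_is_linear.

Definition diff : 'Hom(chain k n e, chain k n.+1 e.+1) := linfun diff_fun.

End Differential.

(* The dimension of the image of U in the quotient by W, that is, of
   (U + W) / W. *)
Definition dim_mod (V : vectType rat) (U W : {vspace V}) : nat :=
  \dim (U :\: W)%VS.

(* Linear combinations of two-loop hairy graphs of defect i whose classes are
   cycles. *)
Definition cycles (m N k n e i : nat) : {vspace chain k n e} :=
  (hairy k n e i :&: diff k n e @^-1: relations k n.+1 e.+1 m N)%VS.

Definition boundaries (m N k n e i : nat) : {vspace chain k n.+1 e.+1} :=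
  (diff k n e @: hairy k n e i.+1 + relations k n.+1 e.+1 m N)%VS.

Definition homology_dim (m N k n e i : nat) : nat :=
  dim_mod (cycles m N k n.+1 e.+1 i) (boundaries m N k n e i).

Definition hairy_dim (m N k n e i : nat) : nat :=
  dim_mod (hairy k n e i) (relations k n e m N).

(* The numbers of internal vertices and edges of a two-loop hairy graph are
   determined by its Hodge degree k and its defect i. *)
Lemma two_loop_hairy_size k n e (G : graph k n e) i :
  two_loop_hairy G -> defect G = i ->
  (n + i = k + 2)%N /\ (e + i = k.*2 + 3)%N.
Proof.
case/and4P=> /and4P[_ /eqP conn /forallP val1 /forallP val3] /eqP betti _ _ def.
have euler : (e + 1 = k + n + 2)%N.
  move: betti; rewrite /betti1 conn.
  have -> : [set j | inr j \in [set: cell k n e]] = setT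
    by apply/setP => j; rewrite !inE.
  have -> : [set x | inl x \in [set: cell k n e]] = setT
    by apply/setP => j; rewrite !inE.
  by rewrite !cardsT card_sum !card_ord; lia.
have sum_val : (\sum_(x : vertex k n) valence G x = e * 2)%N.
  rewrite -{2}(card_ord e) -card_bool -card_prod -sum1_card.
  rewrite (partition_big (fun h => G h) predT) //=.
  by apply: eq_bigr => x _; rewrite /valence /halfedges cardsE sum1_card.
move: sum_val; rewrite big_sumType /=.
rewrite (eq_bigr (fun=> 1%N)); last by move=> j _; apply/eqP.
rewrite sum_nat_const card_ord muln1.
have -> : (\sum_(v < n) valence G (inr v) = i + n * 3)%N.
  have <- : (\sum_(v < n) 3 = n * 3)%N by rewrite sum_nat_const card_ord.
  by rewrite -def -big_split; apply: eq_bigr => v _; rewrite /= subnK.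
lia.
Qed.

(* By the lemma above, the Hodge degree k part of the two-loop hairy
   graph-complex sits in the three bidegrees (n, e) = (k, 2k+1), (k+1, 2k+2)
   and (k+2, 2k+3), for the defects 2, 1 and 0. *)
Definition H0_dim (m N k : nat) : nat := homology_dim m N k k.+1 k.*2.+2 0.

Definition H1_dim (m N k : nat) : nat := homology_dim m N k k k.*2.+1 1.

(* These three bidegrees have distinct total degrees, hence each summand is the
   contribution of one total degree. *)
Definition euler_char (m N k : nat) : rat :=
  (-1) ^ total_degree m N k k k.*2.+1 *
    (hairy_dim m N k k k.*2.+1 2)%:R
  + (-1) ^ total_degree m N k k.+1 k.*2.+2 *
    (hairy_dim m N k k.+1 k.*2.+2 1)%:R
  + (-1) ^ total_degree m N k k.+2 k.*2.+3 *
    (hairy_dim m N k k.+2 k.*2.+3 0)%:R.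

(* A formal power series over rat, given by its coefficients. *)
Definition series := nat -> rat.

(* The sum of a k * t ^ k over k >= 1. *)
Definition genfun (a : nat -> rat) : series :=
  fun k => if k is 0%N then 0 else a k.

Definition series_mul (f g : series) : series :=
  fun d => \sum_(i < d.+1) f i * g (d - i)%N.

Definition series_of_poly (p : {poly rat}) : series := fun d => p`_d.

(* h = p / q in the ring of formal power series, q being invertible there. *)
Definition is_fraction (h : series) (p q : {poly rat}) : Prop :=
  q`_0 != 0 /\ series_mul (series_of_poly q) h =1 series_of_poly p.

(* Main.v *)
(* Every two-loop hairy graph is a theta graph whose strands carry a, b and c
   hairs, with d0, d1 in {0, 1} further hairs at the two vertices where the
   strands meet.  Its defect is d0 + d1 and its Hodge degree is
   a + b + c + d0 + d1.  For m even and N odd the sign of an isomorphism is the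
   parity of the number of reversed edges plus the number of inversions of the
   internal vertices: swapping the first two strands has sign (-1)^(ab), and
   exchanging the two ends has sign theta = (-1)^tau, where
   tau = ceil(a/2) + ceil(b/2) + ceil(c/2).

   Dually, cochains are functions of (a, b, c) with these symmetries, and
   splitting off a hair at an end gives the differentials D and
   (1 + theta) D theta, where
   D f (a, b, c) = f(a+1, b, c) + (-1)^a f(a, b+1, c) + (-1)^(a+b) f(a, b, c+1).
   The equation D f = g is solved by recursion on the first variable, followed
   by averaging, so D is onto and the second differential as well: all dimensions
   follow from those of the cochain spaces and of the kernel of D on the
   theta-invariant functions of sum k.

   As f = theta f, the equation D f = 0 also reads theta D theta f = 0, with
   other signs.  Comparing both for each parity of (a, b, c), the kernel consists of
   functions h of the halves (rounded up for k odd, down for k even) with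
   h(x+1, y, z) + h(x, y+1, z) + h(x, y, z+1) = 0, symmetric of sum (k+1)/2 for
   k odd, alternating of sum (k-2)/2 for k even; it is zero if that sum is odd.
   The dimensions of all spaces involved are traces of averaging projectors,
   which gives rational generating functions. *)

From HB Require Import structures.
Require Import Defs.
From mathcomp Require Import all_boot all_order all_algebra all_fingroup.
From mathcomp Require Import zify ring lra.
From Stdlib Require ClassicalEpsilon.

Set Implicit Arguments.
Unset Strict Implicit.
Unset Printing Implicit Defensive.

Import Order.TTheory GRing.Theory Num.Theory.
Local Open Scope ring_scope.

(** * Oriented graphs and the signs of their isomorphisms *)

(** The complex consists of quotients of chains on numbered graphs, and orbit representatives are
    never chosen in it. Chains are paired with cochains instead, and the pairing is perfect modulo
    the relations. This rests on three facts: every two-loop hairy graph is the target of an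
    isomorphism from a theta graph; every theta graph with at least one hair is two-loop hairy; and
    the strand swaps and the exchange of the ends generate all isomorphisms of theta graphs, so that
    signs need only be tested on them. The Betti numbers become dim ker [delta0] and dim S1 - rank
    [delta0] - rank [delta1]; the second is the first minus an Euler characteristic. For m even and
    N odd only internal vertices have odd degree. Hence edges enter the signs through their
    reversals alone, and the total degree has the parity of n. The ceil(a/2) in tau has this origin:
    turning a strand around reverses a + 1 edges and inverts C(a,2) pairs of vertices, and the
    inversion of the two ends, counted once for each of the three strands, adds 1; modulo 2, C(a,2)
    + a + 2 is ceil(a/2). *)

(* As m is even and N is odd, the order of the orientation set matters only
   through the order olt of the internal vertices. *)
Record ogr := Ogr {
  oX : finType; oV : finType; oE : finType;
  oinc : oE -> bool -> oX + oV;
  olt : rel oV }.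

Definition tournament (T : eqType) (r : rel T) :=
  forall v w, r v w = (v != w) && ~~ r w v.

Definition sum_map (A B C D : Type) (f : A -> C) (g : B -> D) (x : A + B) : C + D :=
  match x with inl a => inl (f a) | inr b => inr (g b) end.

Lemma sum_map_id (A B : Type) (x : A + B) : sum_map id id x = x.
Proof. by case: x. Qed.

(* ifl e tells whether the direction of the edge e is reversed. *)
Record iso (O O' : ogr) := Iso {
  iX : oX O -> oX O'; iV : oV O -> oV O'; iE : oE O -> oE O'; ifl : oE O -> bool;
  iXbij : bijective iX; iVbij : bijective iV; iEbij : bijective iE;
  iinc : forall e b, oinc (iE e) (b (+) ifl e) = sum_map iX iV (oinc e b) }.

Definition inversions (T T' : finType) (r : rel T) (r' : rel T') (f : T -> T') : bool :=
  \big[addb/false]_(p : T * T | r p.1 p.2) ~~ r' (f p.1) (f p.2).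

Definition isgn O O' (f : iso O O') : bool :=
  (\big[addb/false]_e ifl f e) (+) inversions (@olt O) (@olt O') (iV f).

(** Each tournament selects one of (v, w) and (w, v) for v != w, and [s] takes the same value on
    both; the pairs on which [r] and [r'] disagree are matched by exchanging the two entries. *)
Lemma tournament_sum (T : finType) (r r' : rel T) (s : T -> T -> bool) :
  tournament r -> tournament r' -> (forall v w, v != w -> s v w = s w v) ->
  \big[addb/false]_(p : T * T | r p.1 p.2) s p.1 p.2
  = \big[addb/false]_(p : T * T | r' p.1 p.2) s p.1 p.2.
Proof.
move=> tr tr' ss.
rewrite (bigID (fun p => r' p.1 p.2)) /= [RHS](bigID (fun p => r p.1 p.2)) /=.
congr addb; first by apply: eq_bigl => p; rewrite andbC.
rewrite (reindex_inj (h := fun p : T * T => (p.2, p.1))) /=; last first.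
  by move=> [a b] [c d] /= [-> ->].
apply: eq_big => [[v w]|[v w]] /=.
  by rewrite (tr w v) (tr' v w) eq_sym; case: eqP => //= _; rewrite ?negbK andbC.
by rewrite tr => /andP[/andP[/ss]].
Qed.

(** A pair is inverted by the composite iff exactly one of [f] and [g] inverts it. The pairs counted
    for [g], pulled back along [f], form the tournament [r' (f v) (f w)] instead of [r];
    [tournament_sum] passes from one to the other. *)
Lemma inversions_comp (T T' T'' : finType) (r : rel T) (r' : rel T') (r'' : rel T'')
    (f : T -> T') (g : T' -> T'') :
  tournament r -> tournament r' -> tournament r'' -> bijective f -> injective g ->
  inversions r r'' (g \o f) = inversions r r' f (+) inversions r' r'' g.
Proof.
move=> tr tr' tr'' bf ig; have fi := bij_inj bf.
have tf : tournament (fun v w => r' (f v) (f w)).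
  by move=> v w; rewrite tr' (inj_eq fi).
have sym (U U' : finType) (h : U -> U') (q : rel U) (q' : rel U') : tournament q ->
    tournament q' -> injective h ->
    forall v w, v != w -> q v w (+) q' (h v) (h w) = q w v (+) q' (h w) (h v).
  move=> tq tq' ih v w vw; rewrite (tq v w) (tq' (h v)) (inj_eq ih) vw /=.
  by case: (q w v) (q' _ _) => [] [].
have -> : inversions r' r'' g = \big[addb/false]_(p : T * T | r p.1 p.2)
     (r' (f p.1) (f p.2) (+) r'' (g (f p.1)) (g (f p.2))).
  rewrite (tournament_sum (s := fun v w => r' (f v) (f w) (+) r'' (g (f v)) (g (f w))) tr tf); last first.
    by move=> v w vw; apply: (sym _ _ g r' r'' tr' tr'' ig); rewrite (inj_eq fi).
  rewrite /inversions; case: bf => f' fK f'K.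
  rewrite (reindex (fun p : T * T => (f p.1, f p.2))) /=; last first.
    by exists (fun p => (f' p.1, f' p.2)) => [[a b] _|[a b] _] /=; rewrite ?fK ?f'K.
  by apply: eq_bigr => -[a b] /= ->.
rewrite /inversions -big_split /=; apply: eq_bigr => -[a b] /= _.
by case: (r' _ _) (r'' _ _) => [] [].
Qed.

Section IsoOps.
Variables O1 O2 O3 : ogr.

Program Definition iso_id : iso O1 O1 :=
  @Iso O1 O1 id id id (fun=> false) _ _ _ _.
Next Obligation. by exists id. Qed.
Next Obligation. by exists id. Qed.
Next Obligation. by exists id. Qed.
Next Obligation. by rewrite addbF sum_map_id. Qed.

Program Definition iso_comp (g : iso O2 O3) (f : iso O1 O2) : iso O1 O3 :=
  @Iso O1 O3 (iX g \o iX f) (iV g \o iV f) (iE g \o iE f)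
    (fun e => ifl f e (+) ifl g (iE f e)) _ _ _ _.
Next Obligation. by apply: bij_comp; apply: iXbij. Qed.
Next Obligation. by apply: bij_comp; apply: iVbij. Qed.
Next Obligation. by apply: bij_comp; apply: iEbij. Qed.
Next Obligation. by rewrite addbA !iinc; case: (oinc _ _). Qed.

Lemma isgn_comp (g : iso O2 O3) (f : iso O1 O2) :
  tournament (@olt O1) -> tournament (@olt O2) -> tournament (@olt O3) ->
  isgn (iso_comp g f) = isgn f (+) isgn g.
Proof.
move=> t1 t2 t3; rewrite /isgn /=.
rewrite (inversions_comp t1 t2 t3) ?big_split /=; [|exact: iVbij|exact: bij_inj (iVbij g)].
have -> : \big[addb/false]_i ifl g (iE f i) = \big[addb/false]_e ifl g e.
  by rewrite [RHS](reindex (iE f)) //; apply: onW_bij; apply: iEbij.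
by case: (\big[_/_]_i _) (\big[_/_]_i _) (inversions _ _ _) (inversions _ _ _) => [] [] [] [].
Qed.
End IsoOps.

Lemma inversions_id (T : finType) (r : rel T) : inversions r r id = false.
Proof. by rewrite /inversions big1 // => p ->. Qed.

Lemma isgn_id O : isgn (iso_id O) = false.
Proof. by rewrite /isgn /= inversions_id big1. Qed.

(** [bijective] is a proposition, while the inverse is wanted as data for an [iso]; a search in the
    finite type provides it. *)
Lemma bij_inv (A B : finType) (f : A -> B) : bijective f ->
  {g : B -> A | cancel f g & cancel g f}.
Proof.
move=> bf; have fi := bij_inj bf.
have P b : exists a, f a == b by case: bf => g _ gK; exists (g b); rewrite gK.
exists (fun b => xchoose (P b)) => [a|b].
  by apply: fi; apply/eqP; exact: (xchooseP (P (f a))).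
by apply/eqP; exact: (xchooseP (P b)).
Qed.

(** Besides the sign, this records how the inverse acts on vertices, edges and reversals, which the
    analysis of splittings relies on. *)
Lemma iso_sym O O' (f : iso O O') : tournament (@olt O) -> tournament (@olt O') ->
  {g : iso O' O | [/\ isgn g = isgn f, cancel (iV f) (iV g), cancel (iE f) (iE g)
                    & forall e, ifl g (iE f e) = ifl f e]}.
Proof.
move=> t t'.
have [gX XK KX] := bij_inv (iXbij f); have [gV VK KV] := bij_inv (iVbij f).
have [gE EK KE] := bij_inv (iEbij f).
have H e b : oinc (gE e) (b (+) ifl f (gE e)) = sum_map gX gV (oinc e b).
  have := iinc f (gE e) (b (+) ifl f (gE e)).
  rewrite KE -addbA addbb addbF => ->.
  by case: (oinc (gE e) _) => x /=; rewrite ?XK ?VK.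
have BX : bijective gX by exists (iX f).
have BV : bijective gV by exists (iV f).
have BE : bijective gE by exists (iE f).
pose g := @Iso O' O gX gV gE (fun e => ifl f (gE e)) BX BV BE H.
exists g; split=> //; last by move=> e /=; rewrite EK.
rewrite /isgn /=; congr addb.
  by rewrite [RHS](reindex gE) //; apply: onW_bij; exists (iE f).
have := inversions_comp t' t t' (g := iV f) (f := gV).
move=> /(_ BV (bij_inj (iVbij f))).
have -> : inversions (@olt O') (@olt O') (iV f \o gV) = false.
  by rewrite /inversions big1 // => p; rewrite /= !KV => ->.
by case: (inversions _ _ _) (inversions _ _ _) => [] [].
Qed.

Definition obj k n e (g : ograph k n e) : ogr :=
  @Ogr 'I_k 'I_n 'I_e (fun j b => g.1 (j, b))
    (fun v w => (inl (inr v), inl (inr w)) \in g.2).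

Lemma total_order_tournament k n e (L : {set cell k n e * cell k n e}) :
  total_order L -> forall c d, ((c, d) \in L) = (c != d) && ((d, c) \notin L).
Proof.
case/and3P=> /forallP irr /forallP tr /forallP tot c d.
have [->|cd] := eqVneq c d; first by rewrite (negbTE (irr d)).
have := forallP (tot c) d; rewrite cd /= => h.
apply/idP/idP => [cdL|/negbTE ndc]; last by rewrite ndc orbF in h.
apply/negP => dcL; have := forallP (forallP (tr c) d) c.
by rewrite cdL dcL /= (negbTE (irr c)).
Qed.

Lemma obj_tournament k n e (g : ograph k n e) : total_order g.2 ->
  tournament (@olt (obj g)).
Proof. by move=> /total_order_tournament H v w; rewrite /= H. Qed.

Lemma signz_even (z : int) : (2 %| z)%Z -> (-1) ^ z = 1 :> rat.
Proof. by case/dvdzP => q ->; rewrite mulrC -exprz_exp (_ : (-1) ^ 2 = 1) ?exp1rz. Qed.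

Lemma signz_odd (z : int) : (2 %| z + 1)%Z -> (-1) ^ z = -1 :> rat.
Proof.
move=> /signz_even; rewrite exprzDr ?unitrN1 // expr1z => h.
by apply: (@mulIf _ (-1)); rewrite ?oppr_eq0 ?oner_eq0 // h mulrNN mulr1.
Qed.

Section Relations.
Variables (m N k n e : nat) (m_even : ~~ odd m) (N_odd : odd N).
Implicit Types (g : ograph k n e) (L : {set cell k n e * cell k n e}).

Lemma signr_addb_rat (b c : bool) : (-1) ^+ (b (+) c) = (-1) ^+ b * (-1) ^+ c :> rat.
Proof. exact: signr_addb. Qed.

(** External vertices and edges have the even degrees -m and N - 1, so a product of two degrees is
    odd only for two internal vertices, of degree -N. *)
Lemma koszul_factor (c d : cell k n e) :
  (-1) ^ (cell_degree m N c * cell_degree m N d) =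
  (if c is inl (inr _) then if d is inl (inr _) then -1 else 1 else 1) :> rat.
Proof.
by case: c d => [[c|c]|c] [[d|d]|d] /=; (apply: signz_odd || apply: signz_even); nia || lia.
Qed.

Lemma koszul_sign_inversions L L' :
  total_order L -> total_order L' ->
  koszul_sign m N L L' = (-1) ^+ inversions
    (fun v w : 'I_n => (inl (inr v), inl (inr w)) \in L)
    (fun v w => (inl (inr v), inl (inr w)) \in L') id.
Proof.
move=> tL tL'; rewrite /inversions.
rewrite (big_morph (fun b : bool => (-1) ^+ b : rat) (op1 := *%R) (id1 := 1)) //;
  last exact: signr_addb_rat.
rewrite /koszul_sign.
transitivity (\prod_(c : cell k n e) \prod_(d : cell k n e)
   if (c, d) \in L :\: L' then
    (if c is inl (inr _) then if d is inl (inr _) then -1 else 1 else 1) else 1 : rat).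
  rewrite pair_big /= big_mkcond /=; apply: eq_bigr => -[c d] _ /=.
  by case: ifP => // _; exact: koszul_factor.
rewrite big_sumType /= [X in _ * X]big1 ?mulr1; last first.
  by move=> i _; rewrite big1 // => j _; case: ifP.
rewrite big_sumType /= [X in X * _]big1 ?mul1r; last first.
  by move=> i _; rewrite big1 // => j _; case: ifP.
rewrite [RHS]big_mkcond /= -(pair_bigA _ (fun v w : 'I_n => if (inl (inr v), inl (inr w)) \in L then
  (-1) ^+ ((inl (inr v), inl (inr w)) \notin L') else 1 : rat)) /=.
apply: eq_bigr => v _.
rewrite big_sumType /= [X in _ * X]big1 ?mulr1; last by move=> j _; case: ifP.
rewrite big_sumType /= [X in X * _]big1 ?mul1r; last by move=> j _; case: ifP.
apply: eq_bigr => w _; rewrite inE.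
by case: (_ \in L) (_ \in L') => [] [].
Qed.

Lemma iso_relations_sub : (iso_relations k n e <= relations k n e m N)%VS.
Proof. by rewrite /relations -addvA addvSl. Qed.
Lemma flip_relations_sub : (flip_relations k n e N <= relations k n e m N)%VS.
Proof. by rewrite /relations (addvC (iso_relations _ _ _)) -addvA addvSl. Qed.
Lemma order_relations_sub : (order_relations k n e m N <= relations k n e m N)%VS.
Proof. by rewrite /relations addvSr. Qed.

Program Definition flip_iso (g : ograph k n e) (j : 'I_e) : iso (obj g) (obj (flip_edge g.1 j, g.2)) :=
  @Iso (obj g) (obj (flip_edge g.1 j, g.2)) id id id (fun i => i == j) _ _ _ _.
Next Obligation. by exists id. Qed.
Next Obligation. by exists id. Qed.
Next Obligation. by exists id. Qed.
Next Obligation.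
by rewrite sum_map_id ffunE /=; case: eqP => _; rewrite ?addbT ?addbF ?negbK.
Qed.

Lemma flip_isgn g j : isgn (flip_iso g j) = true.
Proof.
rewrite /isgn [inversions _ _ _](inversions_id (@olt (obj g))) addbF.
by rewrite (bigD1 j) //= eqxx big1 // => i /negbTE.
Qed.

Program Definition order_iso (g : ograph k n e) (L : {set cell k n e * cell k n e}) : iso (obj g) (obj (g.1, L)) :=
  @Iso (obj g) (obj (g.1, L)) id id id (fun=> false) _ _ _ _.
Next Obligation. by exists id. Qed.
Next Obligation. by exists id. Qed.
Next Obligation. by exists id. Qed.
Next Obligation. by rewrite addbF sum_map_id. Qed.

Lemma order_isgn g L : total_order g.2 -> total_order L ->
  koszul_sign m N g.2 L = (-1) ^+ isgn (order_iso g L).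
Proof. by move=> t t'; rewrite koszul_sign_inversions // /isgn big1. Qed.

Lemma isomorphic_iso g g' : isomorphic g g' -> exists f : iso (obj g) (obj g'), isgn f = false.
Proof.
move=> /existsP[s /existsP[t /existsP[u /andP[/forallP hG /forallP hL]]]].
have H (j : oE (obj g)) b : oinc (o := obj g') (u j) (b (+) false) = sum_map s t (@oinc (obj g) j b).
  by rewrite addbF /= (eqP (hG (j, b))); case: (g.1 _).
exists (@Iso (obj g) (obj g') s t u (fun=> false) (injF_bij (@perm_inj _ s)) (injF_bij (@perm_inj _ t)) (injF_bij (@perm_inj _ u)) H).
rewrite /isgn /= big1 // /inversions big1 // => -[v w] /= vw.
by have /eqP := forallP (hL (inl (inr v))) (inl (inr w)); rewrite /= vw => ->.
Qed.

Lemma flip_edge_incident (G : graph k n e) j : incident (flip_edge G j) =2 incident G.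
Proof.
have H x i : [exists b, flip_edge G j (i, b) == x] = [exists b, G (i, b) == x].
  apply/existsP/existsP => -[b hb]; exists (b (+) (i == j)); move: hb; rewrite ffunE /=;
  by case: (i == j) => /=; rewrite ?addbT ?addbF ?negbK.
by move=> [x|i] [y|i'] /=; rewrite ?H.
Qed.

Lemma flip_edge_valence (G : graph k n e) j x : valence (flip_edge G j) x = valence G x.
Proof.
rewrite /valence /halfedges.
pose f (h : halfedge e) : halfedge e := (h.1, h.2 (+) (h.1 == j)).
have fK : involutive f by move=> [i b]; rewrite /f /= -addbA addbb addbF.
rewrite -(card_imset [set h | G h == x] (inv_inj fK)); apply: eq_card => h; rewrite inE.
apply/eqP/imsetP => [hx|[h' + ->]].
  exists (f h); rewrite ?fK // inE -hx ffunE /f; case: h {hx} => i b /=.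
  by case: (i == j); rewrite ?addbT ?addbF eqxx.
by rewrite inE ffunE => /eqP <-; case: h' => i b; rewrite /f /=; case: (i == j); rewrite ?addbT ?addbF ?negbK.
Qed.

Lemma flip_edge_components (G : graph k n e) j S : components (flip_edge G j) S = components G S.
Proof.
rewrite /components; apply: eq_imset => c; apply/setP => d; rewrite !inE; congr andb.
apply: eq_connect => x y; rewrite /incident_in /=.
by rewrite flip_edge_incident.
Qed.

Lemma flip_edge_admissible (G : graph k n e) j : admissible (flip_edge G j) = admissible G.
Proof.
rewrite /admissible /connected_space flip_edge_components; congr [&& _, _, _ & _];
by apply: eq_forallb => i; rewrite flip_edge_valence.
Qed.

(** Each generator of the relations compares two graphs along an isomorphism: an even one for a
    relabelling, an odd one for an edge flip, and one with the parity of the inversions for a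
    reordering. The functional defined by [phi] kills all of them. *)
Lemma sub_relations_kernel (phi : ograph k n e -> rat) :
  (forall g g' (f : iso (obj g) (obj g')), admissible_ograph g -> admissible_ograph g' ->
     phi g' = (-1) ^+ isgn f * phi g) ->
  forall x, x \in relations k n e m N -> \sum_g x g * phi g = 0.
Proof.
move=> H.
pose F : chain k n e -> rat^o := fun x => \sum_g x g * phi g.
have linF : linear F.
  move=> a x y; rewrite /F scaler_sumr -big_split /=.
  by apply: eq_bigr => g _; rewrite !ffunE mulrDl -scalerAl.
pose FM : {linear chain k n e -> rat^o} := HB.pack F (GRing.isLinear.Build _ _ _ _ F linF).
pose FL := linfun FM.
have FE x : FL x = F x by rewrite lfunE.
have Fg g : FL (gen g) = phi g.
  rewrite FE /F (bigD1 g) //= ffunE eqxx mul1r big1 ?addr0 // => g' /negbTE h.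
  by rewrite ffunE h mul0r.
suff sub : (relations k n e m N <= lker FL)%VS.
  by move=> x /(subvP sub); rewrite memv_ker FE => /eqP.
rewrite /relations !subv_add; apply/andP; split; [apply/andP; split|].
- apply/span_subvP => _ /imageP[[g g'] /and3P[/= ag ag' /isomorphic_iso[f hf]] ->].
  by rewrite memv_ker linearB /= !Fg (H _ _ f) // hf mul1r subrr.
- apply/span_subvP => _ /imageP[[g j] /= ag ->].
  rewrite memv_ker linearB linearZ /= !Fg (H _ _ (flip_iso g j)) // ?flip_isgn.
    by rewrite -(signr_odd _ N) N_odd; apply/eqP; exact: subrr.
  by move: ag; rewrite !inE /admissible_ograph /= flip_edge_admissible.
- apply/span_subvP => _ /imageP[[g L] /= /andP[/andP[ag tg] tL] ->].
  rewrite memv_ker linearB linearZ /= !Fg (order_isgn tg tL) (H _ _ (order_iso g L)); first (by apply/eqP; exact: subrr).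
    by rewrite /admissible_ograph ag.
  by rewrite /admissible_ograph ag.
Qed.

Definition flip_all (g : ograph k n e) (s : seq 'I_e) : ograph k n e :=
  (foldr (fun j G => flip_edge G j) g.1 s, g.2).

Lemma flip_all_E g s h : uniq s ->
  (flip_all g s).1 h = g.1 (h.1, h.2 (+) (h.1 \in s)).
Proof.
elim: s h => [|j s IH] [i b] /=; first by rewrite addbF.
case/andP=> js us; rewrite ffunE /= inE; case: eqP => [->|_] /=.
  by rewrite IH //= (negbTE js) addbF addbT.
by rewrite IH.
Qed.

Lemma flip_all_rel g s : admissible_ograph g ->
  admissible_ograph (flip_all g s) /\
  gen (flip_all g s) - (-1) ^+ size s *: gen g \in relations k n e m N.
Proof.
move=> ag; elim: s => [|j s [IH1 IH2]] /=.
  by rewrite /flip_all /= -surjective_pairing expr0 scale1r subrr mem0v.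
split; first by move: IH1; rewrite /admissible_ograph /= flip_edge_admissible.
rewrite exprS mulN1r scaleNr opprK.
have h : gen (flip_all g (j :: s)) + gen (flip_all g s) \in relations k n e m N.
  apply: (subvP flip_relations_sub); apply: memv_span.
  apply/imageP; exists (flip_all g s, j) => //=.
  by rewrite -(signr_odd _ N) N_odd expr1 scaleN1r opprK.
by have := memvB h IH2; rewrite opprB addrA addrAC addrK addrC.
Qed.

(** An isomorphism factors into flips of the edges in [ifl f], a relabelling onto [g'.1] with the
    transported order [L0], and a change of order from [L0] to that of [g']. Each factor is a
    relation, and the three telescope. *)
Lemma relations_iso g g' (f : iso (obj g) (obj g')) :
  admissible_ograph g -> admissible_ograph g' ->
  gen g' - (-1) ^+ isgn f *: gen g \in relations k n e m N.
Proof.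
move=> ag ag'.
pose s := enum (ifl f).
pose g0 := flip_all g s.
have [a0 r0] := flip_all_rel s ag; rewrite -/g0 in a0 r0.
pose pX := perm (bij_inj (iXbij f)).
pose pV := perm (bij_inj (iVbij f)).
pose pE := perm (bij_inj (iEbij f)).
pose cp := cell_perm pX pV pE.
have cpK : cancel cp (cell_perm pX^-1 pV^-1 pE^-1).
  by move=> [[x|x]|x]; rewrite /= permK.
have cpK' : cancel (cell_perm pX^-1 pV^-1 pE^-1) cp.
  by move=> [[x|x]|x]; rewrite /= permKV.
pose L0 := [set (cp p.1, cp p.2) | p in g.2].
have L0E c d : ((cp c, cp d) \in L0) = ((c, d) \in g.2).
  apply/imsetP/idP => [[[c' d'] h /= [/(can_inj cpK) -> /(can_inj cpK) ->]] //|h].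
  by exists (c, d).
have tg : total_order g.2 by case/andP: ag.
have tg' : total_order g'.2 by case/andP: ag'.
have tL0 : total_order L0.
  case/and3P: tg => /forallP t1 /forallP t2 /forallP t3.
  apply/and3P; split.
  - by apply/forallP => c; rewrite -(cpK' c) L0E.
  - apply/forallP => a; apply/forallP => b; apply/forallP => c.
    rewrite -(cpK' a) -(cpK' b) -(cpK' c) !L0E.
    exact: (forallP (forallP (t2 _) _)).
  - apply/forallP => c; apply/forallP => d.
    rewrite -(cpK' c) -(cpK' d) !L0E (can_eq cpK); exact: (forallP (t3 _)).
have inc0 h : g'.1 (pE h.1, h.2) = vertex_perm pX pV (g0.1 h).
  rewrite flip_all_E ?enum_uniq // mem_enum.
  have := iinc f h.1 (h.2 (+) ifl f h.1); rewrite -addbA addbb addbF /= permE => ->.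
  rewrite -[_ \in _]/(ifl f h.1).
  by case: (g.1 _) => x /=; rewrite permE.
have r1 : gen g0 - gen (g'.1, L0) \in relations k n e m N.
  apply: (subvP iso_relations_sub); apply: memv_span.
  apply/imageP; exists (g0, (g'.1, L0)) => //=.
  rewrite inE a0 /=; apply/andP; split.
    by case/andP: ag' => h _; rewrite /admissible_ograph h.
  apply/existsP; exists pX; apply/existsP; exists pV; apply/existsP; exists pE.
  apply/andP; split; first by apply/forallP => h; rewrite inc0.
  by apply/forallP => c; apply/forallP => d; rewrite -/cp L0E.
have r2 : gen g' - koszul_sign m N L0 g'.2 *: gen (g'.1, L0) \in relations k n e m N.
  apply: (subvP order_relations_sub); apply: memv_span.
  apply/imageP; exists ((g'.1, L0), g'.2) => //=.
  by case/andP: ag' => h _; rewrite inE /= /admissible_ograph h tL0 tg'.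
set K := koszul_sign m N L0 g'.2 in r2.
have sE : isgn f = odd (size s) (+) inversions (@olt (obj g)) (@olt (obj g')) (iV f).
  congr addb; rewrite /s -cardE -sum1_card [X in odd X]big_mkcond.
  rewrite (big_morph odd (op1 := addb) (id1 := false)) //; last exact: oddD.
  by apply: eq_bigr => j _; rewrite -[j \in _]/(ifl f j); case: (ifl f j).
have KE : K = (-1) ^+ inversions (@olt (obj g)) (@olt (obj g')) (iV f).
  rewrite /K koszul_sign_inversions //; congr (_ ^+ nat_of_bool _).
  rewrite /inversions (reindex (fun p : 'I_n * 'I_n => (pV p.1, pV p.2))) /=; last first.
    by exists (fun p => ((pV^-1)%g p.1, (pV^-1)%g p.2)) => [[a b] _|[a b] _] /=; rewrite ?permK ?permKV.
  apply: eq_big => [[v w]|[v w] _] /=.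
    by rewrite -(L0E (inl (inr v)) (inl (inr w))) /=.
  by rewrite !permE.
rewrite sE signr_addb_rat signr_odd -KE mulrC.
have tel (a b c d : chain k n e) : a - d = (a - b) - (c - b) + (c - d).
  by rewrite opprB addrA (addrA (a - b)) subrK subrK.
rewrite -scalerA.
rewrite (tel _ (K *: gen (g'.1, L0)) (K *: gen g0)) -!scalerBr.
apply: memvD; last exact: memvZ r0.
by apply: memvB r2 _; exact: memvZ r1.
Qed.
End Relations.

(** * Theta graphs with hairs *)

(* A theta graph has two ends, inl false and inl true, and three strands from
   the first to the second; strand i has a i inner vertices, each of which bears
   a hair, and the end inl b bears one if d b.  tv a i p is the vertex number p
   of strand i, the ends being the numbers 0 and a i + 1. *)
Definition tvert (a : 'I_3 -> nat) : finType := (bool + {i : 'I_3 & 'I_(a i)})%type.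
Definition tedge (a : 'I_3 -> nat) : finType := {i : 'I_3 & 'I_(a i).+1}.

Definition tv a (i : 'I_3) (p : nat) : tvert a :=
  if p is q.+1 then
    if (insub q : option 'I_(a i)) is Some r then inr (Tagged (fun i => 'I_(a i)) r) else inl true
  else inl false.
Arguments tv : clear implicits.

Definition tinc a (e : tedge a) (b : bool) : tvert a := tv a (tag e) (tagged e + b).

Definition bearing a (d : bool -> bool) (v : tvert a) : bool :=
  if v is inl b then d b else true.

Definition thair a d : finType := {v : tvert a | bearing d v}.

(** The ends come first and the strands follow one after the other. Exchanging neighbouring strands
    then inverts only pairs between these two, and a new vertex at the start of the first strand has
    just the two ends before it. *)
Definition tlt a : rel (tvert a) := fun v w =>
  match v, w with
  | inl b, inl b' => ~~ b && b'
  | inl _, inr _ => true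
  | inr _, inl _ => false
  | inr s, inr t => (tag s < tag t)%N || (tag s == tag t) && (tagged s < tagged t)%N
  end.

Definition theta d a : ogr :=
  @Ogr (thair a d) (tvert a) (tedge a + thair a d)%type
    (fun e b => match e with
       | inl e => inr (tinc e b)
       | inr x => if b then inl x else inr (val x)
       end)
    (@tlt a).

Lemma tag_ord_eq (a : 'I_3 -> nat) (s t : {i : 'I_3 & 'I_(a i)}) :
  tag s = tag t -> tagged s = tagged t :> nat -> s = t.
Proof.
case: s t => i p [j q] /= eij; subst j => epq; congr Tagged; exact: val_inj.
Qed.

Lemma theta_tournament d a : tournament (@olt (theta d a)).
Proof.
move=> [b|s] [b'|t] //=; first by case: b b' => [] [].
rewrite (inj_eq (@inr_inj _ _)); case: (s =P t) => [->|ne] /=; first by rewrite !ltnn eqxx.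
case: s t ne => i p [j q] ne /=; rewrite -!(inj_eq val_inj) /=.
case: ltngtP => //= /val_inj eij; subst j.
by case: ltngtP => //= h; case: ne; apply: tag_ord_eq.
Qed.

Lemma tv0 a i : tv a i 0 = inl false. Proof. by []. Qed.

Lemma tvS a i p (H : (p < a i)%N) : tv a i p.+1 = inr (Tagged (fun i => 'I_(a i)) (Ordinal H)).
Proof. by rewrite /tv insubT. Qed.

Lemma tv_last a i p : (a i <= p)%N -> tv a i p.+1 = inl true.
Proof. by move=> h; rewrite /tv insubF // ltnNge h. Qed.

Lemma tv_strand a (s : {i : 'I_3 & 'I_(a i)}) : tv a (tag s) (tagged s).+1 = inr s.
Proof. by case: s => i [p hp]; exact: (tvS (a := a) (i := i) hp). Qed.

Lemma tv_inl_false a i p : tv a i p = inl false -> p = 0%N.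
Proof. by case: p => //= p; case: insub. Qed.

Lemma tv_inl_true a i p : tv a i p = inl true -> (a i < p)%N.
Proof. by case: p => //= p; case: insubP => // /[!ltnNge] /[!negbK]. Qed.

Lemma tv_inr a i p (s : {i : 'I_3 & 'I_(a i)}) : tv a i p = inr s -> tag s = i /\ p = (tagged s).+1.
Proof. by case: p => //= p; case: insubP => // q _ <- [<-]. Qed.

Lemma sub_bij (T T' : finType) (P : pred T) (P' : pred T') (f : T -> T')
    (H : forall v, P' (f v) = P v) : bijective f ->
  bijective (fun x : {v | P v} => exist (fun v => P' v) (f (val x)) (etrans (H _) (valP x))).
Proof.
move=> [g fK gK].
have H' w : P (g w) = P' w by rewrite -H gK.
exists (fun x : {v | P' v} => exist (fun v => P v) (g (val x)) (etrans (H' _) (valP x))) => x;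
  by apply: val_inj; rewrite /= ?fK ?gK.
Qed.

Lemma sum_bij (A B C D : Type) (f : A -> C) (g : B -> D) :
  bijective f -> bijective g -> bijective (sum_map f g).
Proof.
by move=> [f' fK f'K] [g' gK g'K]; exists (sum_map f' g') => -[x|x] /=; rewrite ?fK ?f'K ?gK ?g'K.
Qed.

(** The frame decides everything: a hair follows the vertex that bears it and stays directed
    outwards, so hairs contribute no sign. *)
Lemma theta_iso d a d' a' (fV : tvert a -> tvert a') (fE : tedge a -> tedge a')
    (fl : tedge a -> bool) :
  bijective fV -> bijective fE -> (forall v, bearing d' (fV v) = bearing d v) ->
  (forall e b, tinc (fE e) (b (+) fl e) = fV (tinc e b)) ->
  exists f : iso (theta d a) (theta d' a'),
    [/\ iV f =1 fV, forall e, iE f (inl e) = inl (fE e)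
      & isgn f = (\big[addb/false]_e fl e) (+) inversions (@tlt a) (@tlt a') fV].
Proof.
move=> bV bE hb hinc.
have bX := sub_bij hb bV.
set fX : thair a d -> thair a' d' := (fun x => _) in bX.
have bEE := sum_bij bE bX.
have H e b : oinc (o := theta d' a') (sum_map fE fX e) (b (+) (if e is inl e then fl e else false))
  = sum_map fX fV (@oinc (theta d a) e b).
  case: e => [e|x] /=; first by rewrite hinc.
  by rewrite addbF; case: b.
exists (@Iso (theta d a) (theta d' a') fX fV (sum_map fE fX) _ bX bV bEE H); split=> //.
by rewrite /isgn /=; congr addb; rewrite big_sumType /= [X in _ (+) X]big1 ?addbF.
Qed.

Lemma inversions_pair (T T' : finType) (r : rel T) (r' : rel T') (f : T -> T') :
  inversions r r' f = \big[addb/false]_v \big[addb/false]_w (r v w && ~~ r' (f v) (f w)).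
Proof.
rewrite pair_bigA /= /inversions big_mkcond /=; apply: eq_bigr => -[v w] _ /=.
by case: (r v w).
Qed.

Lemma big_tagged (a : 'I_3 -> nat) (F : {i : 'I_3 & 'I_(a i)} -> bool) :
  \big[addb/false]_s F s = \big[addb/false]_i \big[addb/false]_(p < a i) F (Tagged (fun i => 'I_(a i)) p).
Proof. by rewrite (sig_big_dep _ _ (fun i p => F (Tagged (fun i => 'I_(a i)) p))) /=; apply: eq_bigr => -[]. Qed.

Lemma big_addb_true n : \big[addb/false]_(p < n) true = odd n.
Proof. by elim: n => [|n IH]; rewrite ?big_ord0 // big_ord_recr /= IH addbT. Qed.

Definition tfirst (a : 'I_3 -> nat) (l : 'I_3) : tedge a := @Tagged _ l (fun l => 'I_(a l).+1) ord0.
Arguments tfirst : clear implicits.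

Section Relabel.
Variables (g : 'I_3 -> 'I_3) (gK : involutive g).

Definition retag (a a' : 'I_3 -> nat) (H : forall l, a' (g l) = a l)
    (s : {l : 'I_3 & 'I_(a l)}) : {l : 'I_3 & 'I_(a' l)} :=
  Tagged (fun l => 'I_(a' l)) (cast_ord (esym (H (tag s))) (tagged s)).

Lemma retag_bij a a' (H : forall l, a' (g l) = a l) : bijective (retag H).
Proof.
have H' l : a (g l) = a' l by rewrite -(H (g l)) gK.
by exists (retag H') => s; apply: tag_ord_eq; rewrite //= gK.
Qed.

Variables (a a' : 'I_3 -> nat) (H : forall l, a' (g l) = a l).

Lemma retagS : forall l, (a' (g l)).+1 = (a l).+1. Proof. by move=> l; rewrite H. Qed.

Definition relabel_vert (v : tvert a) : tvert a' := sum_map id (retag H) v.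

Definition relabel_edge (e : tedge a) : tedge a' :=
  @retag (fun l => (a l).+1) (fun l => (a' l).+1) retagS e.

Lemma relabel_tv l p : relabel_vert (tv a l p) = tv a' (g l) p.
Proof.
case: p => // p; have [h|h] := ltnP p (a l); last by rewrite !tv_last ?H.
have h' : (p < a' (g l))%N by rewrite H.
by rewrite !tvS /=; congr inr; apply: tag_ord_eq.
Qed.

Lemma relabel_iso d : exists f : iso (theta d a) (theta d a'),
  [/\ forall b, iV f (inl b) = inl b,
      forall l, iE f (inl (tfirst a l)) = inl (tfirst a' (g l))
    & isgn f = inversions (@tlt a) (@tlt a') relabel_vert].
Proof.
have bV : bijective relabel_vert by apply: sum_bij; [exists id|exact: retag_bij].
have bE : bijective relabel_edge by exact: retag_bij.
have hb v : bearing d (relabel_vert v) = bearing d v by case: v.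
have hi (e : tedge a) b : tinc (relabel_edge e) (b (+) false) = relabel_vert (tinc e b).
  by rewrite addbF relabel_tv.
have [f [h1 h2 h3]] := theta_iso (fl := fun=> false) bV bE hb hi.
exists f; split=> [b|l|]; first by rewrite h1.
  by rewrite h2; congr inl; apply: tag_ord_eq.
by rewrite h3 big1.
Qed.
End Relabel.

(** No edge is reversed, and as the two strands are neighbours in [tlt], the inverted pairs are
    those with one vertex in each: [a i] times [a j] of them. *)
Lemma swap_iso d (a a' : 'I_3 -> nat) (i j : 'I_3) : j = i.+1 :> nat ->
  (forall l, a' (tperm i j l) = a l) ->
  exists f : iso (theta d a) (theta d a'),
  [/\ forall b, iV f (inl b) = inl b,
      forall l, iE f (inl (tfirst a l)) = inl (tfirst a' (tperm i j l))
    & isgn f = odd (a i) && odd (a j)].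
Proof.
move=> ij H; have [f [h1 h2 h3]] := relabel_iso (tpermK i j) H d.
exists f; split=> //; rewrite h3 inversions_pair.
rewrite big_sumType /= big1 ?addFb; last first.
  by move=> b _; rewrite big_sumType /= !big1 // => b'; case: (b); case: (b').
transitivity (\big[addb/false]_(s : {l & 'I_(a l)}) \big[addb/false]_(t : {l & 'I_(a l)})
  ((tag s == i) && (tag t == j))).
  apply: eq_bigr => s _; rewrite big_sumType /= [X in X (+) _]big1 ?addFb //.
  apply: eq_bigr => t _; rewrite /= (inj_eq perm_inj).
  have : (tag s == tag t) && (tagged s < tagged t)%N && ~~ ((tag s == tag t) && (tagged s < tagged t)%N) = false.
    by case: (_ && (_ < _)%N).
  have [e|ne] := eqVneq (tag s) (tag t) => /= h.
    have -> : (tag s < tag t)%N = false by rewrite e ltnn.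
    have -> : (tperm i j (tag s) < tperm i j (tag t))%N = false by rewrite e ltnn.
    by rewrite /= h e; case: eqP => //= ->; case: eqP => // eij; move: ij; rewrite eij; lia.
  rewrite !orbF.
  move: ne; rewrite -!(inj_eq val_inj) /=.
  by case: tpermP => [->|->|/eqP + /eqP +]; case: tpermP => [->|->|/eqP + /eqP +];
    rewrite -?(inj_eq val_inj) /=; lia.
have cnt l : \big[addb/false]_(s : {l & 'I_(a l)}) (tag s == l) = odd (a l).
  rewrite big_tagged (bigD1 l) //= [X in _ (+) X]big1 ?addbF; last first.
    by move=> l' /negbTE ->; rewrite big1.
  by under eq_bigr do rewrite eqxx; rewrite big_addb_true.
rewrite -!cnt big_distrl /=; apply: eq_bigr => s _.
by rewrite big_distrr.
Qed.

Lemma big_addb_lt n : \big[addb/false]_(p < n) \big[addb/false]_(q < n) (p < q)%N = odd 'C(n, 2).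
Proof.
elim: n => [|n IH]; first by rewrite big_ord0.
rewrite big_ord_recr /= [X in _ (+) X]big1 ?addbF; last by move=> q _; have := ltn_ord q; lia.
rewrite binS bin1 oddD -IH -[odd n]big_addb_true -big_split /=; apply: eq_bigr => p _.
by rewrite big_ord_recr /= ltn_ord.
Qed.

(** The share of one strand in the sign of the exchange of the ends: C(n, 2) inversions of its
    vertices, n + 1 reversed edges, and [true] for the inversion of the two ends, which may be
    counted once per strand because 3 is odd. *)
Lemma odd_strand n : odd 'C(n, 2) (+) odd n.+1 (+) true = odd (uphalf n).
Proof.
suff : odd 'C(n, 2) = odd n (+) odd (uphalf n) by move=> ->; rewrite /=; case: (odd n); case: odd.
elim: n => // n IH; rewrite binS bin1 oddD IH /= uphalf_half.
by rewrite oddD oddb; case: (odd n); case: odd.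
Qed.

Section Flip.
Variables (a : 'I_3 -> nat) (d d' : bool -> bool) (Hd : forall b, d' (~~ b) = d b).

Definition flip_tag (a : 'I_3 -> nat) (s : {l : 'I_3 & 'I_(a l)}) : {l : 'I_3 & 'I_(a l)} :=
  Tagged (fun l => 'I_(a l)) (rev_ord (tagged s)).

Lemma flip_tagK a0 : involutive (@flip_tag a0).
Proof. by case=> l p; rewrite /flip_tag [tagged _]/= [tagged _]/= rev_ordK. Qed.

Definition flip_vert (v : tvert a) : tvert a := sum_map negb (@flip_tag a) v.

Lemma flip_tv l p : (p <= (a l).+1)%N -> flip_vert (tv a l p) = tv a l ((a l).+1 - p).
Proof.
case: p => [|p]; first by rewrite subn0 tv_last.
rewrite ltnS leq_eqVlt => /orP[/eqP ->|h]; first by rewrite subnn tv_last.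
have h' : ((a l) - p.+1 < a l)%N by lia.
rewrite subSS (_ : a l - p = (a l - p.+1).+1)%N; last by lia.
by rewrite !tvS /=; congr inr; apply: tag_ord_eq.
Qed.

Lemma flip_theta_iso : exists f : iso (theta d a) (theta d' a),
  (forall b, iV f (inl b) = inl (~~ b)) /\
  isgn f = \big[addb/false]_l odd (uphalf (a l)).
Proof.
have bV : bijective flip_vert by apply: sum_bij; [exists negb; exact: negbK|exact: inv_bij (@flip_tagK a)].
have bE : bijective (@flip_tag (fun l => (a l).+1)) by exact: inv_bij (@flip_tagK _).
have hb v : bearing d' (flip_vert v) = bearing d v by case: v => /=.
have hi (e : tedge a) b : tinc (@flip_tag (fun l => (a l).+1) e) (b (+) true) = flip_vert (tinc e b).
  rewrite /tinc flip_tv; last by have := ltn_ord (tagged e); case: b; lia.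
  congr tv; rewrite /=; have := ltn_ord (tagged e); case: b => /=; lia.
have [f [h1 h2 h3]] := theta_iso (fl := fun=> true) bV bE hb hi.
exists f; split=> [b|]; first by rewrite h1.
rewrite h3 inversions_pair [X in X (+) _](big_tagged (a := fun l => (a l).+1)).
rewrite [X in _ (+) X]big_sumType /=.
have -> : \big[addb/false]_b \big[addb/false]_(w : tvert a)
    (tlt (inl b) w && ~~ tlt (flip_vert (inl b)) (flip_vert w)) = true.
  by rewrite big_bool !big_sumType !big_bool /= !big1.
have -> : \big[addb/false]_(s : {l & 'I_(a l)}) \big[addb/false]_(w : tvert a)
    (tlt (inr s) w && ~~ tlt (flip_vert (inr s)) (flip_vert w)) =
   \big[addb/false]_l odd 'C(a l, 2).
  rewrite big_tagged; apply: eq_bigr => l _; rewrite -big_addb_lt; apply: eq_bigr => p _.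
  rewrite big_sumType /= [X in X (+) _]big1 ?addFb //.
  rewrite big_tagged (bigD1 l) //= [X in _ (+) X]big1 ?addbF.
    apply: eq_bigr => q _; rewrite /= ltnn eqxx /=; have := ltn_ord p; have := ltn_ord q; lia.
  move=> l' ll'; rewrite big1 // => q _ /=; rewrite -!(inj_eq val_inj) /= in ll' *; lia.
rewrite !big_ord_recl !big_ord0 /= !big_addb_true -!odd_strand /=.
by case: (odd _); case: (odd _); case: (odd _); case: (odd _); case: (odd _); case: (odd _).
Qed.
End Flip.

Arguments tv : simpl never.

Lemma tedge_eq a (e1 e2 : tedge a) : tag e1 = tag e2 ->
  tagged e1 = tagged e2 :> nat -> e1 = e2.
Proof. exact: tag_ord_eq. Qed.

(** * Rigidity of theta graphs with hairs *)

Section Rigidity.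
Variables (d d' : bool -> bool) (a a' : 'I_3 -> nat).
Variable f : iso (theta d a) (theta d' a').

Lemma iso_frame_edge (e : tedge a) : exists e' : tedge a', iE f (inl e) = inl e' /\
  forall b, tinc e' (b (+) ifl f (inl e)) = iV f (tinc e b).
Proof.
have h b : oinc (iE f (inl e)) (b (+) ifl f (inl e)) = inr (iV f (tinc e b)).
  by rewrite (iinc f).
case E : (iE f (inl e)) h => [e'|x] h.
  by exists e'; split=> // b; have := h b => -[].
by have := h (true (+) ifl f (inl e)); rewrite -addbA addbb.
Qed.

Lemma iso_hair (x : thair a d) : exists y : thair a' d',
  [/\ iE f (inr x) = inr y, ifl f (inr x) = false & iV f (val x) = val y].
Proof.
have h b : oinc (iE f (inr x)) (b (+) ifl f (inr x)) = sum_map (iX f) (iV f) (@oinc (theta d a) (inr x) b).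
  by rewrite (iinc f).
case E : (iE f (inr x)) h => [e'|y] h; first by have := h true.
exists y; have := h true; have := h false.
by case: (ifl f (inr x)) => //= -[].
Qed.

(** Three frame edges meet an end, all with their tails or all with their heads, whereas at an inner
    vertex only one frame edge starts and only one arrives. Of the three direction bits [c0], [c1],
    [c2] two agree, so the image of an end is not an inner vertex. *)
Lemma iso_end (b : bool) : exists b', iV f (inl b) = inl b'.
Proof.
case E : (iV f (inl b)) => [b'|s]; first by exists b'.
(* The position of the edge of strand [l] that touches the end [b]: the last one for [true], the
   first one for [false]. *)
pose p l := if b then a l else 0%N.
have hp l : (p l < (a l).+1)%N by rewrite /p; case: b {E p}.
pose e l : tedge a := @Tagged _ l (fun l => 'I_(a l).+1) (Ordinal (hp l)).
have he l : exists e' : tedge a', exists c, iE f (inl (e l)) = inl e' /\ tinc e' c = inr s.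
  have [e' [h1 h2]] := iso_frame_edge (e l); exists e', (b (+) ifl f (inl (e l))); split=> //.
  rewrite h2 -E; congr (iV f _); rewrite /tinc /= /p; case: b {E p hp e e' h1 h2} => //=.
  by rewrite addn1 tv_last.
have key l l' e1 e2 c : iE f (inl (e l)) = inl e1 -> iE f (inl (e l')) = inl e2 ->
    tinc e1 c = inr s -> tinc e2 c = inr s -> l = l'.
  move=> h1 h2 /tv_inr[t1 p1] /tv_inr[t2 p2].
  have e12 : e1 = e2 by apply: tedge_eq; [rewrite -t1|lia].
  have := bij_inj (iEbij f) (etrans h1 (esym (etrans h2 (congr1 inl (esym e12))))).
  by move=> [].
have [e0 [c0 [h0 k0]]] := he ord0.
have [e1 [c1 [h1 k1]]] := he (inord 1).
have [e2 [c2 [h2 k2]]] := he (inord 2).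
have v1 : @inord 2 1 = 1%N :> nat by rewrite inordK.
have v2 : @inord 2 2 = 2%N :> nat by rewrite inordK.
have n01 : c0 <> c1 by move=> E1; subst; have := congr1 val (key _ _ _ _ _ h0 h1 k0 k1); rewrite /= v1.
have n02 : c0 <> c2 by move=> E1; subst; have := congr1 val (key _ _ _ _ _ h0 h2 k0 k2); rewrite /= v2.
have n12 : c1 <> c2 by move=> E1; subst; have := congr1 val (key _ _ _ _ _ h1 h2 k1 k2); rewrite /= v1 v2.
by case: c0 c1 c2 n01 n02 n12 {k0 k1 k2} => [] [] [].
Qed.

Lemma iso_end_neg (b b' : bool) : iV f (inl b) = inl b' -> iV f (inl (~~ b)) = inl (~~ b').
Proof.
move=> E; have [c E'] := iso_end (~~ b); rewrite E'; congr inl.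
have : c <> b' by move=> E''; subst; have := bij_inj (iVbij f) (etrans E (esym E')) => -[]; case: (b).
by case: c b' {E E'} => [] [].
Qed.

Lemma iso_strand (b : bool) : iV f (inl false) = inl b ->
  forall s, exists s' : {l : 'I_3 & 'I_(a' l)}, iV f (inr s) = inr s'.
Proof.
move=> E s; have E' := iso_end_neg E.
case E'' : (iV f (inr s)) => [c|s']; last by exists s'.
have [ec|ec] : c = b \/ c = ~~ b by case: (c) (b) => [] []; auto.
  by rewrite ec in E''; have := bij_inj (iVbij f) (etrans E (esym E'')).
by rewrite ec in E''; have := bij_inj (iVbij f) (etrans E' (esym E'')).
Qed.

Lemma iso_first (l : 'I_3) : iV f (inl false) = inl false ->
  exists l', iE f (inl (tfirst a l)) = inl (tfirst a' l').
Proof.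
move=> E; have [e' [h1 h2]] := iso_frame_edge (tfirst a l).
have := h2 false; rewrite {2}/tinc /= E /tinc => /tv_inl_false h.
exists (tag e'); rewrite h1; congr inl; apply: tedge_eq => //.
by move/eqP: h; rewrite addn_eq0 => /andP[/eqP -> _].
Qed.

Hypotheses (E0 : iV f (inl false) = inl false)
  (Ef : forall l, iE f (inl (tfirst a l)) = inl (tfirst a' l)).

(** Induction along the strand: the next edge leaves the vertex at which the previous one arrives.
    If it were reversed, it would have the same image as the previous edge, since only one frame
    edge of the target arrives at an inner vertex. *)
Lemma iso_step l p (hp : (p < (a l).+1)%N) : exists hp' : (p < (a' l).+1)%N,
  iE f (inl (@Tagged _ l (fun l => 'I_(a l).+1) (Ordinal hp))) =
    inl (@Tagged _ l (fun l => 'I_(a' l).+1) (Ordinal hp')) /\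
  ifl f (inl (@Tagged _ l (fun l => 'I_(a l).+1) (Ordinal hp))) = false.
Proof.
elim: p hp => [|p IH] hp.
  exists (ltn0Sn _).
  have := Ef l; rewrite /tfirst => h.
  have eo : Ordinal hp = ord0 by apply: val_inj.
  rewrite eo h; split; first by congr (inl (Tagged _ _)); apply: val_inj.
  have [e' [h1 h2]] := iso_frame_edge (tfirst a l).
  have := h2 false; rewrite {2}/tinc /= E0 /tinc => /tv_inl_false.
  by rewrite /tfirst; case: (ifl f _) => //=; rewrite addn1.
have hpa : (p < (a l).+1)%N by lia.
have [hp' [h1 h2]] := IH hpa.
have [e' [h3 h4]] := iso_frame_edge (@Tagged _ l (fun l => 'I_(a l).+1) (Ordinal hpa)).
move: h3; rewrite h1 => -[?]; subst e'.
have pl : (p < a l)%N by [].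
have := h4 true; rewrite h2 /tinc /= !addn1 (tvS pl) => h5.
have [s' hs'] := iso_strand E0 (@Tagged _ l (fun l => 'I_(a l)) (Ordinal pl)).
move: h5; rewrite hs' => h5.
have [t5 p5] := tv_inr h5.
have [e'' [h6 h7]] := iso_frame_edge (@Tagged _ l (fun l => 'I_(a l).+1) (Ordinal hp)).
have := h7 false; rewrite /= {2}/tinc /= addn0 (tvS pl) hs' /tinc => h8.
have [t8 p8] := tv_inr h8.
have nfl : ifl f (inl (@Tagged _ l (fun l => 'I_(a l).+1) (Ordinal hp))) = false.
  apply/negP => fl; rewrite fl addn1 in p8.
  have e12 : e'' = @Tagged _ l (fun l => 'I_(a' l).+1) (Ordinal hp').
    by apply: tedge_eq; [rewrite -t8 t5|move: p8 p5 => /= ? ?; lia].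
  have := bij_inj (iEbij f) (etrans h1 (esym (etrans h6 (congr1 inl e12)))).
  move=> h9; have := congr1 (fun x : oE (theta d a) => if x is inl e then nat_of_ord (tagged e) else 0%N) h9.
  by move=> /=; lia.
rewrite nfl addn0 in p8.
have te : tag e'' = l by rewrite -t8 t5.
have hq : (p.+1 < (a' l).+1)%N.
  by have := ltn_ord (tagged e''); rewrite -te; move: p8 p5 => /= ? ? ?; lia.
exists hq; split=> //; rewrite h6; congr inl; apply: tedge_eq => //.
by move: p8 p5 => /= ? ?; lia.
Qed.

Lemma iso_rigid_vert (s : {l : 'I_3 & 'I_(a l)}) : exists s' : {l : 'I_3 & 'I_(a' l)},
  [/\ iV f (inr s) = inr s', tag s' = tag s & tagged s' = tagged s :> nat].
Proof.
case: s => l [p hp].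
have hp1 : (p < (a l).+1)%N by lia.
have [hp' [h1 h2]] := iso_step hp1.
have [e' [h3 h4]] := iso_frame_edge (@Tagged _ l (fun l => 'I_(a l).+1) (Ordinal hp1)).
move: h3; rewrite h1 => -[?]; subst e'.
have := h4 true; rewrite h2 /tinc /= !addn1 (tvS hp).
have [s' ->] := iso_strand E0 (@Tagged _ l (fun l => 'I_(a l)) (Ordinal hp)).
by move/tv_inr => [t5 p5]; exists s'; split=> //=; lia.
Qed.

(** That the last edge of the strand has an image at the same position gives one inequality; that
    the head of this image is the end [true] gives the other. *)
Lemma iso_rigid_size l : a' l = a l.
Proof.
have hp1 : (a l < (a l).+1)%N by [].
have [hp' [h1 h2]] := iso_step hp1.
have [e' [h3 h4]] := iso_frame_edge (@Tagged _ l (fun l => 'I_(a l).+1) (Ordinal hp1)).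
move: h3; rewrite h1 => -[?]; subst e'.
have := h4 true; rewrite h2 /tinc /= !addn1 (tv_last (leqnn _)) (iso_end_neg E0).
move=> /tv_inl_true; lia.
Qed.

Lemma iso_rigid_sgn : isgn f = false.
Proof.
rewrite /isgn big_sumType /= !big1 /=.
- rewrite /inversions big1 // => -[[b|s] [c|t]] /= lt.
  + case: b c lt => [] [] //= _; rewrite E0.
    by have := iso_end_neg E0 => /= ->.
  + have [t' [-> _ _]] := iso_rigid_vert t.
    by case: b {lt}; rewrite ?E0 // (iso_end_neg E0).
  + by [].
  + have [t' [-> e1 e2]] := iso_rigid_vert t; have [s' [-> e3 e4]] := iso_rigid_vert s.
    pose lex (i j p q : nat) := (i < j)%N || (i == j) && (p < q)%N.
    apply/negbF; change (is_true (lex (tag s') (tag t') (tagged s') (tagged t'))).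
    by rewrite e2 e4 e1 e3.
- by move=> x _; have [y [_ -> _]] := iso_hair x.
- by move=> [l [p hp]] _; have [? [_ ->]] := iso_step hp.
Qed.
End Rigidity.

Lemma iso_bearing d d' a a' (f : iso (theta d a) (theta d' a')) b b' :
  iV f (inl b) = inl b' -> d' b' = d b.
Proof.
have half e e' c c' (g : iso (theta e c) (theta e' c')) l l' : iV g (inl l) = inl l' -> e l -> e' l'.
  move=> E hl; have [[v hv] [_ _]] := iso_hair g (exist _ (inl l) hl).
  by rewrite /= E => ev; move: hv; rewrite -ev.
move=> E; apply/idP/idP; last exact: half E.
have [g [_ gK _ _]] := iso_sym f (@theta_tournament _ _) (@theta_tournament _ _).
by apply: (half _ _ _ _ g); rewrite -E gK.
Qed.

Definition tri (a b c : nat) (l : 'I_3) : nat := nth 0%N [:: a; b; c] l.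

Definition Th (d0 d1 : bool) (a b c : nat) : ogr :=
  theta (fun i => if i then d1 else d0) (tri a b c).

(* The parity of the exchange of the two ends, which reverses every strand. *)
Definition tau (a b c : nat) : bool := odd (uphalf a) (+) odd (uphalf b) (+) odd (uphalf c).

(** The law is imposed for generators of the isomorphisms of theta graphs; [rigidity] extends it to
    all isomorphisms. *)
Record theta_invariant (F : bool -> bool -> nat -> nat -> nat -> rat) : Prop := Invariant {
  inv01 : forall d0 d1 a b c, F d0 d1 b a c = (-1) ^+ (odd a && odd b) * F d0 d1 a b c;
  inv12 : forall d0 d1 a b c, F d0 d1 a c b = (-1) ^+ (odd b && odd c) * F d0 d1 a b c;
  inv_flip : forall d0 d1 a b c, F d1 d0 a b c = (-1) ^+ tau a b c * F d0 d1 a b c }.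

Definition i0 : 'I_3 := @Ordinal 3 0 isT.
Definition i1 : 'I_3 := @Ordinal 3 1 isT.
Definition i2 : 'I_3 := @Ordinal 3 2 isT.

Lemma ord3P (P : 'I_3 -> Prop) : P i0 -> P i1 -> P i2 -> forall l, P l.
Proof.
move=> h0 h1 h2 [[|[|[|l]]] hl] //.
- by rewrite (_ : Ordinal hl = i0) //; apply: val_inj.
- by rewrite (_ : Ordinal hl = i1) //; apply: val_inj.
- by rewrite (_ : Ordinal hl = i2) //; apply: val_inj.
Qed.

Lemma swap01_iso d0 d1 a b c : exists f : iso (Th d0 d1 b a c) (Th d0 d1 a b c),
  [/\ forall l, iV f (inl l) = inl l,
      forall l, iE f (inl (tfirst _ l)) = inl (tfirst _ (tperm i0 i1 l))
    & isgn f = odd a && odd b].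
Proof.
have H l : tri a b c (tperm i0 i1 l) = tri b a c l.
  by move: l; apply: ord3P; rewrite ?tpermL ?tpermR ?tpermD.
have [f [h1 h2 h3]] := swap_iso (fun i => if i then d1 else d0) (erefl : i1 = i0.+1 :> nat) H.
by exists f; split=> //; rewrite h3 andbC.
Qed.

Lemma swap12_iso d0 d1 a b c : exists f : iso (Th d0 d1 a c b) (Th d0 d1 a b c),
  [/\ forall l, iV f (inl l) = inl l,
      forall l, iE f (inl (tfirst _ l)) = inl (tfirst _ (tperm i1 i2 l))
    & isgn f = odd b && odd c].
Proof.
have H l : tri a b c (tperm i1 i2 l) = tri a c b l.
  by move: l; apply: ord3P; rewrite ?tpermL ?tpermR ?tpermD.
have [f [h1 h2 h3]] := swap_iso (fun i => if i then d1 else d0) (erefl : i2 = i1.+1 :> nat) H.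
by exists f; split=> //; rewrite h3 andbC.
Qed.

Lemma flip_iso_Th d0 d1 a b c : exists f : iso (Th d1 d0 a b c) (Th d0 d1 a b c),
  (forall l, iV f (inl l) = inl (~~ l)) /\ isgn f = tau a b c.
Proof.
have Hd i : (if ~~ i then d1 else d0) = (if i then d0 else d1) by case: i.
have [f [h1 h2]] := @flip_theta_iso (tri a b c) (fun i => if i then d0 else d1)
  (fun i => if i then d1 else d0) Hd.
by exists f; split=> //; rewrite h2 !big_ord_recl big_ord0 /= addbF addbA.
Qed.

(* An isomorphism of theta graphs is, up to the strand swaps and the flip,
   the identity. *)
Lemma rigidity F d0 d1 a b c d0' d1' a' b' c' (f : iso (Th d0 d1 a b c) (Th d0' d1' a' b' c')) :
  theta_invariant F -> F d0' d1' a' b' c' = (-1) ^+ isgn f * F d0 d1 a b c.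
Proof.
move=> FI.
(* [C s] is the claim for isomorphisms that fix the ends and permute the strands by [s]. For the
   identity it is the rigid case; [C01] and [C12] precompose with a swap, and each of the six
   permutations is a product of swaps. *)
pose C (s : 'I_3 -> 'I_3) := forall d0 d1 a b c (f : iso (Th d0 d1 a b c) (Th d0' d1' a' b' c')),
  iV f (inl false) = inl false ->
  (forall l, iE f (inl (tfirst _ l)) = inl (tfirst _ (s l))) ->
  F d0' d1' a' b' c' = (-1) ^+ isgn f * F d0 d1 a b c.
have tT := theta_tournament.
have Cid (s : 'I_3 -> 'I_3) : s =1 id -> C s.
  move=> sid {}d0 {}d1 {}a {}b {}c {}f E0 Ef.
  have Ef' l : iE f (inl (tfirst _ l)) = inl (tfirst _ l) by rewrite Ef sid.
  have e0 : a' = a := iso_rigid_size E0 Ef' i0.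
  have e1 : b' = b := iso_rigid_size E0 Ef' i1.
  have e2 : c' = c := iso_rigid_size E0 Ef' i2.
  have e3 : d0' = d0 := iso_bearing E0.
  have e4 : d1' = d1 := iso_bearing (iso_end_neg E0).
  by rewrite (iso_rigid_sgn E0 Ef') mul1r e0 e1 e2 e3 e4.
have C01 (s : 'I_3 -> 'I_3) : C (s \o tperm i0 i1) -> C s.
  move=> Cs {}d0 {}d1 {}a {}b {}c {}f E0 Ef.
  have [g [g1 g2 g3]] := swap01_iso d0 d1 a b c.
  rewrite (Cs _ _ _ _ _ (iso_comp f g)) /= ?g1 //; last by move=> l; rewrite g2 Ef.
  rewrite (isgn_comp _ _ (tT _ _) (tT _ _) (tT _ _)) g3 (inv01 FI) mulrA -signr_addb.
  by case: (_ && _) (isgn f) => [] [].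
have C12 (s : 'I_3 -> 'I_3) : C (s \o tperm i1 i2) -> C s.
  move=> Cs {}d0 {}d1 {}a {}b {}c {}f E0 Ef.
  have [g [g1 g2 g3]] := swap12_iso d0 d1 a b c.
  rewrite (Cs _ _ _ _ _ (iso_comp f g)) /= ?g1 //; last by move=> l; rewrite g2 Ef.
  rewrite (isgn_comp _ _ (tT _ _) (tT _ _) (tT _ _)) g3 (inv12 FI) mulrA -signr_addb.
  by case: (_ && _) (isgn f) => [] [].
have Call (s : 'I_3 -> 'I_3) : injective s -> C s.
  move=> si.
  have c01 l : tperm i0 i1 l = if l == i0 then i1 else if l == i1 then i0 else l.
    by move: l; apply: ord3P; rewrite ?tpermL ?tpermR ?tpermD.
  have c12 l : tperm i1 i2 l = if l == i1 then i2 else if l == i2 then i1 else l.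
    by move: l; apply: ord3P; rewrite ?tpermL ?tpermR ?tpermD.
  have n01 : s i0 <> s i1 by move/si.
  have n02 : s i0 <> s i2 by move/si.
  have n12 : s i1 <> s i2 by move/si.
  have fin (s' : 'I_3 -> 'I_3) : s' i0 = i0 -> s' i1 = i1 -> s' i2 = i2 -> C s'.
    by move=> h0 h1 h2; apply: Cid; apply: ord3P.
  have [e0|[e0|e0]] : s i0 = i0 \/ s i0 = i1 \/ s i0 = i2 by move: (s i0); apply: ord3P; auto.
  - have [e1|[e1|e1]] : s i1 = i0 \/ s i1 = i1 \/ s i1 = i2 by move: (s i1); apply: ord3P; auto.
    + by rewrite e0 e1 in n01.
    + have [e2|[e2|e2]] : s i2 = i0 \/ s i2 = i1 \/ s i2 = i2 by move: (s i2); apply: ord3P; auto.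
      * by rewrite e0 e2 in n02.
      * by rewrite e1 e2 in n12.
      * exact: fin.
    + have [e2|[e2|e2]] : s i2 = i0 \/ s i2 = i1 \/ s i2 = i2 by move: (s i2); apply: ord3P; auto.
      * by rewrite e0 e2 in n02.
      * by apply: C12; apply: fin; rewrite /= ?c12 /= ?c12.
      * by rewrite e1 e2 in n12.
  - have [e1|[e1|e1]] : s i1 = i0 \/ s i1 = i1 \/ s i1 = i2 by move: (s i1); apply: ord3P; auto.
    + have [e2|[e2|e2]] : s i2 = i0 \/ s i2 = i1 \/ s i2 = i2 by move: (s i2); apply: ord3P; auto.
      * by rewrite e1 e2 in n12.
      * by rewrite e0 e2 in n02.
      * by apply: C01; apply: fin; rewrite /= ?c01.
    + by rewrite e0 e1 in n01.
    + have [e2|[e2|e2]] : s i2 = i0 \/ s i2 = i1 \/ s i2 = i2 by move: (s i2); apply: ord3P; auto.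
      * by apply: C12; apply: C01; apply: fin; rewrite /= c01 /= c12.
      * by rewrite e0 e2 in n02.
      * by rewrite e1 e2 in n12.
  - have [e1|[e1|e1]] : s i1 = i0 \/ s i1 = i1 \/ s i1 = i2 by move: (s i1); apply: ord3P; auto.
    + have [e2|[e2|e2]] : s i2 = i0 \/ s i2 = i1 \/ s i2 = i2 by move: (s i2); apply: ord3P; auto.
      * by rewrite e1 e2 in n12.
      * by apply: C01; apply: C12; apply: fin; rewrite /= c12 /= c01.
      * by rewrite e0 e2 in n02.
    + have [e2|[e2|e2]] : s i2 = i0 \/ s i2 = i1 \/ s i2 = i2 by move: (s i2); apply: ord3P; auto.
      * by apply: (C01); apply: C12; apply: (C01); apply: fin; rewrite /= c01 /= c12 /= c01.
      * by rewrite e1 e2 in n12.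
      * by rewrite e0 e2 in n02.
    + by rewrite e0 e1 in n01.
have main x0 x1 x2 x3 x4 (g : iso (Th x0 x1 x2 x3 x4) (Th d0' d1' a' b' c')) :
    iV g (inl false) = inl false -> F d0' d1' a' b' c' = (-1) ^+ isgn g * F x0 x1 x2 x3 x4.
  move=> E0.
  (* The permutation of the strands is read off from their first edges. *)
  have P l : exists l', iE g (inl (tfirst _ l)) == inl (tfirst _ l').
    by have [l' ->] := iso_first l E0; exists l'.
  apply: (Call (fun l => xchoose (P l)) _ _ _ _ _ _ g E0) => [l l' E|l]; last exact/eqP/(xchooseP (P l)).
  have h1 := eqP (xchooseP (P l)); have h2 := eqP (xchooseP (P l')).
  rewrite /= in E; rewrite E -h2 in h1; have := bij_inj (iEbij g) h1.
  exact: (congr1 (fun x : oE (Th x0 x1 x2 x3 x4) => if x is inl e then tag e else i0)).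
have [[] E] := iso_end f false; last exact: main.
have [g [g1 g2]] := flip_iso_Th d0 d1 a b c.
have E' := iso_end_neg E.
rewrite (main _ _ _ _ _ (iso_comp f g)); last by rewrite /= g1 /= E'.
rewrite (isgn_comp _ _ (tT _ _) (tT _ _) (tT _ _)) g2 (inv_flip FI) mulrA -signr_addb.
by case: (tau _ _ _) (isgn f) => [] [].
Qed.

(** * Two-loop hairy graphs are theta graphs with hairs *)

Arguments incident : simpl never.

Section Components.
Variables (k n e : nat) (G : graph k n e).
Implicit Types (S A : {set cell k n e}) (c : cell k n e) (h : halfedge e).

Definition opph h : halfedge e := (h.1, ~~ h.2).

Lemma opphK : involutive opph.
Proof. by case=> j b; rewrite /opph /= negbK. Qed.

Lemma same_edge h h' : h.1 = h'.1 -> h' = h \/ h' = opph h.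
Proof. by case: h h' => j [] [j' []] /= ->; auto. Qed.

Lemma incident_sym c d : incident G c d = incident G d c.
Proof. by case: c d => [x|j] [y|j']. Qed.

Lemma incident_in_sym S c d : incident_in G S c d = incident_in G S d c.
Proof. by apply/and3P/and3P => -[h1 h2 h3]; split=> //; rewrite incident_sym. Qed.

Lemma connect_in_sym S : connect_sym (incident_in G S).
Proof. exact/sym_connect_sym/incident_in_sym. Qed.

Lemma connected_in1 S c : c \in S -> (forall d, d \in S -> connect (incident_in G S) c d) ->
  #|components G S| = 1%N.
Proof.
move=> cS H; suff -> : components G S = [set S] by rewrite cards1.
apply/setP => T; rewrite inE; apply/imsetP/eqP => [[d dS ->]|->].
  apply/setP => x; rewrite inE; case xS : (x \in S) => //=.
  by apply: (@connect_trans _ _ c); rewrite ?H // connect_in_sym H.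
exists c => //; apply/setP => x; rewrite inE; case xS : (x \in S) => //=.
by rewrite H.
Qed.

Lemma components_connect S c d : (#|components G S| <= 1)%N -> c \in S -> d \in S ->
  connect (incident_in G S) c d.
Proof.
move=> h cS dS.
pose C x := [set y in S | connect (incident_in G S) x y].
have memC x : x \in S -> C x \in components G S by move=> xS; apply/imsetP; exists x.
have E : C c = C d.
  apply/eqP; case: (C c =P C d) => // ne.
  have sub : [set C c; C d] \subset components G S by rewrite subUset !sub1set !memC.
  by have := leq_trans (subset_leq_card sub) h; rewrite cards2 (introF eqP ne).
have : d \in C d by rewrite inE dS connect0.
by rewrite -E inE => /andP[].
Qed.

Lemma components_closed S A c d : (#|components G S| <= 1)%N ->
  (forall x y, incident_in G S x y -> x \in A -> y \in A) ->
  c \in S -> c \in A -> d \in S -> d \in A.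
Proof.
move=> h cl cS cA dS; have := components_connect h cS dS.
move/connectP => [p + ->]; elim: p c {cS h dS} cA => //= x p IH c cA /andP[cx].
by apply: IH; apply: cl cx cA.
Qed.

Lemma connected_closed A c : connected_space G [set: cell k n e] ->
  (forall x y, incident G x y -> x \in A -> y \in A) -> c \in A -> A = setT.
Proof.
move=> /eqP conn cl cA; apply/setP => d; rewrite inE.
apply: (components_closed (S := setT) (c := c)); rewrite ?inE ?conn // => x y.
by case/and3P => _ _; apply: cl.
Qed.

Lemma incident_half h : incident G (inl (G h)) (inr h.1).
Proof. by apply/existsP; exists h.2; case: h. Qed.

Lemma incidentP x j : reflect (exists b, G (j, b) = x) (incident G (inl x) (inr j)).
Proof. by apply: (iffP existsP) => -[b hb]; exists b; apply/eqP. Qed.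

Lemma valence1_unique x h h' : valence G x = 1%N -> G h = x -> G h' = x -> h = h'.
Proof.
move=> /eqP/cards1P[h0 E] hx h'x.
have : h \in halfedges G x by rewrite inE hx.
have : h' \in halfedges G x by rewrite inE h'x.
by rewrite E !inE => /eqP -> /eqP ->.
Qed.

(** Without the edge of [h] the graph falls into the leaf, which is a tree, and the rest, which has
    one edge and one vertex less and so keeps its two loops. *)
Lemma leaf_tree_type (i : 'I_k) (v : 'I_n) h :
  connected_space G setT -> betti1 G setT = 2 -> valence G (inl i) = 1%N ->
  G h = inl i -> G (opph h) = inr v -> tree_type G h.1.
Proof.
move=> conn betti val hi hv.
set j := h.1.
have only b : G (j, b) = inl i -> b = h.2.
  by move=> E; have := valence1_unique val hi E; case: h @j {hi hv E} => j' b' /= [].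
pose ci : cell k n e := inl (inl i).
pose y : cell k n e := inl (inr v).
set S := [set: cell k n e] :\ inr j.
pose A := [set ci]; pose B := S :\ ci.
have iS : ci \in S by rewrite !inE.
have yB : y \in B by rewrite !inE.
have isoi d : ~~ incident_in G S ci d.
  apply/negP => /and3P[_]; case: d => // j'.
  rewrite !inE => /andP[jj _] /existsP[b /eqP hb].
  have := valence1_unique val hi hb; move=> E; move: jj; rewrite (_ : j = j') ?eqxx //.
  by rewrite /j E.
(* [r] retracts the graph onto the second part by sending the leaf and its edge to their neighbour
   [y]; it turns every path into one that avoids the edge. *)
pose r c := if (c == ci) || (c == inr j) then y else c.
have rB c : r c \in B by rewrite /r; case: ifP => // /norP[h1 h2]; rewrite !inE h1 h2.
have rstep c d : incident G c d -> connect (incident_in G S) (r c) (r d).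
  wlog : c d / exists x j', c = inl x /\ d = inr j'.
    move=> H; case: c d => [x|j'] [x'|j''] // cd; first by apply: H => //; exists x, j''.
    by rewrite connect_in_sym; apply: H; [exists x', j'|rewrite incident_sym].
  move=> [x [j' [-> ->]]] /incidentP[b hb]; rewrite /r /=.
  move: hb; have [->|jj] := eqVneq j' j => hb.
    rewrite eqxx; case: ifP => // /norP[xi _].
    have bh : b = ~~ h.2.
      case: (b =P h.2) => [bb|]; last by case: (b) (h.2) => [] [].
      by move: hb xi; rewrite bb /j -surjective_pairing hi => <-; rewrite eqxx.
    by rewrite -hb bh -[(j, _)]/(opph h) hv connect0.
  have nj : (inr j' == inr j :> cell k n e) = false by rewrite (inj_eq (@inr_inj _ _)) (negbTE jj).
  rewrite nj /=; case: ifP => [|/norP[xi _]].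
    rewrite orbF => /eqP[xi]; move: hb; rewrite xi => /(valence1_unique val hi) E.
    by rewrite /j E eqxx in jj.
  apply: connect1; apply/and3P; split; rewrite ?inE // ?andbT ?(inj_eq (@inr_inj _ _)) //.
  by apply/incidentP; exists b.
have conB c d : c \in B -> d \in B -> connect (incident_in G S) c d.
  have rid x : x \in B -> r x = x.
    by rewrite !inE /r => /and3P[/negbTE -> /negbTE ->].
  move=> cB dB; rewrite -(rid c) // -(rid d) //.
  have := components_connect (S := setT) (c := c) (d := d).
  rewrite (eqP conn) !inE => /(_ isT isT isT) /connectP[p + ->].
  elim: p c {cB dB rid} => //= x p IH c /andP[cx /IH]; apply: connect_trans.
  by apply: rstep; case/and3P: cx.
have compA : [set d in S | connect (incident_in G S) ci d] = A.
  apply/setP => d; rewrite !inE; apply/andP/eqP => [[dS]|->]; last by rewrite connect0.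
  case/connectP => -[|x p] /=; first by move=> _ ->.
  by case/andP => cx; have := isoi x; rewrite cx.
have compB c : c \in B -> [set d in S | connect (incident_in G S) c d] = B.
  move=> cB; apply/setP => d; rewrite inE; apply/andP/idP => [[dS cd]|dB].
    rewrite in_setD1 dS andbT; apply/eqP => dci; move: cd.
    rewrite dci connect_in_sym => /connectP[[|x p]] /=.
      by move=> _ E; rewrite E !inE eqxx in cB.
    by case/andP => cx; have := isoi x; rewrite cx.
  by split; [move: dB; rewrite inE => /andP[]|exact: conB].
have AB : A != B by apply/eqP => E; move: yB; rewrite -E inE.
have parts : components G S = [set A; B].
  apply/setP => T; rewrite !inE; apply/imsetP/orP => [[c cS ->]|].
    have [->|cc] := eqVneq c ci; [left|right]; first by rewrite compA.
    by rewrite compB // in_setD1 cc.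
  case=> /eqP ->; first by exists ci; rewrite ?compA.
  by exists y; rewrite ?compB //; move: yB; rewrite inE => /andP[].
have compsA : #|components G A| = 1%N.
  by apply: (@connected_in1 A ci); rewrite ?inE // => d; rewrite inE => /eqP ->; rewrite connect0.
have treeA : is_tree G A.
  rewrite /is_tree /connected_space compsA eqxx /betti1 compsA.
  have -> : [set j | inr j \in A] = set0 by apply/setP => x; rewrite !inE.
  have -> : [set x | inl x \in A] = [set inl i] by apply/setP => x; rewrite !inE.
  by rewrite cards0 cards1.
have treeB : is_tree G B = false.
  apply/negP => /andP[_]; rewrite /betti1.
  have : (0 < #|components G B|)%N.
    by apply/card_gt0P; exists [set d in B | connect (incident_in G B) y d]; apply/imsetP; exists y.
  have -> : [set j | inr j \in B] = [set~ j].
    by apply/setP => x; rewrite !inE andbT /= (inj_eq (@inr_inj _ _)).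
  have -> : [set x | inl x \in B] = [set~ inl i].
    by apply/setP => x; rewrite !inE !andbT (inj_eq (@inl_inj _ _)).
  move: betti; rewrite /betti1 (eqP conn).
  have -> : [set j | inr j \in [set: cell k n e]] = setT by apply/setP => x; rewrite !inE.
  have -> : [set x | inl x \in [set: cell k n e]] = setT by apply/setP => x; rewrite !inE.
  have := cardsC1 (inl i : vertex k n); have := cardsC1 j.
  rewrite !cardsT card_sum !card_ord => -> -> .
  have := ltn_ord i; have := ltn_ord j; lia.
rewrite /tree_type -/j -/S parts cards2 AB /=.
rewrite (_ : [set _ in _ | _] = [set A]) ?cards1 //.
apply/setP => T; rewrite !inE; case: eqP => [->|_] /=; first by rewrite treeA.
by case: eqP => [->|].
Qed.
End Components.

Section Classification.
Variables (k n e : nat) (G : graph k n e).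
Hypothesis hairyG : two_loop_hairy G.

Definition ext_vertex (x : vertex k n) : bool := if x is inl _ then true else false.
Definition int_edge (j : 'I_e) : bool := ~~ ext_vertex (G (j, false)) && ~~ ext_vertex (G (j, true)).

Let conn : connected_space G setT. Proof. by case/and4P: hairyG => /and4P[]. Qed.
Let k_gt0 : (0 < k)%N. Proof. by case/and4P: hairyG => /and4P[]. Qed.
Let val1 i : valence G (inl i) = 1%N.
Proof. by case/and4P: hairyG => /and4P[_ _ /forallP/(_ i)/eqP]. Qed.
Let val3 v : (3 <= valence G (inr v))%N.
Proof. by case/and4P: hairyG => /and4P[_ _ _ /forallP]. Qed.
Let betti : betti1 G setT = 2. Proof. by case/and4P: hairyG => _ /eqP. Qed.
Let nocut x : ~~ cut_vertex G (frame G) x. Proof. by case/and4P: hairyG => _ _ /forallP. Qed.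
Let hairs j : tree_type G j -> is_hair G j.
Proof. by case/and4P: hairyG => _ _ _ /forallP/(_ j)/implyP. Qed.

Let euler : (e + 1 = k + n + 2)%N.
Proof.
move: betti; rewrite /betti1 (eqP conn).
have -> : [set j | inr j \in [set: cell k n e]] = setT by apply/setP => j; rewrite !inE.
have -> : [set x | inl x \in [set: cell k n e]] = setT by apply/setP => j; rewrite !inE.
by rewrite !cardsT card_sum !card_ord; lia.
Qed.

(** An edge between two external vertices would be the whole graph, since its three cells are closed
    under incidence; but e = k + n + 1 is at least 2. *)
Lemma ext_opp h i : G h = inl i -> exists v, G (opph h) = inr v.
Proof.
move=> hi; case E : (G (opph h)) => [i'|v]; last by exists v.
pose A : {set cell k n e} := [set inl (inl i); inl (inl i'); inr h.1].
have AT : A = setT.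
  apply: (connected_closed (c := inl (inl i)) conn); last by rewrite !inE eqxx.
  have half x h' : G h' = x -> x \in [:: inl i; inl i'] -> h'.1 = h.1.
    move=> h'x; rewrite !inE => /orP[]/eqP ex; rewrite ex in h'x.
      by rewrite (valence1_unique (val1 i) h'x hi).
    by rewrite (valence1_unique (val1 i') h'x E).
  move=> [x|j] [y|j'] // inc.
    have [b hb] := incidentP _ _ _ inc.
    rewrite !inE !orbF => xA; apply/eqP; congr inr; apply: (half _ (j', b) hb).
    by rewrite !inE; move: xA; rewrite !(inj_eq (@inl_inj _ _)).
  rewrite incident_sym in inc; have [b hb] := incidentP _ _ _ inc.
  rewrite !inE /= (inj_eq (@inr_inj _ _)) => /eqP jh; rewrite !(inj_eq (@inl_inj _ _)) orbF -hb.
  have [->|->] := same_edge (h := h) (h' := (j, b)) (esym jh); first by rewrite hi eqxx.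
  by rewrite E eqxx orbT.
have e1 j : j = h.1.
  by have : inr j \in A; [rewrite AT inE|rewrite !inE /= (inj_eq (@inr_inj _ _)) => /eqP].
have : (e <= 1)%N.
  by rewrite -(card_ord e) -cardsT -(cards1 h.1); apply/subset_leq_card/subsetP => j _; rewrite inE (e1 j).
have : (n = 0)%N.
  case: (posnP n) => // n0; have : inl (inr (Ordinal n0)) \in A by rewrite AT inE.
  by rewrite !inE.
have := euler; lia.
Qed.

Lemma ext_edge_tree_type h i : G h = inl i -> tree_type G h.1.
Proof.
move=> hi; have [v hv] := ext_opp hi.
exact: leaf_tree_type conn betti (val1 i) hi hv.
Qed.

Lemma ext_edge_hair h i : G h = inl i ->
  inl (G (opph h)) \in frame G /\
  forall j, tree_type G j -> incident G (inl (G (opph h))) (inr j) -> j = h.1.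
Proof.
move=> hi; have [v hv] := ext_opp hi.
have /andP[_ /existsP[b /and3P[/eqP vb fb /forallP ub]]] := hairs (ext_edge_tree_type hi).
have bE : b = h.2.
  case: (b =P h.2) => // bb; have : (h.1, b) = opph h by rewrite /opph; congr pair; case: (b) (h.2) bb => [] [].
  by move=> E; move: vb; rewrite E hv => vb; have := val3 v; rewrite vb.
rewrite bE -/(opph h) in fb ub; split=> // j tj ij; apply/eqP.
by have := implyP (ub j); rewrite tj ij => /(_ isT).
Qed.

(** A tree-type edge is a hair, so one of its endpoints is univalent, hence external, as internal
    vertices have valence at least 3. The edges with [int_edge] are therefore those of the frame. *)
Lemma tree_type_ext j : tree_type G j = ~~ int_edge j.
Proof.
apply/idP/idP => [tj|].
  have /andP[_ /existsP[b /and3P[/eqP vb _ _]]] := hairs tj.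
  have : ext_vertex (G (j, b)) by case E : (G (j, b)) vb => [//|v] vb; have := val3 v; rewrite vb.
  by rewrite /int_edge; case: b {vb} => ->; rewrite ?andbF.
rewrite negb_and !negbK => /orP[].
  by case E : (G (j, false)) => [i|//] _; exact: (ext_edge_tree_type E).
by case E : (G (j, true)) => [i|//] _; exact: (ext_edge_tree_type E).
Qed.

Lemma int_edge_opp h : int_edge h.1 = ~~ ext_vertex (G h) && ~~ ext_vertex (G (opph h)).
Proof. by case: h => j [] /=; rewrite /int_edge // andbC. Qed.

Lemma ext_edge_unique v h h' : G h = inr v -> G h' = inr v -> ~~ int_edge h.1 -> ~~ int_edge h'.1 -> h = h'.
Proof.
move=> hv h'v; rewrite int_edge_opp hv /= negbK => eh eh'.
case E : (G (opph h)) eh => [i|//] _.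
have [_] := ext_edge_hair E; rewrite opphK hv => /(_ h'.1); rewrite tree_type_ext eh'.
have inc : incident G (inl (inr v)) (inr h'.1) by rewrite -h'v incident_half.
move=> /(_ isT inc) => e1.
have [hh|->] := same_edge (esym e1); last by rewrite opphK.
by rewrite hh E in h'v.
Qed.

Definition fh v : {set halfedge e} := [set h | (G h == inr v) && int_edge h.1].
Definition fv v : nat := #|fh v|.

Lemma fv_valence v : (valence G (inr v) <= (fv v).+1)%N.
Proof.
rewrite /valence /fv -(cardsID [set h | int_edge h.1] (halfedges G (inr v))).
rewrite (_ : _ :&: _ = fh v); last by apply/setP => h; rewrite !inE.
rewrite -[X in (_ <= X)%N]addn1 leq_add2l.
apply/card_le1P => h; rewrite !inE => /andP[eh /eqP hv] h'; rewrite !inE.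
apply/andP/eqP => [[eh' /eqP h'v]|->]; last by rewrite eh hv.
exact: ext_edge_unique h'v hv eh' eh.
Qed.

Lemma fv_ge2 v : (2 <= fv v)%N.
Proof. by have := fv_valence v; have := val3 v; lia. Qed.

(** Double counting in the frame: the half-edges outside it are the k external ones and their k
    opposites, disjoint by [ext_opp], and the Euler characteristic leaves n + 1 edges. *)
Lemma fv_sum : (\sum_v fv v = n.+1.*2)%N.
Proof.
have card_ext : #|[set h : halfedge e | ext_vertex (G h)]| = k.
  rewrite -sum1_card (partition_big (fun h => if G h is inl i then i else Ordinal k_gt0) predT) //=.
  rewrite -[RHS]card_ord -sum1_card; apply: eq_bigr => i _.
  rewrite -[RHS](val1 i) /valence -sum1_card; apply: eq_bigl => h; rewrite !inE.
  by case: (G h) => [i'|v] //=.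
have card_oext : #|[set h : halfedge e | ext_vertex (G (opph h))]| = k.
  rewrite -[RHS]card_ext -[RHS](card_imset _ (can_inj (@opphK e))); congr #|pred_of_set _|.
  apply/setP => h; rewrite inE; apply/idP/imsetP => [hh|[h' + ->]].
    by exists (opph h); rewrite ?opphK ?inE ?opphK.
  by rewrite inE opphK.
have dis : [set h : halfedge e | ext_vertex (G h)] :&: [set h : halfedge e | ext_vertex (G (opph h))] = set0.
  apply/setP => h; rewrite !inE; case E : (G h) => [i|] //=.
  by have [v ->] := ext_opp E.
have sz := cardsC [set h : halfedge e | int_edge h.1].
have card_int : #|[set h : halfedge e | int_edge h.1]| = (\sum_v fv v)%N.
  case: (posnP n) => [n0|n0].
    have no : forall v : 'I_n, False by move=> v; have := ltn_ord v; rewrite [X in (_ < X)%N]n0.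
    rewrite big1 => [|v]; last by have := no v.
    apply/eqP; rewrite cards_eq0; apply/eqP/setP => h; rewrite !inE int_edge_opp.
    by case: (G h) => [//|v]; have := no v.
  rewrite -sum1_card (partition_big (fun h => if G h is inr v then v else Ordinal n0) predT) //=.
  apply: eq_bigr => v _; rewrite /fv -sum1_card; apply: eq_bigl => h; rewrite !inE int_edge_opp.
  by case: (G h) => [i|v'] //=; rewrite andbC.
have := cardsUI [set h : halfedge e | ext_vertex (G h)] [set h | ext_vertex (G (opph h))].
rewrite dis cards0 card_ext card_oext.
have -> : [set h : halfedge e | ext_vertex (G h)] :|: [set h | ext_vertex (G (opph h))] = ~: [set h | int_edge h.1].
  by apply/setP => h; rewrite !inE int_edge_opp negb_and !negbK.
move: sz; rewrite card_int card_prod card_ord card_bool => s1 s2.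
have s3 : (\sum_v fv v + (k + k) = e * 2)%N by rewrite -s1 -s2 addn0.
have := euler; lia.
Qed.

(* nu exchanges the two frame half-edges at a vertex of valence 2 in the frame
   and fixes the other half-edges, so iterating psi walks along a strand. *)
Definition nu h : halfedge e :=
  if G h is inr v then
    if int_edge h.1 && (fv v == 2) then odflt h [pick h' in fh v :\ h] else h
  else h.

Lemma nu_fv2 h v : G h = inr v -> int_edge h.1 -> fv v = 2 ->
  fh v = [set h; nu h] /\ nu h != h.
Proof.
move=> hv ih f2; have hf : h \in fh v by rewrite inE hv eqxx ih.
rewrite /nu hv ih f2 eqxx /=.
have := cardsD1 h (fh v); rewrite hf -/(fv v) f2 => /eqP; rewrite eqSS eq_sym => /cards1P[h' E].
case: pickP => [h''|/(_ h')]; last by rewrite E inE eqxx.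
rewrite E inE => /eqP -> /=; split; first by rewrite -(setD1K hf) E.
by have : h' \in fh v :\ h; [rewrite E inE|rewrite !inE => /andP[]].
Qed.

Lemma nu_id h v : G h = inr v -> fv v <> 2 -> nu h = h.
Proof. by rewrite /nu => -> /eqP/negbTE ->; rewrite andbF. Qed.

Lemma nu_spec h : int_edge h.1 -> [/\ G (nu h) = G h, int_edge (nu h).1 & nu (nu h) = h].
Proof.
move=> ih; have [v hv] : exists v, G h = inr v.
  by move: ih; rewrite int_edge_opp; case: (G h) => // v; exists v.
have [f2|f2] := eqVneq (fv v) 2; last by rewrite !(nu_id hv (elimN eqP f2)).
have [E ne] := nu_fv2 hv ih f2.
have : nu h \in fh v by rewrite E !inE eqxx orbT.
rewrite inE => /andP[/eqP nv ni]; rewrite nv hv; split=> //.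
have [E' ne'] := nu_fv2 nv ni f2.
have : h \in fh v by rewrite inE hv eqxx ih.
by rewrite E' !inE eq_sym (negbTE ne) /= => /eqP.
Qed.

Lemma nu_inj : injective nu.
Proof.
have out h : ~~ int_edge h.1 -> nu h = h.
  by rewrite /nu => /negbTE ->; case: (G h).
have inv h : nu (nu h) = h.
  by have [/nu_spec[]//|/out E] := boolP (int_edge h.1); rewrite !E.
exact: can_inj inv.
Qed.

Definition psi h := nu (opph h).
Lemma psi_inj : injective psi.
Proof. by move=> h h' /nu_inj/(can_inj (@opphK e)). Qed.

(** For an edge of the frame, a fixed point of [nu] here means that the edge arrives at a vertex
    whose valence in the frame is not 2. *)
Definition strand_end h : bool := nu (opph h) == opph h.

Section Strand.
Variables (v0 : 'I_n) (h0 : halfedge e).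
Hypotheses (h0v : G h0 = inr v0) (h0i : int_edge h0.1) (f3 : fv v0 <> 2).

Let nu0 : nu h0 = h0. Proof. exact: nu_id h0v f3. Qed.

(** [psi] is injective, so its orbit returns to [h0]. As [nu] fixes [h0], the half-edge just before
    the return is the opposite of [h0], and there the walk stops. *)
Lemma strand_ends : exists p, strand_end (iter p psi h0).
Proof.
have := iter_order psi_inj h0; have : (0 < fingraph.order psi h0)%N by rewrite fingraph.order_gt0.
case: (fingraph.order psi h0) => // q _ /= E; exists q; rewrite /strand_end -/(psi _) E.
by rewrite -(inj_eq nu_inj) nu0 -/(psi _) E.
Qed.

Lemma strand_len : exists a, strand_end (iter a psi h0) /\
  forall p, (p < a)%N -> ~~ strand_end (iter p psi h0).
Proof.
exists (ex_minn strand_ends); case: ex_minnP => m sm mm; split=> // p pm.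
by apply/negP => /mm; lia.
Qed.

Variable len : nat.
Hypotheses (len_end : strand_end (iter len psi h0))
  (len_min : forall p, (p < len)%N -> ~~ strand_end (iter p psi h0)).

Lemma iter_int p : int_edge (iter p psi h0).1.
Proof. by elim: p => //= p IH; have [] := nu_spec (h := opph (iter p psi h0)) IH. Qed.

Lemma iter_vertex p : exists v, G (iter p psi h0) = inr v.
Proof. by have := iter_int p; rewrite int_edge_opp; case: (G (iter p psi h0)) => // v; exists v. Qed.

Lemma iter_succ_vertex p : G (iter p.+1 psi h0) = G (opph (iter p psi h0)).
Proof. by rewrite /= /psi; have [] := nu_spec (h := opph (iter p psi h0)) (iter_int p). Qed.

Lemma iter_succ_nu p : nu (iter p.+1 psi h0) = opph (iter p psi h0).
Proof. by rewrite /= /psi; have [] := nu_spec (h := opph (iter p psi h0)) (iter_int p). Qed.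

Lemma iter_nu_free p : (p < len)%N -> nu (iter p.+1 psi h0) != iter p.+1 psi h0.
Proof.
move=> /len_min; rewrite iter_succ_nu /strand_end /= /psi eq_sym //.
Qed.

Lemma iter_fv2 p v : (p < len)%N -> G (iter p.+1 psi h0) = inr v -> fv v = 2.
Proof.
move=> pl pv; case: (fv v =P 2) => // f2.
by have := iter_nu_free pl; rewrite (nu_id pv f2) eqxx.
Qed.

Lemma iter_fh p v : (p < len)%N -> G (iter p.+1 psi h0) = inr v ->
  fh v = [set iter p.+1 psi h0; opph (iter p psi h0)].
Proof.
move=> pl pv; have [-> _] := nu_fv2 pv (iter_int _) (iter_fv2 pl pv).
by rewrite iter_succ_nu.
Qed.

Lemma end_fv v : G (opph (iter len psi h0)) = inr v -> fv v <> 2.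
Proof.
move=> ev f2; have [_] := nu_fv2 ev (iter_int _) f2.
by have := len_end; rewrite /strand_end => ->.
Qed.

(* Otherwise removing v0 would separate the strand from the rest of the frame. *)
Lemma strand_no_return : G (opph (iter len psi h0)) <> inr v0.
Proof.
move=> ret.
(* The edges and inner vertices of the strand. If it returned to [v0], they would be closed under
   incidence in the frame without [v0]. *)
pose A : {set cell k n e} := [set c | match c with
  | inr j => [exists p : 'I_len.+1, (iter p psi h0).1 == j]
  | inl x => [exists p : 'I_len, G (iter p.+1 psi h0) == x] end].
pose S := frame G :\ inl (inr v0).
have inA p : (p <= len)%N -> inr (iter p psi h0).1 \in A.
  by move=> pl; rewrite inE; apply/existsP; exists (inord p); rewrite inordK.
have vA p : (p < len)%N -> inl (G (iter p.+1 psi h0)) \in A.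
  by move=> pl; rewrite inE; apply/existsP; exists (Ordinal pl).
have inA_elim j : inr j \in A -> exists p, (p <= len)%N /\ (iter p psi h0).1 = j.
  by rewrite inE => /existsP[p /eqP pj]; exists p; split=> //; have := ltn_ord p.
have vA_elim x : inl x \in A -> exists p, (p < len)%N /\ G (iter p.+1 psi h0) = x.
  by rewrite inE => /existsP[p /eqP px]; exists p.
have frameE j : int_edge j -> inr j \in S.
  by move=> ij; rewrite !inE /= tree_type_ext negbK.
have comp : (#|components G S| <= 1)%N.
  have := nocut (inr v0); rewrite /cut_vertex negb_and -leqNgt => /orP[|//].
  move/negP => []; rewrite inE; apply/existsP; exists h0.1.
  by rewrite tree_type_ext negbK h0i -h0v incident_half.
have closed c d : incident_in G S c d -> c \in A -> d \in A.
  case/and3P => cS dS; case: c d cS dS => [x|j] [y|j'] // cS dS cd.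
    have [b hb] := incidentP _ _ _ cd.
    move=> /vA_elim[p [pl px]].
    have ij : int_edge j' by move: dS; rewrite !inE /= tree_type_ext negbK.
    have [v pv] := iter_vertex p.+1.
    have : (j', b) \in fh v by rewrite inE hb -px pv eqxx.
    rewrite (iter_fh pl pv) in_set2 => /orP[]/eqP E.
      by rewrite (congr1 fst E : j' = (iter p.+1 psi h0).1); exact: (inA p.+1 pl).
    by rewrite (congr1 fst E : j' = (iter p psi h0).1); exact: (inA p (ltnW pl)).
  rewrite incident_sym in cd; have [b hb] := incidentP _ _ _ cd.
  move=> /inA_elim[p [pl pj]].
  have yv0 : y <> inr v0 by move=> E; move: dS; rewrite E !inE eqxx.
  have [E|E] := same_edge (h := iter p psi h0) (h' := (j, b)) pj.
    rewrite -hb E; case: p E pl {pj} => [E|q E ql]; last exact: vA.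
    by move: hb; rewrite E /= h0v => /esym.
  rewrite -hb E; move: pl; rewrite leq_eqVlt => /orP[/eqP pl|pl].
    by move: hb; rewrite E pl ret => /esym.
  by rewrite -iter_succ_vertex; exact: vA.
have h0f : h0 \in fh v0 by rewrite inE h0v eqxx h0i.
(* At least three frame half-edges meet at [v0], hence one besides the two of the strand;
   connectedness would put its edge on the strand too. *)
have [h2 h2f] : exists h2, h2 \in fh v0 :\ h0 :\ opph (iter len psi h0).
  apply/set0Pn; rewrite -card_gt0.
  have := cardsD1 h0 (fh v0); rewrite h0f -/(fv v0).
  have := cardsD1 (opph (iter len psi h0)) (fh v0 :\ h0).
  have := fv_ge2 v0; move: (f3); case: (_ \in _ :\ _) => /=; lia.
move: h2f; rewrite !inE => /and3P[ne1 ne2 /andP[/eqP h2v h2i]].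
have := components_closed comp closed (frameE _ h0i) (inA 0%N isT) (frameE _ h2i).
move=> /inA_elim[p [pl pj]].
have notv0 q : (q < len)%N -> G (iter q.+1 psi h0) <> inr v0.
  by move=> ql qv; apply: f3; apply: iter_fv2 ql qv.
have [E|E] := same_edge pj.
  case: p E pl {pj} => [E|q E ql]; first by rewrite E eqxx in ne2.
  by apply: (notv0 _ ql); rewrite -E.
move: pl; rewrite leq_eqVlt => /orP[/eqP pl|pl]; first by rewrite E pl eqxx in ne1.
by apply: (notv0 _ pl); rewrite iter_succ_vertex -E.
Qed.

End Strand.

Definition is_strand h a := strand_end (iter a psi h) /\
  forall p, (p < a)%N -> ~~ strand_end (iter p psi h).

Section TwoStrands.
Variables (v0 : 'I_n) (f3 : fv v0 <> 2).
Variables (h0 h1 : halfedge e) (a0 a1 : nat).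
Hypotheses (h0v : h0 \in fh v0) (h1v : h1 \in fh v0) (s0 : is_strand h0 a0) (s1 : is_strand h1 a1).

(** After cancelling common steps by injectivity of [psi], one of the two half-edges at [v0] would
    occur later on a strand; but [nu] fixes the half-edges at [v0] and moves those that a strand
    reaches after its start. *)
Lemma strand_disjoint p q : (p <= a0)%N -> (q <= a1)%N ->
  iter p psi h0 = iter q psi h1 -> h0 = h1 /\ p = q.
Proof.
move: h0v h1v; rewrite !inE => /andP[/eqP g0 e0] /andP[/eqP g1 e1].
have psi_iter r x y : iter r psi x = iter r psi y -> x = y.
  by elim: r => //= r IH /psi_inj/IH.
have fixed h r b : G h = inr v0 -> is_strand b r -> G b = inr v0 -> int_edge b.1 ->
    forall q, (q < r)%N -> h <> iter q.+1 psi b.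
  move=> gh [sb1 sb2] gb ib q' qr E; have := iter_nu_free ib sb2 qr.
  by rewrite -E (nu_id gh f3) eqxx.
move=> pa qa; have [pq|qp] := leqP p q.
  rewrite -(subnKC pq) iterD => /psi_iter; case E : (q - p)%N => [|r]; first by move=> /= ->; rewrite addn0.
  by move=> h; case: (fixed _ _ _ g0 s1 g1 e1 r _ h); lia.
rewrite -(subnKC (ltnW qp)) iterD => /psi_iter; case E : (p - q)%N => [|r]; first by move=> /= ->; rewrite addn0.
by move=> h; case: (fixed _ _ _ g1 s0 g0 e0 r _ (esym h)); lia.
Qed.

(** If the strands met in opposite directions, one step back on the first and one step forward on
    the second would keep them opposite, until the first is back at [v0] or the second has ended;
    [strand_no_return] and the frame valences exclude both. *)
Lemma strand_no_reversal p q : (p <= a0)%N -> (q <= a1)%N ->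
  iter p psi h0 <> opph (iter q psi h1).
Proof.
move: h0v h1v; rewrite !inE => /andP[/eqP g0 e0] /andP[/eqP g1 e1].
case: s0 s1 => [s00 s01] [s10 s11].
elim: p q => [|p IH] q pa qa E.
  move: qa; rewrite leq_eqVlt => /orP[/eqP qa|qa].
    by apply: (strand_no_return g1 e1 f3 s10 s11); rewrite -qa -E.
  by apply: f3; apply: (iter_fv2 e1 s11 qa); rewrite (iter_succ_vertex e1) -E.
move: qa; rewrite leq_eqVlt => /orP[/eqP qa|qa].
  have [v hv] := iter_vertex e0 p.+1.
  have := iter_fv2 e0 s01 pa hv; apply: (end_fv e1 s10).
  by rewrite -qa -E.
apply: (IH q.+1 (ltnW pa) qa); apply: (can_inj (@opphK e)).
by rewrite opphK -(iter_succ_nu e0) E.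
Qed.
End TwoStrands.

(** The excesses fv v - 2 have sum 2. They cannot sit in a single vertex, because a strand that
    starts there ends at another vertex of frame valence other than 2. *)
Lemma theta_vertices : exists v0 v1, [/\ v0 != v1, fv v0 = 3, fv v1 = 3
  & forall v, v != v0 -> v != v1 -> fv v = 2].
Proof.
have sum2 : (\sum_v (fv v - 2) = 2)%N.
  have := fv_sum; have -> : (\sum_v fv v = \sum_v (fv v - 2) + \sum_(v < n) 2)%N.
    by rewrite -big_split; apply: eq_bigr => v _ /=; have := fv_ge2 v; lia.
  rewrite sum_nat_const card_ord => h; apply/eqP; rewrite -(eqn_add2r (n * 2)) h.
  by apply/eqP; lia.
have [v0 v0P] : exists v0, (2 < fv v0)%N.
  case: (pickP (fun v => 2 < fv v)%N) => [v vP|no]; first by exists v.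
  by move: sum2; rewrite big1 // => v _; have := no v; lia.
have f3 : fv v0 <> 2 by lia.
have [h0 h0f] : exists h, h \in fh v0 by apply/set0Pn; rewrite -card_gt0 -/(fv v0); lia.
move: (h0f); rewrite inE => /andP[/eqP g0 e0].
have [a [sa1 sa2]] := strand_len g0 e0 f3.
have [v1 hv1] : exists v, G (opph (iter a psi h0)) = inr v.
  by rewrite -(iter_succ_vertex e0); exact: iter_vertex.
have v01 : v1 != v0.
  by apply/eqP => E; apply: (strand_no_return g0 e0 f3 sa1 sa2); rewrite hv1 E.
have f1 := end_fv e0 sa1 hv1.
exists v0, v1; move: sum2.
rewrite (bigD1 v0) //= (bigD1 v1) //=.
set R := (X in (_ + (_ + X))%N); have := fv_ge2 v1 => ge1 sum2.
split; first by rewrite eq_sym.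
- lia.
- lia.
move=> v vv0 vv1; have ge := fv_ge2 v.
have : R = 0%N by lia.
move/eqP; rewrite sum_nat_eq0 => /forallP/(_ v)/implyP; rewrite vv0 vv1.
by move=> /(_ isT)/eqP; move: ge; case: (fv v) => [|[|[|]]].
Qed.

Definition has_hair v : bool := [exists h, (G h == inr v) && ~~ int_edge h.1].

Lemma fv2_has_hair v : fv v = 2 -> has_hair v.
Proof.
move=> f2; case: (pickP (fun h => (G h == inr v) && ~~ int_edge h.1)) => [h hP|no].
  by apply/existsP; exists h.
have := val3 v; rewrite /valence (_ : halfedges G (inr v) = fh v) -/(fv v) ?f2 //.
apply/setP => h; rewrite !inE; have := no h; by case: (_ == _) => //= /negbFE ->.
Qed.

(** The three strands that start at [v0] all end at [v1], and with the hairs they form a copy of a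
    theta graph. The order [L] affects only the sign of the isomorphism. *)
Theorem classification (L : {set cell k n e * cell k n e}) :
  exists d0 d1 a b c (f : iso (Th d0 d1 a b c) (obj (G, L))), True.
Proof.
have [v0 [v1 [v01 fv0 fv1 fv2]]] := theta_vertices.
have f3 : fv v0 <> 2 by rewrite fv0.
pose h (l : 'I_3) : halfedge e := enum_val (cast_ord (esym fv0) l).
have hf l : h l \in fh v0 by exact: enum_valP.
have hinj : injective h by move=> l l' /enum_val_inj/cast_ord_inj.
have hG l : G (h l) = inr v0 by have := hf l; rewrite inE => /andP[/eqP].
have hi l : int_edge (h l).1 by have := hf l; rewrite inE => /andP[].
have [ai aiP] := fin_all_exists (fun l => strand_len (hG l) (hi l) f3).
pose a := tri (ai i0) (ai i1) (ai i2).
have sa l : is_strand (h l) (a l) by have := aiP l; move: l; apply: ord3P.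
pose E l p := iter p psi (h l).
have Ei l p : int_edge (E l p).1 by exact: iter_int (hi l) p.
pose vt x := if G x is inr v then v else v0.
have GE l p : G (E l p) = inr (vt (E l p)).
  by rewrite /vt; have [v ->] := iter_vertex (hi l) p.
have Esucc l p : G (E l p.+1) = G (opph (E l p)) by exact: iter_succ_vertex (hi l) p.
have Eend l : G (opph (E l (a l))) = inr v1.
  have [s1 s2] := sa l; rewrite -Esucc GE; congr inr.
  have ev : G (opph (E l (a l))) = inr (vt (E l (a l).+1)) by rewrite -Esucc -GE.
  have ne2 := end_fv (hi l) s1 ev.
  have ne0 : vt (E l (a l).+1) != v0.
    by apply/eqP => E0; apply: (strand_no_return (hG l) (hi l) f3 s1 s2); rewrite ev E0.
  by apply/eqP; apply/negPn/negP => ne1; apply: ne2; apply: fv2.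
have E2 l p : (p < a l)%N -> fv (vt (E l p.+1)) = 2.
  by have [s1 s2] := sa l; move=> pl; apply: (iter_fv2 (hi l) s2 pl); rewrite -GE.
have Efh l p : (p < a l)%N -> fh (vt (E l p.+1)) = [set E l p.+1; opph (E l p)].
  by have [s1 s2] := sa l; move=> pl; apply: (iter_fh (hi l) s2 pl); rewrite -GE.
have Einj l l' p p' : (p <= a l)%N -> (p' <= a l')%N -> E l p = E l' p' -> l = l' /\ p = p'.
  by move=> pl pl' /(strand_disjoint f3 (hf l) (hf l') (sa l) (sa l') pl pl')[/hinj].
have Enrev l l' p p' : (p <= a l)%N -> (p' <= a l')%N -> E l p <> opph (E l' p').
  move=> pl pl'; exact: (strand_no_reversal f3 (hf l) (hf l') (sa l) (sa l') pl pl').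
pose fV (t : tvert a) : 'I_n := match t with
  | inl b => if b then v1 else v0 | inr s => vt (E (tag s) (tagged s).+1) end.
have tailE l p : (p <= a l)%N -> G (E l p) = inr (fV (tv a l p)).
  by case: p => [|p] pl; [rewrite hG|rewrite tvS GE].
have headE l p : (p <= a l)%N -> G (opph (E l p)) = inr (fV (tv a l p.+1)).
  rewrite leq_eqVlt => /orP[/eqP ->|pl]; first by rewrite Eend tv_last.
  by rewrite -Esucc tailE.
have fVinj : injective fV.
  have no2 b s : fV (inl b) <> fV (inr s).
    move=> /= eb; have := E2 _ _ (ltn_ord (tagged s)).
    by rewrite -eb; case: (b); rewrite ?fv0 ?fv1.
  move=> [b|s] [b'|t] //; last 1 first.
  - move=> /= st; have ps := ltn_ord (tagged s); have pt := ltn_ord (tagged t).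
    have : E (tag t) (tagged t).+1 \in fh (vt (E (tag s) (tagged s).+1)).
      by rewrite st Efh // !inE eqxx.
    rewrite Efh // !inE => /orP[]/eqP; last by move=> /Enrev[]//; exact: ltnW.
    move=> /Einj[]// e1 [e2]; congr inr; exact: tag_ord_eq.
  - by case: b b' => [] [] //= h'; rewrite h' eqxx in v01.
  - by move=> /no2.
  - by move=> /esym/no2.
pose d0 := has_hair v0; pose d1 := has_hair v1.
pose d (i : bool) := if i then d1 else d0.
have hairV (x : thair a d) : has_hair (fV (val x)).
  by case: x => -[[]|s] //= _; apply: fv2_has_hair; exact: E2.
pose hh v : halfedge e := odflt (h i0) [pick x | (G x == inr v) && ~~ int_edge x.1].
have hhP v : has_hair v -> G (hh v) = inr v /\ ~~ int_edge (hh v).1.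
  by rewrite /hh; case: pickP => [x /andP[/eqP]|no] // /existsP[x]; rewrite no.
pose xt x : 'I_k := if G (opph x) is inl i then i else Ordinal k_gt0.
have xtP v : has_hair v -> G (opph (hh v)) = inl (xt (hh v)).
  move=> /hhP[hv]; rewrite int_edge_opp hv /= negbK /xt.
  by case: (G (opph (hh v))).
pose fX (x : thair a d) : 'I_k := xt (hh (fV (val x))).
pose fE (y : tedge a + thair a d) : 'I_e := match y with
  | inl t => (E (tag t) (tagged t)).1 | inr x => (hh (fV (val x))).1 end.
pose fl (y : tedge a + thair a d) : bool := match y with
  | inl t => (E (tag t) (tagged t)).2 | inr x => (hh (fV (val x))).2 end.
have inc (y : oE (theta d a)) b : @oinc (obj (G, L)) (fE y) (b (+) fl y) = sum_map fX fV (oinc y b).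
  case: y => [t|x] /=.
    have pt : (tagged t <= a (tag t))%N by have := ltn_ord (tagged t).
    rewrite /tinc; case: b; rewrite ?addTb ?addFb ?addn0 ?addn1.
      by rewrite -headE.
    by rewrite -surjective_pairing tailE.
  have hx := hairV x; case: b; rewrite ?addTb ?addFb.
    exact: xtP.
  by rewrite -surjective_pairing; have [] := hhP _ hx.
have fXinj : injective fX.
  move=> x y xy; apply: val_inj; apply: fVinj.
  have := xtP _ (hairV x); rewrite -/(fX x) xy => hx; have hy := xtP _ (hairV y).
  have := valence1_unique (val1 _) hx hy => /(can_inj (@opphK e)) hxy.
  have [hvx _] := hhP _ (hairV x); have [hvy _] := hhP _ (hairV y).
  by apply: (@inr_inj 'I_k); rewrite -hvx hxy hvy.
have fEinj : injective fE.
  move=> [s|x] [t|y] /=; last 1 first.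
  - have [hvx ix] := hhP _ (hairV x); have [hvy iy] := hhP _ (hairV y).
    move=> /same_edge[] hxy.
      congr inr; apply: val_inj; apply: fVinj.
      by apply: (@inr_inj 'I_k); rewrite -hvx -hvy hxy.
    by have := xtP _ (hairV x); rewrite -hxy hvy.
  - have ps : (tagged s <= a (tag s))%N by have := ltn_ord (tagged s).
    have pt : (tagged t <= a (tag t))%N by have := ltn_ord (tagged t).
    move=> /same_edge[/Einj[]// e1 e2|/Enrev[]//].
    by congr inl; apply: tag_ord_eq.
  - by move=> st; have [_] := hhP _ (hairV y); rewrite -st Ei.
  - by move=> st; have [_] := hhP _ (hairV x); rewrite st Ei.
(* The cells in the images of the three maps. They are closed under incidence, so connectedness
   makes the maps onto. *)
pose A : {set cell k n e} := [set c | match c with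
  | inl (inl i) => i \in codom fX | inl (inr v) => v \in codom fV | inr j => j \in codom fE end].
have AE x : inr (fE x) \in A by rewrite inE codom_f.
have AV t : inl (inr (fV t)) \in A by rewrite inE codom_f.
have AX x : inl (inl (fX x)) \in A by rewrite inE codom_f.
have fh_v0 x : x \in fh v0 -> exists l, x = h l.
  move=> xf; exists (cast_ord fv0 (enum_rank_in xf x)).
  by rewrite /h cast_ordK enum_rankK_in.
(* The frame valence of [v1] is 3, so the distinct last half-edges of the three strands exhaust
   it. *)
have fh_v1 x : x \in fh v1 -> exists l, x = opph (E l (a l)).
  move=> xf; pose g l := opph (E l (a l)).
  have ginj : injective g by move=> l l' /(can_inj (@opphK e))/Einj[].
  have : g @: 'I_3 = fh v1.
    apply/eqP; rewrite eqEcard card_imset // card_ord -/(fv v1) fv1 leqnn andbT.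
    by apply/subsetP => _ /imsetP[l _ ->]; rewrite inE Eend eqxx Ei.
  by move=> /setP/(_ x); rewrite xf => /imsetP[l _ ->]; exists l.
have edgeA l p : (p <= a l)%N -> inr (E l p).1 \in A.
  move=> pl; exact: (AE (inl (@Tagged _ l (fun l => 'I_(a l).+1) (Ordinal (pl : (p < (a l).+1)%N))))).
have vA t x : G x = inr (fV t) -> inr x.1 \in A.
  move=> xv; have [ix|ex] := boolP (int_edge x.1).
    have : x \in fh (fV t) by rewrite inE xv eqxx ix.
    case: t xv => [[]|s] xv /=.
    - by move=> /fh_v1[l ->]; exact: edgeA.
    - by move=> /fh_v0[l ->]; exact: (edgeA l 0%N).
    - by rewrite Efh // in_set2 => /orP[]/eqP ->; apply: edgeA => //; exact: ltnW.
  have hv : has_hair (fV t) by apply/existsP; exists x; rewrite xv eqxx ex.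
  have bt : bearing d t by case: t hv xv => [[]|].
  have [h1 h2] := hhP _ hv.
  rewrite (ext_edge_unique xv h1 ex h2).
  exact: (AE (inr (exist (fun t => bearing d t) t bt))).
have AT : A = setT.
  apply: (connected_closed conn (c := inl (inr v0))); last exact: (AV (inl false)).
  move=> [x|j] [y|j'] // cd.
    have [b hb] := incidentP _ _ _ cd; rewrite inE; case: x hb {cd} => [i|v] hb /codomP[t et].
      have hx := xtP _ (hairV t); rewrite -/(fX t) -et in hx.
      have eb := congr1 fst (valence1_unique (val1 i) hb hx : (j', b) = opph (hh (fV (val t)))).
      by rewrite (eb : j' = _); exact: (AE (inr t)).
    by rewrite et in hb; exact: (vA t (j', b) hb).
  rewrite incident_sym in cd; have [b hb] := incidentP _ _ _ cd.
  rewrite [in X in X -> _]inE => /codomP[t et].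
  have : G (j, b) = sum_map fX fV (@oinc (theta d a) t (b (+) fl t)).
    by rewrite -inc -addbA addbb addbF et.
  by rewrite hb; case: (@oinc (theta d a) t _) => [x|v] /= ->; [exact: AX|exact: AV].
have inA c : c \in A by rewrite AT inE.
have bX : bijective fX.
  apply: (inj_card_bij (fXinj)); rewrite -(card_codom fXinj); apply/subset_leq_card/subsetP => i _.
  by have := inA (inl (inl i)); rewrite inE.
have bV : bijective fV.
  apply: (inj_card_bij (fVinj)); rewrite -(card_codom fVinj); apply/subset_leq_card/subsetP => i _.
  by have := inA (inl (inr i)); rewrite inE.
have bE : bijective fE.
  apply: (inj_card_bij (fEinj)); rewrite -(card_codom fEinj); apply/subset_leq_card/subsetP => i _.
  by have := inA (inr i); rewrite inE.
by exists d0, d1, (ai i0), (ai i1), (ai i2), (@Iso (theta d a) (obj (G, L)) fX fV fE fl bX bV bE inc).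
Qed.

End Classification.

Lemma card_tagged_ord (a : 'I_3 -> nat) : #|{: {l : 'I_3 & 'I_(a l)}}| = (a i0 + a i1 + a i2)%N.
Proof.
have H : #|{: {l : 'I_3 & 'I_(a l)}}| = (\sum_(l < 3) \sum_(p < a l) 1)%N.
  rewrite (sig_big_dep _ _ (fun _ _ => 1%N)) /= -sum1_card; exact: eq_bigl.
rewrite H !big_ord_recl big_ord0 /= !sum_nat_const !card_ord !muln1 addn0 addnA.
by congr (_ + _ + _)%N; congr a; apply: val_inj.
Qed.

(** * Theta graphs with hairs are two-loop hairy *)

Section Realize.
Variables (k n e : nat) (g : ograph k n e) (d : bool -> bool) (a : 'I_3 -> nat).
Variable f : iso (theta d a) (obj g).
Local Notation G := g.1.
Implicit Types (S : {set cell k n e}) (c : cell k n e).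

Let fV : tvert a -> 'I_n := iV f.
Let fX : thair a d -> 'I_k := iX f.
Let fE : tedge a + thair a d -> 'I_e := iE f.
Let V (t : tvert a) : cell k n e := inl (inr (fV t)).
Let X (x : thair a d) : cell k n e := inl (inl (fX x)).
Let E (y : tedge a + thair a d) : cell k n e := inr (fE y).
Let ed l p (pl : (p < (a l).+1)%N) : tedge a + thair a d :=
  inl (@Tagged _ l (fun l => 'I_(a l).+1) (Ordinal pl)).

Let Vinj : injective fV. Proof. exact: bij_inj (iVbij f). Qed.
Let Xinj : injective fX. Proof. exact: bij_inj (iXbij f). Qed.
Let Einj : injective fE. Proof. exact: bij_inj (iEbij f). Qed.

Let ends y b : G (fE y, b (+) ifl f y) = sum_map fX fV (@oinc (theta d a) y b).
Proof. exact: (iinc f y b). Qed.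

Let edgeP j : exists y, j = fE y.
Proof. by have [h hK Kh] := iEbij f; exists (h j); rewrite /fE Kh. Qed.

Let halfP (h : halfedge e) : exists y b, h = (fE y, b (+) ifl f y).
Proof.
case: h => j b; have [y ->] := edgeP j; exists y, (b (+) ifl f y).
by rewrite -addbA addbb addbF.
Qed.

Let tailed l p (pl : (p < (a l).+1)%N) : incident G (V (tv a l p)) (E (ed pl)).
Proof. by apply/incidentP; exists (false (+) ifl f (ed pl)); rewrite ends /= /tinc addn0. Qed.

Let headed l p (pl : (p < (a l).+1)%N) : incident G (V (tv a l p.+1)) (E (ed pl)).
Proof. by apply/incidentP; exists (true (+) ifl f (ed pl)); rewrite ends /= /tinc addn1. Qed.

Let hair_head x : G (fE (inr x), ~~ ifl f (inr x)) = inl (fX x).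
Proof. exact: (ends (inr x) true). Qed.

Let hair_tail x : G (fE (inr x), ifl f (inr x)) = inr (fV (val x)).
Proof. exact: (ends (inr x) false). Qed.

Let haired x : incident G (V (val x)) (E (inr x)).
Proof. by apply/incidentP; exists (false (+) ifl f (inr x)); rewrite ends. Qed.

Let hair_end x : incident G (X x) (E (inr x)).
Proof. by apply/incidentP; exists (true (+) ifl f (inr x)); rewrite ends. Qed.

Let cellP (c : cell k n e) : (exists t, c = V t) \/ (exists x, c = X x) \/
  (exists l p (pl : (p < (a l).+1)%N), c = E (ed pl)) \/ (exists x, c = E (inr x)).
Proof.
case: c => [[i|v]|j].
- by have [h hK Kh] := iXbij f; right; left; exists (h i); rewrite /X /fX Kh.
- by have [h hK Kh] := iVbij f; left; exists (h v); rewrite /V /fV Kh.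
- have [[[l [p pl]]|x] ->] := edgeP j; right; right; last by right; exists x.
  by left; exists l, p, pl.
Qed.

Local Notation conn S := (connect (incident_in G S)).

Let conn1 S c c' : c \in S -> c' \in S -> incident G c c' -> conn S c c'.
Proof. by move=> h1 h2 h3; apply: connect1; apply/and3P. Qed.

Let segment S l q r : (q <= r)%N -> (r <= (a l).+1)%N ->
  (forall p, (q <= p <= r)%N -> V (tv a l p) \in S) ->
  (forall p (pl : (p < (a l).+1)%N), (q <= p < r)%N -> E (ed pl) \in S) ->
  conn S (V (tv a l q)) (V (tv a l r)).
Proof.
move=> qr; rewrite -(subnKC qr); elim: (r - q)%N => [|m IH] ra HV HE.
  by rewrite addn0 connect0.
have pl : (q + m < (a l).+1)%N by lia.
apply: connect_trans (IH _ _ _) _; first lia.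
- by move=> p hp; apply: HV; lia.
- by move=> p pl' hp; apply: HE; lia.
have eS : E (ed pl) \in S by apply: HE; lia.
apply: connect_trans (conn1 _ eS (tailed pl)) _; first by apply: HV; lia.
rewrite connect_in_sym addnS; apply: conn1 (headed pl) => //; apply: HV; lia.
Qed.

(** The ends are joined along an intact strand [l1], and every other remaining vertex is joined to
    one of the ends by an intact piece of its own strand. This serves for the whole graph and after
    the removal of a frame edge or of an inner vertex. *)
Let through S (l1 : 'I_3) : V (inl false) \in S -> V (inl true) \in S ->
  (forall s : {l : 'I_3 & 'I_(a l)}, tag s = l1 -> V (inr s) \in S) ->
  (forall p (pl : (p < (a l1).+1)%N), E (ed pl) \in S) ->
  (forall s : {l : 'I_3 & 'I_(a l)}, V (inr s) \in S ->
     ((forall t : {l : 'I_3 & 'I_(a l)}, tag t = tag s -> (tagged t <= tagged s)%N -> V (inr t) \in S) /\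
      (forall p (pl : (p < (a (tag s)).+1)%N), (p <= tagged s)%N -> E (ed pl) \in S))
   \/ ((forall t : {l : 'I_3 & 'I_(a l)}, tag t = tag s -> (tagged s <= tagged t)%N -> V (inr t) \in S) /\
      (forall p (pl : (p < (a (tag s)).+1)%N), (tagged s < p)%N -> E (ed pl) \in S))) ->
  forall t, V t \in S -> conn S (V (inl false)) (V t).
Proof.
move=> S0 S1 hV1 hE1 hs.
have c1 : conn S (V (inl false)) (V (inl true)).
  rewrite -(tv_last (leqnn (a l1))) -(tv0 a l1); apply: segment => [//|//|[|p] hp|p pl _].
  - by rewrite tv0.
  - by have [h|h] := ltnP p (a l1); [rewrite (tvS h); apply: hV1|rewrite tv_last].
  - exact: hE1.
move=> [[]|s] sS; [exact: c1|exact: connect0|].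
have ls := ltn_ord (tagged s).
have [[h1 h2]|[h1 h2]] := hs s sS.
  rewrite -(tv0 a (tag s)) -(tv_strand s); apply: segment => [//||[|p] hp|p pl /andP[_ ps]].
  - exact: ltnW.
  - by rewrite tv0.
  - have pl : (p < a (tag s))%N by apply: leq_ltn_trans ls; case/andP: hp.
    by rewrite (tvS pl); apply: h1.
  - exact: h2.
apply: connect_trans c1 _; rewrite connect_in_sym -(tv_last (leqnn (a (tag s)))) -(tv_strand s).
apply: segment => [||[|p] // /andP[hp _]|p pl /andP[ps _]].
- exact: ltnW.
- by [].
- have [h|h] := ltnP p (a (tag s)); last by rewrite tv_last.
  by rewrite (tvS h); apply: h1.
- exact: h2.
Qed.

Let all_from S c0 : c0 \in S ->
  (forall t, V t \in S -> conn S c0 (V t)) ->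
  (forall l p (pl : (p < (a l).+1)%N), E (ed pl) \in S -> V (tv a l p) \in S \/ V (tv a l p.+1) \in S) ->
  (forall x, E (inr x) \in S -> V (val x) \in S) ->
  (forall x, X x \in S -> E (inr x) \in S) ->
  #|components G S| = 1%N.
Proof.
move=> cS hV hE hH hX.
have cH x : E (inr x) \in S -> conn S c0 (E (inr x)).
  by move=> xS; apply: connect_trans (hV _ (hH _ xS)) _; apply: conn1 (haired x) => //; exact: hH.
apply: (connected_in1 cS) => c; have [[t ->]|[[x ->]|[[l [p [pl ->]]]|[x ->]]]] := cellP c.
- exact: hV.
- move=> xS; apply: connect_trans (cH _ (hX _ xS)) _; rewrite connect_in_sym.
  by apply: conn1 (hair_end x) => //; exact: hX.
- move=> eS; have [h|h] := hE _ _ _ eS; apply: connect_trans (hV _ h) _.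
    exact: conn1 (tailed pl).
  exact: conn1 (headed pl).
- exact: cH.
Qed.

Lemma theta_connected : connected_space G setT.
Proof.
apply/eqP; apply: (all_from (c0 := V (inl false))); rewrite ?inE //.
- by apply: (through (l1 := i0)); rewrite ?inE // => s _; left; split=> *; rewrite inE.
- by move=> *; left; rewrite inE.
Qed.

Let EE y y' : (E y == E y') = (y == y').
Proof. by rewrite (inj_eq (@inr_inj _ _)) (inj_eq Einj). Qed.
Let VV t t' : (V t == V t') = (t == t').
Proof. by rewrite (inj_eq (@inl_inj _ _)) (inj_eq (@inr_inj _ _)) (inj_eq Vinj). Qed.

Let other (l0 : 'I_3) : exists l1 : 'I_3, l1 != l0.
Proof. by move: l0; apply: ord3P; [exists i1|exists i0|exists i0]. Qed.

(** Another strand still joins the ends, and the two pieces of the cut strand hang on them, so the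
    removal of the edge leaves one component. *)
Lemma theta_frame_edge (y : tedge a) : ~~ tree_type G (fE (inl y)).
Proof.
rewrite /tree_type; set S := _ :\ _.
have eS y' : (E y' \in S) = (y' != inl y) by rewrite !inE andbT EE.
suff -> : #|components G S| = 1%N by [].
have vS t : V t \in S by rewrite !inE.
apply: (all_from (c0 := V (inl false))); rewrite ?inE //.
- have [l1 hl1] := other (tag y).
  apply: (through (l1 := l1)) => // [p pl|s _].
    rewrite eS; apply: contra hl1 => /eqP[/(congr1 tag) /= ->]; exact: eqxx.
  have [ts|ts] := eqVneq (tag s) (tag y); last first.
    left; split=> // p pl _; rewrite eS; apply: contra ts => /eqP[/(congr1 tag) /= ->]; exact: eqxx.
  have [h|h] := ltnP (tagged s) (tagged y); [left|right]; split=> // p pl ps;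
    rewrite eS; apply/eqP => -[/(congr1 (fun y : tedge a => nat_of_ord (tagged y))) /= py];
    move: ps h; rewrite py /=; lia.
- by move=> *; left.
- by move=> x _; rewrite eS.
Qed.

Let val_ext x : valence G (inl (fX x)) = 1%N.
Proof.
apply/eqP/cards1P; exists (fE (inr x), true (+) ifl f (inr x)); apply/setP => h; rewrite !inE.
apply/eqP/eqP => [|->]; last by rewrite ends.
have [y [b ->]] := halfP h; rewrite ends; case: y => [y|x'] //=; case: b => //= -[] /Xinj ->.
by [].
Qed.

Lemma theta_sizes : [/\ #|thair a d| = k, n = (a i0 + a i1 + a i2).+2 & e = (n + k).+1].
Proof.
have hk : #|thair a d| = k by rewrite (bij_eq_card (iXbij f)) card_ord.
have hn : n = (a i0 + a i1 + a i2).+2.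
  by rewrite -(card_ord n) -(bij_eq_card (iVbij f)) card_sum card_bool card_tagged_ord.
split=> //; rewrite -(card_ord e) -(bij_eq_card (iEbij f)) card_sum hk hn.
by rewrite (card_tagged_ord (fun l => (a l).+1)); lia.
Qed.

Let betti : betti1 G setT = 2.
Proof.
have [_ hn he] := theta_sizes.
rewrite /betti1 (eqP theta_connected).
have -> : [set j | inr j \in [set: cell k n e]] = setT by apply/setP => j; rewrite !inE.
have -> : [set x | inl x \in [set: cell k n e]] = setT by apply/setP => j; rewrite !inE.
by rewrite !cardsT card_sum !card_ord; lia.
Qed.

Let hair_tree_type x : tree_type G (fE (inr x)).
Proof.
apply: (@leaf_tree_type _ _ _ _ (fX x) (fV (val x)) (fE (inr x), true (+) ifl f (inr x)));
  rewrite ?theta_connected ?val_ext ?ends //.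
by rewrite /opph /= -[~~ ifl f _]/(true (+) ifl f _) -[X in (_, X)]/(~~ ~~ ifl f _) negbK -[ifl f _]/(false (+) ifl f _) ends.
Qed.

Let tree_typeE y : tree_type G (fE y) = if y is inr _ then true else false.
Proof. by case: y => [y|x]; [apply/negbTE/theta_frame_edge|exact: hair_tree_type]. Qed.

Let V_frame t : V t \in frame G.
Proof.
rewrite inE; apply/existsP.
have [l [p [pl [->|->]]]] : exists l p, exists pl : (p < (a l).+1)%N, t = tv a l p \/ t = tv a l p.+1.
  case: t => [[]|s].
  - by exists i0, (a i0), (ltnSn _); right; rewrite tv_last.
  - by exists i0, 0%N, (ltn0Sn _); left.
  - have h : (tagged s < (a (tag s)).+1)%N by exact: ltnW (ltn_ord _).
    by exists (tag s), (tagged s), h; right; rewrite tv_strand.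
- by exists (fE (ed pl)); rewrite tree_typeE; exact: tailed.
- by exists (fE (ed pl)); rewrite tree_typeE; exact: headed.
Qed.

Let X_frame x : X x \notin frame G.
Proof.
rewrite inE; apply/negP => /existsP[j]; have [y ->] := edgeP j; rewrite tree_typeE.
case: y => // y /andP[_ /incidentP[b]].
by rewrite -(addbK (ifl f (inl y)) b) ends.
Qed.

(** The frame without an end is a tripod around the other end; without an inner vertex it is the
    cycle of two strands with two pieces of the third attached. *)
Let no_cut t : #|components G (frame G :\ V t)| = 1%N.
Proof.
set S := _ :\ _.
have eS y : E (inl y) \in S by rewrite !inE /= tree_typeE.
have hS x : (E (inr x) \in S) = false by rewrite !inE /= tree_typeE.
have xS x : (X x \in S) = false by rewrite in_setD1 (negbTE (X_frame x)) andbF.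
have vS t' : (V t' \in S) = (t' != t) by rewrite in_setD1 V_frame andbT VV.
case: t S eS hS xS vS => [[]|s0] S eS hS xS vS.
- have S0 : V (inl false) \in S by rewrite vS.
  apply: (all_from S0) => [t tS|l p pl _|x|x]; rewrite ?hS ?xS //.
  + case: t tS => [[]|s]; rewrite ?vS ?connect0 // => _.
    rewrite -(tv0 a (tag s)) -(tv_strand s); apply: segment => [//||p hp|p pl _]; last exact: eS.
      exact: ltnW (ltn_ord _).
    rewrite vS; apply/eqP => /tv_inl_true h; case/andP: hp => _ /(leq_trans h).
    by rewrite ltnS leqNgt ltn_ord.
  + left; rewrite vS; apply/eqP => /tv_inl_true; lia.
- have S0 : V (inl true) \in S by rewrite vS.
  apply: (all_from S0) => [t tS|l p pl _|x|x]; rewrite ?hS ?xS //.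
  + case: t tS => [[]|s]; rewrite ?vS ?connect0 // => _.
    rewrite connect_in_sym -(tv_last (leqnn (a (tag s)))) -(tv_strand s).
    apply: segment => [||[|p] //|p pl _]; last exact: eS.
    * exact: ltnW (ltn_ord _).
    * by [].
    * by move=> _; rewrite vS; apply/eqP => /tv_inl_false.
  + by right; rewrite vS; apply/eqP => /tv_inl_false.
- have S0 : V (inl false) \in S by rewrite vS.
  apply: (all_from S0) => [|l p pl _|x|x]; rewrite ?hS ?xS //.
  + have [l1 hl1] := other (tag s0).
    apply: (through (l1 := l1)) => [||s sl|p pl|s]; rewrite ?vS //.
    - by apply: contra hl1 => /eqP[<-]; rewrite sl.
    - exact: eS.
    have eS' l' p' (pl' : (p' < (a l').+1)%N) : E (ed pl') \in S by exact: eS.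
    rewrite (inj_eq (@inr_inj _ _)) => ss0.
    have [ts|ts] := eqVneq (tag s) (tag s0); last first.
      by left; split=> [t tt _|p pl _]; [rewrite vS; apply: contra ts => /eqP[<-]; rewrite tt|exact: eS'].
    have : nat_of_ord (tagged s) <> tagged s0.
      by move=> E'; move: ss0; rewrite (tag_ord_eq ts E') eqxx.
    case: (ltngtP (tagged s) (tagged s0)) => // h _; [left|right]; (split=> [t tt le|p pl _]; last exact: eS');
      rewrite vS; apply/eqP => E1;
      have t1 : tagged t = tagged s0 :> nat := congr1 (fun x : tvert a =>
        if x is inr s then nat_of_ord (tagged s) else 0%N) E1;
      by rewrite t1 leqNgt h in le.
  + have [tl|tl] := eqVneq (tv a l p) (inr s0); last by left; rewrite vS.
    right; rewrite vS; apply/eqP => tl'; have [_ h1] := tv_inr tl; have [_ h2] := tv_inr tl'; lia.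
Qed.

Let val_int v : (3 <= valence G (inr v))%N.
Proof.
have [t ->] : exists t, v = fV t.
  by have [h hK Kh] := iVbij f; exists (h v); rewrite /fV Kh.
have mem y b : @oinc (theta d a) y b = inr t -> (fE y, b (+) ifl f y) \in halfedges G (inr (fV t)).
  by move=> h; rewrite inE ends h.
case: t mem => [b|s] mem.
  pose p l := if b then a l else 0%N.
  have pl l : (p l < (a l).+1)%N by rewrite /p; case: b {mem p}.
  pose h l : halfedge e := (fE (ed (pl l)), b (+) ifl f (ed (pl l))).
  have hi : injective h by move=> l l' [] /Einj hy _;
      exact: (congr1 (fun y : tedge a + thair a d => if y is inl e then tag e else i0) hy).
  rewrite -{1}(card_ord 3) -(card_imset _ hi); apply/subset_leq_card/subsetP => _ /imsetP[l _ ->].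
  apply: mem; rewrite /= /tinc /= /p; case: b {p pl h hi} => //.
  by rewrite addn1 tv_last.
have q0 : (tagged s < (a (tag s)).+1)%N by exact: ltnW (ltn_ord _).
have q1 : ((tagged s).+1 < (a (tag s)).+1)%N by exact: ltn_ord.
pose x : thair a d := exist (fun t => bearing d t) (inr s) isT.
pose s1 : seq (halfedge e) := [:: (fE (ed q0), true (+) ifl f (ed q0));
   (fE (ed q1), false (+) ifl f (ed q1)); (fE (inr x), false (+) ifl f (inr x))].
have us : uniq s1.
  rewrite /= !inE !xpair_eqE !(inj_eq Einj) /= !andbT.
  rewrite orbF negb_and; apply/orP; left.
  apply/eqP => h.
  have /= := congr1 (fun y : tedge a + thair a d => if y is inl e then nat_of_ord (tagged e) else 0%N) h; lia.
rewrite -[X in (X <= _)%N]/(size s1) -(card_uniqP us); apply/subset_leq_card/subsetP => h.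
rewrite !inE => /or3P[]/eqP ->.
- by have := mem (ed q0) true; rewrite inE; apply; rewrite /= /tinc /= addn1 tv_strand.
- by have := mem (ed q1) false; rewrite inE; apply; rewrite /= /tinc /= addn0 tv_strand.
- by have := mem (inr x) false; rewrite inE; apply.
Qed.

Theorem theta_two_loop_hairy : (0 < k)%N -> two_loop_hairy G.
Proof.
move=> k0; apply/and4P; split.
- rewrite /admissible k0 theta_connected /=; apply/andP; split; apply/forallP => v; last exact: val_int.
  by have [h hK Kh] := iXbij f; rewrite -(Kh v) val_ext.
- by rewrite betti.
- apply/forallP => -[i|v]; rewrite /cut_vertex negb_and -leqNgt.
    by have [h hK Kh] := iXbij f; rewrite -(Kh i) X_frame.
  by have [h hK Kh] := iVbij f; rewrite -(Kh v) no_cut orbT.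
- apply/forallP => j; apply/implyP; have [y ->] := edgeP j; rewrite tree_typeE; case: y => // x _.
  rewrite /is_hair hair_tree_type /=; apply/existsP; exists (~~ ifl f (inr x)).
  rewrite negbK hair_head hair_tail val_ext eqxx V_frame /=.
  apply/forallP => j'; apply/implyP; have [y ->] := edgeP j'; rewrite tree_typeE; case: y => //= x'.
  move=> /incidentP[b]; rewrite -(addbK (ifl f (inr x')) b) ends /=.
  by case: (b (+) _) => //= -[/Vinj/val_inj ->].
Qed.
End Realize.

(** * The differential on theta graphs *)

Lemma theta_realize d a k n e : #|thair a d| = k -> #|tvert a| = n ->
  #|{: tedge a + thair a d}| = e ->
  exists g : ograph k n e, total_order g.2 /\ exists f : iso (theta d a) (obj g), True.
Proof.
move=> hk hn he.
pose fX x := cast_ord hk (enum_rank x); pose fV x := cast_ord hn (enum_rank x).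
pose fE x := cast_ord he (enum_rank x); pose gE j := enum_val (cast_ord (esym he) j).
have bij (T : finType) q (h : #|T| = q) : bijective (fun x : T => cast_ord h (enum_rank x)).
  exists (fun j => enum_val (cast_ord (esym h) j)) => x; by rewrite ?cast_ordK ?enum_rankK ?enum_valK ?cast_ordKV.
pose G : graph k n e := [ffun h : halfedge e => sum_map fX fV (@oinc (theta d a) (gE h.1) h.2)].
pose L : {set cell k n e * cell k n e} := [set p | (enum_rank p.1 < enum_rank p.2)%N].
exists (G, L); split.
  apply/and3P; split; first by apply/forallP => c; rewrite inE ltnn.
    do 3!apply/forallP => ?; apply/implyP; rewrite !inE => /andP[]; exact: ltn_trans.
  apply/forallP => c; apply/forallP => c'; apply/implyP; rewrite !inE /= => cc.
  by rewrite -neq_ltn; apply: contra cc => /eqP/val_inj/enum_rank_inj ->.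
have H (y : oE (theta d a)) b : @oinc (obj (G, L)) (fE y) (b (+) false) = sum_map fX fV (oinc y b).
  by rewrite addbF /= ffunE /= /gE /fE cast_ordK enum_rankK.
by exists (@Iso (theta d a) (obj (G, L)) fX fV fE (fun=> false) (bij _ _ _) (bij _ _ _) (bij _ _ _) H).
Qed.

Section SplitOrder.
Variables (k n e : nat) (L : {set cell k n e * cell k n e}).

Lemma old_cell_inj : injective (@old_cell k n e).
Proof.
pose un (c : cell k n.+1 e.+1) : option (cell k n e) := match c with
  | inl (inl i) => Some (inl (inl i))
  | inl (inr v) => omap (fun w => inl (inr w)) (unlift ord0 v)
  | inr j => omap inr (unlift ord0 j) end.
by apply: (@pcan_inj _ _ _ un) => -[[i|v]|j]; rewrite /un /= ?liftK.
Qed.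

Lemma cellSP (c : cell k n.+1 e.+1) :
  [\/ c = inl (inr ord0), c = inr ord0 | exists c', c = old_cell c'].
Proof.
case: c => [[i|v]|j]; first by apply: Or33; exists (inl (inl i)).
- by case: (unliftP ord0 v) => [w|] ->; [apply: Or33; exists (inl (inr w))|apply: Or31].
- by case: (unliftP ord0 j) => [w|] ->; [apply: Or33; exists (inr w)|apply: Or32].
Qed.

Lemma old_cell_neq_vertex (c : cell k n e) : (inl (inr ord0) == old_cell c) = false.
Proof. by case: c => [[i|v]|j]; rewrite //=; apply/negbTE/eqP => -[] /eqP; rewrite (negbTE (neq_lift _ _)). Qed.

Lemma old_cell_neq_edge (c : cell k n e) : (inr ord0 == old_cell c) = false.
Proof. by case: c => [[i|v]|j]; rewrite //=; apply/negbTE/eqP => -[] /eqP; rewrite (negbTE (neq_lift _ _)). Qed.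

Lemma split_orderE (x y : cell k n.+1 e.+1) : ((x, y) \in split_order L) =
  [|| (x == inl (inr ord0)) && (y == inr ord0),
      (x == inl (inr ord0)) && [exists c, y == old_cell c],
      (x == inr ord0) && [exists c, y == old_cell c]
    | [exists p in L, (x == old_cell p.1) && (y == old_cell p.2)]].
Proof.
rewrite /split_order !inE xpair_eqE -!orbA; congr [|| _, _, _ | _].
- apply/imsetP/andP => [[c _ [-> ->]]|[/eqP -> /existsP[c /eqP ->]]]; last by exists c.
  by rewrite eqxx; split=> //; apply/existsP; exists c.
- apply/imsetP/andP => [[c _ [-> ->]]|[/eqP -> /existsP[c /eqP ->]]]; last by exists c.
  by rewrite eqxx; split=> //; apply/existsP; exists c.
- apply/imsetP/existsP => [[p pL [-> ->]]|[p /and3P[pL /eqP -> /eqP ->]]]; last by exists p.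
  by exists p; rewrite pL !eqxx.
Qed.

Lemma split_order_old (c c' : cell k n e) :
  ((old_cell c, old_cell c') \in split_order L) = ((c, c') \in L).
Proof.
rewrite split_orderE !(eq_sym (old_cell _)) !old_cell_neq_vertex !old_cell_neq_edge /=.
apply/existsP/idP => [[[d d'] /and3P[dL]]|cL].
  by rewrite !(inj_eq old_cell_inj) => /eqP/= -> /eqP/= ->.
by exists (c, c'); rewrite cL !eqxx.
Qed.

Lemma split_order_first (c : cell k n e) :
  ((inl (inr ord0), old_cell c) \in split_order L) /\ ((old_cell c, inl (inr ord0)) \notin split_order L).
Proof.
split; rewrite split_orderE.
  by apply/or4P/Or42; rewrite eqxx; apply/existsP; exists c.
rewrite !(eq_sym (old_cell c)) old_cell_neq_vertex old_cell_neq_edge !andFb !orFb.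
by apply/existsP => -[p /and3P[_ _]]; rewrite old_cell_neq_vertex.
Qed.

Lemma split_order_second (c : cell k n e) :
  ((inr ord0, old_cell c) \in split_order L) /\ ((old_cell c, inr ord0) \notin split_order L).
Proof.
split; rewrite split_orderE.
  by apply/or4P/Or43; rewrite eqxx; apply/existsP; exists c.
rewrite !(eq_sym (old_cell c)) old_cell_neq_vertex old_cell_neq_edge !andFb !orFb.
by apply/existsP => -[p /and3P[_ _]]; rewrite old_cell_neq_edge.
Qed.

Lemma split_order_top :
  ((inl (inr ord0), inr ord0) \in split_order L) /\ ((inr ord0, inl (inr ord0)) \notin split_order L).
Proof.
split; rewrite split_orderE ?eqxx // !andFb !orFb negb_or; apply/andP; split.
  by apply/negP => /existsP[c]; rewrite old_cell_neq_vertex.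
by apply/existsP => -[p /and3P[_]]; rewrite old_cell_neq_edge.
Qed.

Lemma split_order_total : total_order L -> total_order (split_order L).
Proof.
case/and3P => /forallP irr /forallP tr /forallP tot.
have irr' c : (c, c) \notin split_order L.
  have [->|->|[c' ->]] := cellSP c; last by rewrite split_order_old.
  - rewrite split_orderE; apply/negP => /or4P[/andP[_ /eqP]//|/andP[_ /existsP[p]]|/andP[/eqP]//|].
      by rewrite old_cell_neq_vertex.
    by move=> /existsP[p /and3P[_]]; rewrite old_cell_neq_vertex.
  - rewrite split_orderE; apply/negP => /or4P[/andP[/eqP]//|/andP[/eqP]//|/andP[_ /existsP[p]]|].
      by rewrite old_cell_neq_edge.
    by move=> /existsP[p /and3P[_]]; rewrite old_cell_neq_edge.
have [t1 t2] := split_order_top.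
apply/and3P; split; first exact/forallP.
- apply/forallP => x; apply/forallP => y; apply/forallP => z; apply/implyP => /andP[].
  have [->|->|[x' ->]] := cellSP x; have [->|->|[y' ->]] := cellSP y; have [->|->|[z' ->]] := cellSP z;
    rewrite ?(negbTE (irr' _)) ?(negbTE t2) // ?(negbTE (split_order_first _).2) ?(negbTE (split_order_second _).2) //;
    rewrite ?(split_order_first _).1 ?(split_order_second _).1 //.
  rewrite !split_order_old => h1 h2; have /implyP := forallP (forallP (tr x') y') z'; apply.
  by rewrite h1.
- apply/forallP => x; apply/forallP => y; apply/implyP.
  have [->|->|[x' ->]] := cellSP x; have [->|->|[y' ->]] := cellSP y; rewrite ?eqxx // ?t1 ?orbT //;
    rewrite ?(split_order_first _).1 ?(split_order_second _).1 ?orbT //.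
  rewrite !split_order_old (inj_eq old_cell_inj).
  exact: (implyP (forallP (tot x') y')).
Qed.
End SplitOrder.

Lemma tri_succ a b c l : tri a.+1 b c l = (tri a b c l + (l == i0))%N.
Proof. by move: l; apply: ord3P; rewrite /tri /= ?addn0 ?addn1. Qed.

(** * Moving the hair of an end to the start of the first strand *)

Section Shift.
Variables (a b c : nat).
Local Notation A0 := (tri a b c).
Local Notation A1 := (tri a.+1 b c).

Lemma shift_vert_proof (s : {l : 'I_3 & 'I_(A0 l)}) : (tagged s + (tag s == i0) < A1 (tag s))%N.
Proof. by rewrite tri_succ ltn_add2r. Qed.

Definition shift_strand (s : {l : 'I_3 & 'I_(A0 l)}) : {l : 'I_3 & 'I_(A1 l)} :=
  @Tagged _ (tag s) (fun l => 'I_(A1 l)) (Ordinal (shift_vert_proof s)).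

Lemma shift_edge_proof (s : tedge A0) : (tagged s + (tag s == i0) < (A1 (tag s)).+1)%N.
Proof. by rewrite tri_succ -[X in (_ < X)%N]addSn ltn_add2r. Qed.

Definition shift_edge (s : tedge A0) : tedge A1 :=
  @Tagged _ (tag s) (fun l => 'I_(A1 l).+1) (Ordinal (shift_edge_proof s)).

Definition new_strand : {l : 'I_3 & 'I_(A1 l)} :=
  @Tagged _ i0 (fun l => 'I_(A1 l)) (@Ordinal a.+1 0 isT).

Definition shift_vert (t : tvert A0) : tvert A1 := sum_map id shift_strand t.

Lemma shift_strand_inj : injective shift_strand.
Proof.
move=> s t E; have E1 := congr1 tag E; have /= E2 := congr1 (fun s => nat_of_ord (tagged s)) E.
have e : (tag s == i0) = (tag t == i0) := congr1 (fun l => l == i0) E1.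
by apply: tag_ord_eq => //; move: E2; rewrite e => /addIn.
Qed.

Lemma shift_edge_inj : injective shift_edge.
Proof.
move=> s t E; have E1 := congr1 tag E; have /= E2 := congr1 (fun s : tedge A1 => nat_of_ord (tagged s)) E.
have e : (tag s == i0) = (tag t == i0) := congr1 (fun l => l == i0) E1.
by apply: tedge_eq => //; move: E2; rewrite e => /addIn.
Qed.

Lemma shift_vert_inj : injective shift_vert.
Proof.
move=> [x|s] [y|t] //= E; first by case: E => ->.
congr inr; apply: shift_strand_inj.
exact: (congr1 (fun x : tvert A1 => if x is inr s then s else new_strand) E).
Qed.

Lemma shift_vert_new t : shift_vert t <> inr new_strand.
Proof.
case: t => [//|s] E.
have E1 : tag s = i0 := congr1 (fun x : tvert A1 => if x is inr s then tag s else i0) E.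
have := congr1 (fun x : tvert A1 => if x is inr s then nat_of_ord (tagged s) else 0%N) E.
have e : (tag s == i0) = true := congr1 (fun l => l == i0) E1.
by rewrite /= e addn1.
Qed.

(** The start of strand [i0] is excluded: what was its first edge now begins at the new vertex and
    no longer at the end. *)
Lemma shift_vert_tv l p : (0 < p)%N || (l != i0) -> shift_vert (tv A0 l p) = tv A1 l (p + (l == i0)).
Proof.
case: p => [/=|p _]; first by move=> /negbTE ->.
have [h|h] := ltnP p (A0 l).
  have h' : (p + (l == i0) < A1 l)%N by rewrite tri_succ ltn_add2r.
  by rewrite (tvS h) addSn (tvS h') /=; congr inr; apply: tag_ord_eq.
by rewrite tv_last // addSn tv_last // tri_succ leq_add2r.
Qed.

Lemma shift_vert_tlt t t' : tlt (shift_vert t) (shift_vert t') = tlt t t'.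
Proof.
case: t t' => [x|[l p]] [y|[l' p']] //=; case: (l =P l') => [e|//]; subst l'.
by rewrite /= ltn_add2r.
Qed.

Variables (d1 : bool).
Local Notation D0 := (fun i : bool => if i then d1 else true).
Local Notation D1 := (fun i : bool => if i then d1 else false).

Definition shift_hair_val (t : tvert A0) : tvert A1 :=
  if t == inl false then inr new_strand else shift_vert t.

Lemma shift_hair_proof (x : thair A0 D0) : bearing D1 (shift_hair_val (val x)).
Proof. by case: x => -[[]|s]. Qed.

Definition shift_hair (x : thair A0 D0) : thair A1 D1 :=
  exist (fun t => bearing D1 t) _ (shift_hair_proof x).

Lemma shift_hair_inj : injective shift_hair.
Proof.
move=> x y /(congr1 val) /=; rewrite /shift_hair_val => E; apply: val_inj; move: E.
case: eqP => [ex|_]; case: eqP => [ey|_].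
- by move=> _; exact: etrans ex (esym ey).
- by move=> /esym/shift_vert_new.
- by move=> /shift_vert_new.
- exact: shift_vert_inj.
Qed.
End Shift.

Lemma inl_eq (A B : Type) (x y : A) : @inl A B x = inl y -> x = y. Proof. by case. Qed.
Lemma inr_eq (A B : Type) (x y : B) : @inr A B x = inr y -> x = y. Proof. by case. Qed.

Lemma card_thair d a : #|thair a d| = (d false + d true + (a i0 + a i1 + a i2))%N.
Proof.
rewrite card_sig -sum1_card big_mkcond big_sumType /= big_bool /= addnC.
rewrite sum1_card card_tagged_ord addnC; congr addn.
by rewrite !unfold_in /=; case: (d true) (d false) => [] [].
Qed.

Lemma card_tedge a : #|tedge a| = (a i0 + a i1 + a i2 + 3)%N.
Proof. by rewrite (card_tagged_ord (fun l => (a l).+1)) /=; lia. Qed.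

Lemma card_tvert a : #|tvert a| = (a i0 + a i1 + a i2).+2.
Proof. by rewrite card_sum card_bool card_tagged_ord. Qed.

Section Split.
Variables (k n e : nat) (g : ograph k n e) (tg : total_order g.2).

Lemma split_olt A v u w : olt (o := obj (split_graph g.1 v A, split_order g.2)) u w =
  match unlift ord0 u, unlift ord0 w with
  | None, None => false | None, Some _ => true | Some _, None => false
  | Some u', Some w' => olt (o := obj g) u' w' end.
Proof.
have irr := total_order_tournament (split_order_total tg).
rewrite /=; case: (unliftP ord0 u) => [u'|] ->; case: (unliftP ord0 w) => [w'|] ->.
- exact: (split_order_old _ (inl (inr u')) (inl (inr w'))).
- by apply/negbTE; have [_] := split_order_first g.2 (inl (inr u')).
- by have [] := split_order_first g.2 (inl (inr w')).
- by rewrite irr eqxx.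
Qed.

Lemma big_addb_recl (m : nat) (F : 'I_m.+1 -> bool) :
  \big[addb/false]_j F j = F ord0 (+) \big[addb/false]_j F (lift ord0 j).
Proof. exact: big_ord_recl. Qed.

Section Block.
Variables (a b c : nat) (d1 : bool).
Variable f : iso (obj g) (Th true d1 a b c).
Variable v : 'I_n.
Hypothesis fv0 : iV f v = inl false.
Variable A : {set halfedge e}.
Hypothesis AP : forall j s, ((j, s) \in A) = match iE f j with
   | inl y => ~~ (s (+) ifl f j) && (y == tfirst _ i0)
   | inr x => ~~ (s (+) ifl f j) && (val x == inl false) end.

Let pV (u : 'I_n.+1) : tvert (tri a.+1 b c) :=
  if unlift ord0 u is Some w then shift_vert (iV f w) else inr (new_strand a b c).
Let pE (j : 'I_e.+1) : oE (Th false d1 a.+1 b c) :=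
  if unlift ord0 j is Some i then
    match iE f i with inl y => inl (shift_edge y) | inr x => inr (shift_hair x) end
  else inl (tfirst (tri a.+1 b c) i0).
Let pX (i : 'I_k) : oX (Th false d1 a.+1 b c) := shift_hair (iX f i).
Let pfl (j : 'I_e.+1) : bool := if unlift ord0 j is Some i then ifl f i else false.

Let pV_inj : injective pV.
Proof.
move=> u w; rewrite /pV; case: (unliftP ord0 u) => [u'|] ->; case: (unliftP ord0 w) => [w'|] -> //.
- by move/shift_vert_inj/(bij_inj (iVbij f)) => ->.
- by move/shift_vert_new.
- by move/esym/shift_vert_new.
Qed.

Let pX_inj : injective pX.
Proof. by move=> i j /shift_hair_inj/(bij_inj (iXbij f)). Qed.

Let pE_inj : injective pE.
Proof.
have nf (y : tedge (tri a b c)) : shift_edge y <> tfirst (tri a.+1 b c) i0.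
  move=> E; have E1 : tag y = i0 := congr1 tag E.
  have := congr1 (fun y : tedge (tri a.+1 b c) => nat_of_ord (tagged y)) E.
  have e1 : (tag y == i0) = true := congr1 (fun l => l == i0) E1.
  by rewrite /= e1 addn1.
have key i j : iE f i = iE f j -> i = j by move/(bij_inj (iEbij f)).
move=> u w; rewrite /pE; case: (unliftP ord0 u) => [u'|] ->; case: (unliftP ord0 w) => [w'|] -> //.
- case Eu : (iE f u') => [y|x]; case Ew : (iE f w') => [y'|x'] //.
    move=> E; have yy := shift_edge_inj (inl_eq E); congr lift; apply: key; by rewrite Eu Ew yy.
  move=> E; have xx := shift_hair_inj (inr_eq E); congr lift; apply: key; by rewrite Eu Ew xx.
- by case: (iE f u') => [y|x] // E; case: (nf _ (inl_eq E)).
- by case: (iE f w') => [y|x] // E; case: (nf _ (inl_eq (esym E))).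
Qed.

Let bX : bijective pX.
Proof.
apply: (inj_card_bij pX_inj); rewrite card_ord -[X in (_ <= X)%N](card_ord k) (bij_eq_card (iXbij f)).
by rewrite !card_thair /tri /=; lia.
Qed.

Let bV : bijective pV.
Proof.
apply: (inj_card_bij pV_inj).
have := bij_eq_card (iVbij f); rewrite !card_tvert !card_ord /= => ->; rewrite /tri /=; lia.
Qed.

Let bE : bijective pE.
Proof.
apply: (inj_card_bij pE_inj).
have := bij_eq_card (iEbij f); rewrite !card_sum !card_tedge !card_thair !card_ord /tri /= => ->; lia.
Qed.

Let inc (j : 'I_e.+1) s : @oinc (Th false d1 a.+1 b c) (pE j) (s (+) pfl j) =
  sum_map pX pV (@oinc (obj (split_graph g.1 v A, split_order g.2)) j s).
Proof.
rewrite /= ffunE /= /pE /pfl; case: (unliftP ord0 j) => [i _|_] /=; last first.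
  rewrite addbF /tinc /= add0n; case: s => /=; rewrite /pV.
    by rewrite unlift_none (tvS (isT : (0 < tri a.+1 b c i0)%N)); congr (inr (inr _)); exact: tag_ord_eq.
  by rewrite liftK fv0.
have inci := iinc f i s; rewrite AP.
have oldE x : sum_map pX pV (old_vertex x) = sum_map (@shift_hair a b c d1) (@shift_vert a b c) (sum_map (iX f) (iV f) x).
  by case: x => [q|q] //=; rewrite /pV liftK.
have newE : sum_map pX pV (@new_vertex k n) = inr (inr (new_strand a b c)).
  by rewrite /= /pV unlift_none.
rewrite (fun_if (sum_map pX pV)) newE oldE -inci.
case: (iE f i) => [y|x] /=; case: (s (+) ifl f i) => //=.
- rewrite /tinc shift_vert_tv ?addn1 //=; congr (inr (tv _ _ _)); lia.
- rewrite /tinc !addn0; case: eqP => [->|ny].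
    rewrite /= addn1 (tvS (isT : (0 < tri a.+1 b c i0)%N)); congr (inr (inr _)); exact: tag_ord_eq.
  rewrite shift_vert_tv //; case: posnP => //= p0; apply/eqP => t0; apply: ny.
  by apply: tedge_eq.
- by rewrite /shift_hair_val; case: ifP.
Qed.

(** The new edge becomes the first edge of strand [i0], without reversal. The new vertex is the
    first one in the split order but has the two ends before it in [tlt]; these two inversions
    cancel, so the sign does not change. *)
Lemma split_block_iso : exists f' : iso (obj (split_graph g.1 v A, split_order g.2)) (Th false d1 a.+1 b c),
  isgn f' = isgn f.
Proof.
exists (@Iso (obj (split_graph g.1 v A, split_order g.2)) (Th false d1 a.+1 b c) pX pV pE pfl bX bV bE inc).
rewrite /isgn; congr addb.
  change (\big[addb/false]_j pfl j = \big[addb/false]_j ifl f j).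
  rewrite big_addb_recl {1}/pfl unlift_none addFb.
  by apply: eq_bigr => j _; rewrite /pfl liftK.
change (inversions (@olt (obj (split_graph g.1 v A, split_order g.2))) (@tlt (tri a.+1 b c)) pV =
  inversions (@olt (obj g)) (@tlt (tri a b c)) (iV f)).
rewrite !inversions_pair big_addb_recl.
rewrite [X in X (+) _](_ : _ = false) ?addFb; last first.
  rewrite big_addb_recl !split_olt !unlift_none addFb.
  under eq_bigr => w _ do rewrite split_olt unlift_none liftK andTb /pV unlift_none liftK.
  have [h hK Kh] := iVbij f.
  rewrite (reindex h) /=; last by exists (iV f) => x _; [exact: Kh|exact: hK].
  under eq_bigr => t _ do rewrite Kh.
  rewrite big_sumType /= big_bool /= big1 // => s _; apply/negbTE; rewrite negbK.
  apply/orP; have [ts|ts] := eqVneq (tag s) i0; [right|left].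
    by rewrite addn1.
  by move: (tag s) ts; apply: ord3P.
apply: eq_bigr => u _; rewrite big_addb_recl split_olt liftK unlift_none andFb addFb.
by apply: eq_bigr => w _; rewrite split_olt !liftK /pV !liftK shift_vert_tlt.
Qed.

End Block.
End Split.

Lemma tperm_lift m (v w : 'I_m) :
  tperm ord0 (lift ord0 v) (lift ord0 w) = if w == v then ord0 else lift ord0 w.
Proof.
case: eqP => [->|wv]; first by rewrite tpermR.
by rewrite tpermD ?neq_lift //; apply: contra_notN wv => /eqP/lift_inj.
Qed.

(* Exchanging the old and the new vertex reverses the new edge: the two signs cancel. *)
Lemma complement_iso k n e (g : ograph k n e) (v : 'I_n) (A : {set halfedge e}) :
  total_order g.2 -> {subset A <= halfedges g.1 (inr v)} ->
  exists f : iso (obj (split_graph g.1 v A, split_order g.2))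
                 (obj (split_graph g.1 v (halfedges g.1 (inr v) :\: A), split_order g.2)),
    isgn f = false.
Proof.
move=> tg AD; set B := _ :\: _.
pose t := tperm ord0 (lift ord0 v).
have inc (j : 'I_e.+1) s :
    @oinc (obj (split_graph g.1 v B, split_order g.2)) j (s (+) (j == ord0)) =
    sum_map id t (@oinc (obj (split_graph g.1 v A, split_order g.2)) j s).
  rewrite /= !ffunE /=; case: (unliftP ord0 j) => [i|] ->; last first.
    rewrite eqxx addbT; case: s => /=; first by rewrite /t tpermL.
    by rewrite /t tpermR.
  rewrite eq_sym (negbTE (neq_lift _ _)) addbF.
  have BE : ((i, s) \in B) = (g.1 (i, s) == inr v) && ((i, s) \notin A) by rewrite !inE andbC.
  rewrite BE; case Av : ((i, s) \in A).
    have := AD _ Av; rewrite inE => /eqP ->; rewrite andbF /= /t tpermL //.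
  rewrite andbT; case Gv : (g.1 (i, s)) => [x|w] //=.
  by rewrite /t tperm_lift (inj_eq (@inr_inj _ _)); case: eqP.
have bt : bijective t by exact: injF_bij (@perm_inj _ t).
have bi (T : Type) : bijective (@id T) by exists id.
exists (@Iso (obj (split_graph g.1 v A, split_order g.2)) (obj (split_graph g.1 v B, split_order g.2))
  id t id (fun j => j == ord0) (bi _) bt (bi _) inc).
rewrite /isgn.
change ((\big[addb/false]_(j < e.+1) (j == ord0)) (+)
  inversions (@olt (obj (split_graph g.1 v A, split_order g.2)))
    (@olt (obj (split_graph g.1 v B, split_order g.2))) t = false).
rewrite big_addb_recl eqxx [X in _ (+) X (+) _]big1 => [|j _]; last by rewrite eq_sym (negbTE (neq_lift _ _)).
have to := obj_tournament tg.
have irr w : olt (o := obj g) w w = false by rewrite to eqxx.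
rewrite inversions_pair big_addb_recl big_addb_recl !(split_olt tg) unlift_none andFb addFb.
(* The vertices that precede [v] are inverted with the new vertex here and counted once more in the
   next sum; what remains is the inversion of [v] with the new vertex. *)
have -> : \big[addb/false]_(w < n) (olt (o := obj (split_graph g.1 v A, split_order g.2)) ord0 (lift ord0 w) &&
    ~~ olt (o := obj (split_graph g.1 v B, split_order g.2)) (t ord0) (t (lift ord0 w))) =
  \big[addb/false]_(w < n) ((w == v) (+) olt (o := obj g) w v).
  apply: eq_bigr => w _; rewrite (split_olt tg) unlift_none liftK /t tpermL tperm_lift (split_olt tg) liftK.
  case: eqP => [->|/eqP wv]; first by rewrite unlift_none irr.
  by rewrite liftK (to v w) eq_sym wv /= negbK.
have -> : \big[addb/false]_(u < n) \big[addb/false]_(w < n.+1)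
    (olt (o := obj (split_graph g.1 v A, split_order g.2)) (lift ord0 u) w &&
    ~~ olt (o := obj (split_graph g.1 v B, split_order g.2)) (t (lift ord0 u)) (t w)) =
  \big[addb/false]_(u < n) olt (o := obj g) u v.
  apply: eq_bigr => u _; rewrite big_addb_recl (split_olt tg) liftK unlift_none andFb addFb.
  rewrite (bigD1 v) // big1 ?addbF => [|w /andP[_ wv]].
    rewrite (split_olt tg) !liftK /t tpermR tperm_lift (split_olt tg) unlift_none.
    by case: (u =P v) => [->|_]; rewrite ?irr ?liftK ?andbT /= ?addbF.
  rewrite (split_olt tg) !liftK /t !tperm_lift (negbTE wv) (split_olt tg) liftK.
  by case: eqP => [->|_]; rewrite ?unlift_none ?andbF // liftK andbN.
rewrite big_split /= (bigD1 v) //= eqxx big1 => [|w /negbTE //].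
by case: (\big[addb/false]_(u < n) _).
Qed.

Section Value.
Variables (k n e : nat) (g : ograph k n e) (tg : total_order g.2).

Lemma splitting_valence v P : splitting g.1 v P -> (4 <= valence g.1 (inr v))%N.
Proof.
case/and3P => pP /eqP cP /forall_inP aP.
rewrite /valence (card_partition pP).
have : (\sum_(A in P) 2 <= \sum_(A in P) #|A|)%N by exact: leq_sum.
by rewrite sum_nat_const cP.
Qed.

Lemma splitting_new_block v P : splitting g.1 v P -> new_block P \in P.
Proof.
case/and3P => _ /eqP cP _; rewrite /new_block; case: pickP => //= no.
by move: cP; rewrite (eq_card0 no).
Qed.

Lemma splitting_two v P A B : splitting g.1 v P -> A \in P -> B \in P -> A != B ->
  P = [set A; B] /\ B = halfedges g.1 (inr v) :\: A.
Proof.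
case/and3P => /and3P[/eqP covP trP _] /eqP cP _ AP BP AB.
have PE : P = [set A; B].
  by apply/esym/eqP; rewrite eqEcard cP cards2 AB andbT subUset !sub1set AP BP.
split=> //; have := trivIsetP trP A B AP BP AB; rewrite -setI_eq0 => /eqP dAB.
rewrite -covP PE /cover big_setU1 ?inE //= big_set1 setDUl setDv set0U.
by apply/esym/setDidPl; rewrite -setI_eq0 setIC dAB.
Qed.

Variable F : bool -> bool -> nat -> nat -> nat -> rat.
Hypothesis FI : theta_invariant F.
Variable phi : ograph k n.+1 e.+1 -> rat.
Hypothesis phiP : forall g' d0 d1 a b c (f : iso (Th d0 d1 a b c) (obj g')),
  total_order g'.2 -> phi g' = (-1) ^+ isgn f * F d0 d1 a b c.

Section OneEnd.
Variables (d0 d1 : bool) (a b c : nat) (f : iso (Th d0 d1 a b c) (obj g)).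

Definition first_half l : halfedge e :=
  (iE f (inl (tfirst (tri a b c) l)), ifl f (inl (tfirst (tri a b c) l))).

Lemma first_half_inj : injective first_half.
Proof.
move=> l l' E; have := bij_inj (iEbij f) (congr1 fst E) => /= E'.
exact: (congr1 (fun y : oE (Th d0 d1 a b c) => if y is inl e then tag e else i0) E').
Qed.

Lemma first_half_end l : g.1 (first_half l) = inr (iV f (inl false)).
Proof. exact: (iinc f (inl (tfirst (tri a b c) l)) false). Qed.

Lemma half_end_cases h : g.1 h = inr (iV f (inl false)) ->
  (exists l, h = first_half l) \/ exists x, h = (iE f (inr x), ifl f (inr x)) /\ val x = inl false.
Proof.
move=> hv; have [gE EK KE] := iEbij f.
pose y := gE h.1; pose s := h.2 (+) ifl f y.
have hE : h = (iE f y, s (+) ifl f y).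
  by rewrite /s -addbA addbb addbF /y KE -surjective_pairing.
have := iinc f y s; rewrite [oinc _ _](_ : _ = g.1 h); last by rewrite hE.
rewrite hv => E.
have {}E : inr (inl false) = oinc y s.
  case O : (oinc y s) E => [x|t] //= E; congr inr.
  by apply: (bij_inj (iVbij f)); apply: inr_eq E.
case: y s hE E => [y|x] s hE /=; last by case: s hE => // hE E; right; exists x; split=> //; apply/esym/inr_eq/E.
move=> E; have := tv_inl_false (esym (inr_eq E)) => /eqP; rewrite addn_eq0 => /andP[/eqP y0 s0].
left; exists (tag y); rewrite hE /first_half.
have -> : s = false by case: (s) s0.
have -> // : y = tfirst (tri a b c) (tag y) by apply: tedge_eq.
Qed.
End OneEnd.

Section Hairy.
Variables (d1 : bool).
Definition end_hair a b c : thair (tri a b c) (fun i : bool => if i then d1 else true) :=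
  exist (fun t => bearing (fun i : bool => if i then d1 else true) t) (inl false : tvert (tri a b c)) isT.
Definition hair_half a b c (f : iso (Th true d1 a b c) (obj g)) : halfedge e :=
  (iE f (inr (end_hair a b c)), ifl f (inr (end_hair a b c))).

(** The explicit isomorphism is for the block of the hair and the first half-edge. If [new_block]
    chooses the other block, [complement_iso] exchanges the old and the new vertex without a
    sign. *)
Lemma split_value a b c (f : iso (Th true d1 a b c) (obj g)) P :
  splitting g.1 (iV f (inl false)) P -> [set hair_half f; first_half f i0] \in P ->
  phi (split_graph g.1 (iV f (inl false)) (new_block P), split_order g.2) =
  (-1) ^+ isgn f * F false d1 a.+1 b c.
Proof.
set v := iV f _; set B := [set _; _] => sP BP.
have tT := theta_tournament; have tg' := obj_tournament tg.
have [f1 [s1 fVK fEK flK]] := iso_sym f (tT _ _) tg'.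
have [gE EK KE] := iEbij f.
have AP j s : ((j, s) \in B) = match iE f1 j with
   | inl y => ~~ (s (+) ifl f1 j) && (y == tfirst _ i0)
   | inr x => ~~ (s (+) ifl f1 j) && (val x == inl false) end.
  rewrite -(KE j); set y := gE j; rewrite fEK flK !inE !xpair_eqE !(inj_eq (bij_inj (iEbij f))).
  have sE c' : ~~ (s (+) c') = (s == c') by case: s c' => [] [].
  case: y => [y|x]; rewrite [X in _ = X]/= sE.
    apply/orP/andP => [[/andP[/eqP E]|/andP[/eqP E /eqP ->]]|[/eqP -> /eqP ->]] //.
      by rewrite (inl_eq E) !eqxx.
    by right; rewrite !eqxx.
  apply/orP/andP => [[/andP[/eqP E /eqP ->]|/andP[/eqP E]]|[/eqP -> /eqP xe]] //.
    by rewrite (inr_eq E) !eqxx.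
  have -> : x = end_hair a b c by apply: val_inj.
  by left; rewrite !eqxx.
have [f2 s2] := split_block_iso (v := v) tg (fVK (inl false)) AP.
have tS : total_order (split_order g.2) by exact: split_order_total.
have tS' X : tournament (@olt (obj (split_graph g.1 v X, split_order g.2))) by exact: obj_tournament.
have [f3 [s3 _ _ _]] := iso_sym f2 (tS' _) (tT _ _).
have [->|ne] := eqVneq (new_block P) B; first by rewrite (phiP f3) // s3 s2 s1.
have [_ ->] := splitting_two sP BP (splitting_new_block sP) ltac:(by rewrite eq_sym).
have BD : {subset B <= halfedges g.1 (inr v)}.
  move=> h; rewrite !inE => /orP[]/eqP ->; last by rewrite first_half_end.
  by apply/eqP; exact: (iinc f (inr (end_hair a b c)) false).
have [f4 s4] := complement_iso tg BD.
rewrite (phiP (iso_comp f4 f3)) //.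
by rewrite (isgn_comp _ _ (tT _ _) (tS' _) (tS' _)) s4 addbF s3 s2 s1.
Qed.

Section RelabelHalves.
Variables (a b c a' b' c' : nat).
Variables (f : iso (Th true d1 a b c) (obj g)) (r : iso (Th true d1 a' b' c') (Th true d1 a b c)).
Hypothesis r0 : iV r (inl false) = inl false.

Lemma hair_half_comp : hair_half (iso_comp f r) = hair_half f.
Proof.
have [y [h1 h2 h3]] := iso_hair r (end_hair a' b' c').
have yE : y = end_hair a b c by apply: val_inj; rewrite -h3 /= r0.
by rewrite /hair_half /= h1 h2 yE.
Qed.

Lemma first_half_comp l l' : iE r (inl (tfirst _ l)) = inl (tfirst _ l') ->
  first_half (iso_comp f r) l = first_half f l'.
Proof.
move=> h1; have [e' [h2 h3]] := iso_frame_edge r (tfirst _ l).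
have fl0 : ifl r (inl (tfirst (tri a' b' c') l)) = false.
  have := h3 false; rewrite {2}/tinc /= r0 /tinc => /tv_inl_false /eqP.
  by rewrite addn_eq0 => /andP[_]; case: (ifl r _).
by rewrite /first_half /= h1 fl0.
Qed.
End RelabelHalves.
End Hairy.

(** A strand is moved to the front, grows by one hair and is moved back. For the second strand the
    sign is (-1)^(ab + a(b+1)) = (-1)^a, for the third (-1)^((a+b)c + (a+b)(c+1)) = (-1)^(a+b). *)
Definition theta_diff (d0 d1 : bool) (a b c : nat) : rat :=
  F d0 d1 a.+1 b c + (-1) ^+ a * F d0 d1 a b.+1 c + (-1) ^+ (a + b) * F d0 d1 a b c.+1.

(** An end without a hair is trivalent and has no splitting. With a hair it has valence 4, and a
    splitting into two pairs amounts to the choice of the strand whose first half-edge goes with the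
    hair. *)
Lemma end_value d0 d1 a b c (f : iso (Th d0 d1 a b c) (obj g)) :
  \sum_(P | splitting g.1 (iV f (inl false)) P)
     phi (split_graph g.1 (iV f (inl false)) (new_block P), split_order g.2) =
  if d0 then (-1) ^+ isgn f * theta_diff false d1 a b c else 0.
Proof.
set v := iV f _; case: d0 f @v => f v; last first.
  rewrite big_pred0 // => P; apply/negP => /splitting_valence; apply/negP; rewrite -leqNgt.
  have sub : halfedges g.1 (inr v) \subset first_half f @: setT.
    apply/subsetP => h; rewrite inE => /eqP/half_end_cases[[l ->]|[[x hx] [_ /= xe]]].
      by apply/imsetP; exists l.
    by move: hx; rewrite xe.
  apply: leq_trans (subset_leq_card sub) _.
  by rewrite (leq_trans (leq_imset_card _ _)) // cardsT card_ord.
set D := halfedges g.1 (inr v).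
pose hh := hair_half f; pose H := first_half f.
have hhD : hh \in D by rewrite inE; apply/eqP; exact: (iinc f (inr (end_hair d1 a b c)) false).
have HD l : H l \in D by rewrite inE first_half_end.
have Hinj : injective H by exact: first_half_inj.
have hhH l : hh <> H l.
  by move=> /(congr1 fst)/(bij_inj (iEbij f)).
have DE h : h \in D -> h = hh \/ exists l, h = H l.
  rewrite inE => /eqP/half_end_cases[[l ->]|[x [-> xe]]]; first by right; exists l.
  by left; have -> : x = end_hair d1 a b c by apply: val_inj.
have cD : #|D| = 4.
  have -> : D = hh |: (H @: setT).
    apply/setP => h; rewrite in_setU1; apply/idP/orP => [/DE[->|[l ->]]|[/eqP ->|/imsetP[l _ ->]]] //.
    - by left.
    - by right; apply/imsetP; exists l.
  rewrite cardsU1 card_imset // cardsT card_ord.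
  by case: imsetP => // -[l _ /hhH].
pose B l := [set hh; H l]; pose Q l := [set B l; D :\: B l].
have cB l : #|B l| = 2 by rewrite cards2; case: eqP => // /hhH.
have BD l : B l \subset D by rewrite subUset !sub1set hhD HD.
have cDB l : #|D :\: B l| = 2 by rewrite cardsD (setIidPr (BD l)) cD cB.
have hB l : hh \in B l by rewrite !inE eqxx.
have neB l l' : B l <> D :\: B l' by move=> E; have := hB l; rewrite E inE hB.
have dB l : B l :&: (D :\: B l) = set0.
  by apply/setP => h; rewrite in_setI in_setD in_set0; case: (h \in B l).
have Qs l : splitting g.1 v (Q l).
  apply/and3P; split.
  - apply/and3P; split.
    + rewrite /cover /Q big_setU1 ?inE; last by apply/eqP/neB.
      by rewrite big_set1 /= -[X in _ == X](setID D (B l)) (setIidPr (BD l)).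
    + apply/trivIsetP => X Y; rewrite !inE => /orP[]/eqP -> /orP[]/eqP ->; rewrite ?eqxx // => _.
        by rewrite -setI_eq0 dB.
      by rewrite -setI_eq0 setIC dB.
    + by rewrite !inE; apply/norP; split; apply/eqP => E; [have := cB l|have := cDB l]; rewrite -E cards0.
  - by rewrite cards2 (introF eqP (@neB l l)).
  - by apply/forall_inP => X; rewrite !inE => /orP[]/eqP ->; rewrite ?cB ?cDB.
have BQ l : B l \in Q l by rewrite !inE eqxx.
have Qinj : injective Q.
  move=> l l' E; have : B l \in Q l' by rewrite -E BQ.
  rewrite !inE => /orP[]/eqP; last by move/neB.
  move=> EB; have : H l \in B l' by rewrite -EB !inE eqxx orbT.
  by rewrite !inE => /orP[]/eqP; [move/esym/hhH|move/Hinj].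
have Qsurj P : splitting g.1 v P -> exists l, P = Q l.
  move=> sP; have /and3P[pP /eqP cP aP] := sP.
  have /and3P[/eqP covP trP n0P] := pP.
  have hhP : hh \in cover P by rewrite covP.
  pose A := pblock P hh; have AP : A \in P by exact: pblock_mem.
  have hA : hh \in A by rewrite mem_pblock.
  have [A' A'P AA'] : exists2 A', A' \in P & A != A'.
    have : #|P :\ A| = 1%N by move: (cardsD1 A P); rewrite AP cP => -[].
    by move/eqP/cards1P => [A' E]; have := set11 A'; rewrite -E !inE => /andP[ne ?]; exists A'; rewrite // eq_sym.
  have [PE A'E] := splitting_two sP AP A'P AA'.
  have c1 := forall_inP aP _ AP; have c2 := forall_inP aP _ A'P.
  have AD : A \subset D by apply/subsetP => x xA; rewrite /D -covP; apply/bigcupP; exists A.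
  have cA : #|A| = 2.
    by move: c2; rewrite A'E cardsD (setIidPr AD) cD; move: c1; case: #|A| => [|[|[|[|m]]]].
  have : #|A :\ hh| = 1%N by move: (cardsD1 hh A); rewrite hA cA => -[].
  move/eqP/cards1P => [z E].
  have zA : z \in A :\ hh by rewrite E inE.
  move: zA; rewrite !inE => /andP[/eqP zh zA].
  have [//|[l zl]] := DE z (subsetP AD _ zA).
  exists l; rewrite PE A'E; have -> // : A = B l.
  by rewrite -(setD1K hA) E zl.
rewrite (eq_bigl (fun P => P \in Q @: [set: 'I_3])); last first.
  move=> P; apply/idP/imsetP => [/Qsurj[l ->]|[l _ ->]]; [by exists l|exact: Qs].
rewrite big_imset /=; last by move=> l l' _ _; exact: Qinj.
rewrite big_mkcond !big_ord_recl big_ord0 /= !inE addr0 /theta_diff.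
have o1 : lift ord0 ord0 = i1 :> 'I_3 by apply: val_inj.
have o2 : lift ord0 (lift ord0 ord0) = i2 :> 'I_3 by apply: val_inj.
have o0 : ord0 = i0 :> 'I_3 by apply: val_inj.
rewrite o1 o2 o0.
have tT := theta_tournament; have tg' := obj_tournament tg.
have V0 : phi (split_graph g.1 v (new_block (Q i0)), split_order g.2) =
  (-1) ^+ isgn f * F false d1 a.+1 b c := split_value (Qs i0) (BQ i0).
have V1 : phi (split_graph g.1 v (new_block (Q i1)), split_order g.2) =
  (-1) ^+ isgn f * ((-1) ^+ a * F false d1 a b.+1 c).
  have [r [r1 r2 r3]] := swap01_iso true d1 a b c.
  have r0 := r1 false.
  have ev : iV (iso_comp f r) (inl false) = v by rewrite /= r0.
  have := @split_value _ _ _ _ (iso_comp f r) (Q i1).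
  rewrite ev (hair_half_comp f r0) (first_half_comp f r0 (r2 i0)) tpermL => ->; rewrite ?Qs ?BQ //.
  rewrite (isgn_comp _ _ (tT _ _) (tT _ _) tg') r3 (inv01 FI) /=.
  rewrite -(signr_odd _ a).
  rewrite !mulrA -!signr_addb_rat; congr (_ ^+ nat_of_bool _ * _).
  by case: (odd a) (odd b) (isgn f) => [] [] [].
have V2 : phi (split_graph g.1 v (new_block (Q i2)), split_order g.2) =
  (-1) ^+ isgn f * ((-1) ^+ (a + b) * F false d1 a b c.+1).
  have [r [r1 r2 r3]] := swap12_iso true d1 a b c.
  have [r' [r1' r2' r3']] := swap01_iso true d1 a c b.
  have r0 : iV (iso_comp r r') (inl false) = inl false by rewrite /= r1' r1.
  have rr : iE (iso_comp r r') (inl (tfirst _ i0)) = inl (tfirst _ i2).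
    by rewrite /= r2' tpermL r2 tpermL.
  have ev : iV (iso_comp f (iso_comp r r')) (inl false) = v by rewrite [LHS]/= r1' r1.
  have := @split_value _ _ _ _ (iso_comp f (iso_comp r r')) (Q i2).
  rewrite ev (hair_half_comp f r0) (first_half_comp f r0 rr) => ->; rewrite ?Qs ?BQ //.
  rewrite (isgn_comp _ _ (tT _ _) (tT _ _) tg') (isgn_comp _ _ (tT _ _) (tT _ _) (tT _ _)) r3 r3'.
  rewrite (inv01 FI) (inv12 FI) /= -(signr_odd _ (a + b)) oddD.
  rewrite !mulrA -!signr_addb_rat; congr (_ ^+ nat_of_bool _ * _).
  by case: (odd a) (odd b) (odd c) (isgn f) => [] [] [] [].
by rewrite V0 V1 V2 !mulrDr addrA.
Qed.

(** Inner vertices are trivalent and cannot be split; the second end is treated as the first one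
    after the flip, whose sign is [tau]. *)
Theorem diff_value d0 d1 a b c (f : iso (Th d0 d1 a b c) (obj g)) :
  \sum_(v < n) \sum_(P | splitting g.1 v P)
     phi (split_graph g.1 v (new_block P), split_order g.2) =
  (-1) ^+ isgn f * ((if d0 then theta_diff false d1 a b c else 0) +
                    (if d1 then (-1) ^+ tau a b c * theta_diff false d0 a b c else 0)).
Proof.
have tT := theta_tournament; have tg' := obj_tournament tg.
have [h hK Kh] := iVbij f.
rewrite (reindex (iV f)) /=; last by exists h => x _; [exact: hK|exact: Kh].
rewrite big_sumType /= big_bool /= [X in _ + X]big1 ?addr0; last first.
  move=> s _; rewrite big_pred0 // => P; apply/negP => /splitting_valence; apply/negP; rewrite -leqNgt.
  (* The labels distinguish the edge that arrives, the edge that leaves and the hair, so an inner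
     vertex has at most three half-edges. *)
  pose lab (y : oE (Th d0 d1 a b c)) (s : bool) : 'I_3 := if y is inl _ then if s then i0 else i1 else i2.
  have [gE EK KE] := iEbij f.
  pose q (x : halfedge e) := gE x.1.
  have qE x : x = (iE f (q x), (x.2 (+) ifl f (q x)) (+) ifl f (q x)).
    by rewrite -addbA addbb addbF /q KE -surjective_pairing.
  pose lb x := lab (q x) (x.2 (+) ifl f (q x)).
  have inj : {in halfedges g.1 (inr (iV f (inr s))) &, injective lb}.
    have key x : x \in halfedges g.1 (inr (iV f (inr s))) ->
        oinc (q x) (x.2 (+) ifl f (q x)) = inr (inr s : tvert (tri a b c)).
      have E0 : g.1 x = sum_map (iX f) (iV f) (oinc (q x) (x.2 (+) ifl f (q x))).
        by rewrite {1}[x]qE; exact: (iinc f (q x) (x.2 (+) ifl f (q x))).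
      rewrite inE E0 => /eqP; case: (@oinc (Th d0 d1 a b c) (q x) _) => // t E.
      by congr inr; apply: (bij_inj (iVbij f)); apply: inr_eq E.
    move=> x y /key kx /key ky; rewrite /lb /lab => E.
    suff [Eq Es] : q x = q y /\ x.2 (+) ifl f (q x) = y.2 (+) ifl f (q y).
      by rewrite [x]qE [y]qE Eq -Eq Es Eq.
    case: (q x) (x.2 (+) _) kx E => [u|u] [] kx; case: (q y) (y.2 (+) _) ky => [w|w] [] ky // _; split=> //.
    - have [t1 p1] := tv_inr (inr_eq kx); have [t2 p2] := tv_inr (inr_eq ky).
      congr inl; apply: tedge_eq; [by rewrite -t1|move: p1 p2 => /= p1 p2; lia].
    - have [t1 p1] := tv_inr (inr_eq kx); have [t2 p2] := tv_inr (inr_eq ky).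
      congr inl; apply: tedge_eq; [by rewrite -t1|move: p1 p2 => /= p1 p2; lia].
    - by congr inr; apply: val_inj; have := etrans (inr_eq kx) (esym (inr_eq ky)).
  by rewrite /valence -(card_in_imset inj) (leq_trans (max_card _)) // card_ord.
have if0 (b0 : bool) (x y : rat) : (if b0 then x * y else 0) = x * (if b0 then y else 0).
  by case: b0; rewrite ?mulr0.
rewrite end_value [LHS]addrC [RHS]mulrDr; congr (_ + _); first exact: if0.
have [r [r1 r2]] := flip_iso_Th d0 d1 a b c.
have := end_value (iso_comp f r); rewrite /= r1 /= => ->.
rewrite (isgn_comp _ _ (tT _ _) (tT _ _) tg') r2 !if0 mulrA.
by rewrite signr_addb_rat -[RHS]mulrA [RHS]mulrCA mulrA.
Qed.

End Value.

(** * Homology through a dual complex *)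

Section Pairing.
Variables (Q V : vectType rat) (B : Q -> V -> rat).
Hypotheses (Bl : forall x, linear (fun f => B f x : rat^o))
  (Br : forall f, linear (fun x => B f x : rat^o)).

Lemma pairingDr f x y : B f (x + y) = B f x + B f y.
Proof. by have := Br f 1 x y; rewrite !scale1r. Qed.

Lemma pairing0r f : B f 0 = 0.
Proof. by apply: (@addrI _ (B f 0)); rewrite -pairingDr !addr0. Qed.

Lemma pairingZr f a x : B f (a *: x) = a * B f x.
Proof. by have := Br f a x 0; rewrite pairing0r !addr0. Qed.

Lemma pairing_sum f (I : Type) (r : seq I) (P : pred I) (E : I -> V) :
  B f (\sum_(i <- r | P i) E i) = \sum_(i <- r | P i) B f (E i).
Proof. by apply: (big_morph (B f) (pairingDr f) (pairing0r f)). Qed.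
End Pairing.

(* Pairing with a basis of a complement of U0 in U embeds S / S0. *)
Lemma pairing_le (Q V : vectType rat) (B : Q -> V -> rat)
    (Bl : forall x, linear (fun f => B f x : rat^o))
    (Br : forall f, linear (fun x => B f x : rat^o))
    (S S0 : {vspace Q}) (U U0 : {vspace V}) :
  (forall f, f \in S -> (forall x, x \in U -> B f x = 0) -> f \in S0) -> (S0 <= S)%VS ->
  (forall x, x \in U0 -> forall f, f \in S -> B f x = 0) -> (U0 <= U)%VS ->
  (\dim S + \dim U0 <= \dim U + \dim S0)%N.
Proof.
move=> hS hS0 hU0 hU.
pose W := (U :\: U0)%VS; pose m := \dim W.
pose F : Q -> 'rV[rat]_m := fun f => \row_j B f (vbasis W)`_j.
have linF : linear F by move=> a f g; apply/rowP => j; rewrite !mxE Bl.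
pose FM : {linear Q -> 'rV[rat]_m} := HB.pack F (GRing.isLinear.Build _ _ _ _ F linF).
pose FL := linfun FM.
have FE f : FL f = F f by rewrite lfunE.
have kS : (S :&: lker FL <= S0)%VS.
  apply/subvP => f; rewrite memv_cap memv_ker FE => /andP[fS /eqP f0].
  apply: hS => // x xU; have : x \in (U0 + W)%VS.
    by move: xU; apply: subvP; rewrite addvC addv_diff (addv_idPl hU) subvv.
  case/memv_addP => y yU0 [z zW ->]; rewrite (pairingDr Br) (hU0 y yU0 f fS) add0r.
  rewrite (coord_vbasis zW) (pairing_sum Br) big1 // => j _; rewrite (pairingZr Br).
  by have := congr1 (fun u : 'rV_m => u 0 j) f0; rewrite !mxE => ->; rewrite mulr0.
have le1 : (\dim (FL @: S) <= m)%N.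
  by apply: leq_trans (dimvS (subvf _)) _; rewrite dimvf dim_matrix mul1r.
have := limg_ker_dim FL S; have := dimvS kS; have := dimv_cap_compl U U0.
rewrite (capv_idPr hU) -/W -/m; lia.
Qed.

(** Equality of the row and column rank of [B] between [S] and [U], from [pairing_le] applied to
    both sides. *)
Lemma pairing_rank (Q V : vectType rat) (B : Q -> V -> rat)
    (Bl : forall x, linear (fun f => B f x : rat^o))
    (Br : forall f, linear (fun x => B f x : rat^o))
    (S S0 : {vspace Q}) (U U0 : {vspace V}) :
  (forall f, f \in S0 <-> f \in S /\ forall x, x \in U -> B f x = 0) ->
  (forall x, x \in U0 <-> x \in U /\ forall f, f \in S -> B f x = 0) ->
  (\dim S + \dim U0 = \dim U + \dim S0)%N.
Proof.
move=> hS hU.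
have sS : (S0 <= S)%VS by apply/subvP => f /hS[].
have sU : (U0 <= U)%VS by apply/subvP => x /hU[].
have := pairing_le Bl Br (S := S) (S0 := S0) (U := U) (U0 := U0).
have := @pairing_le _ _ (fun x f => B f x) Br Bl U U0 S S0.
move=> h1 h2; apply/eqP; rewrite eqn_leq; apply/andP; split.
  by apply: h2 => // [f fS h|x /hU[_ ]//]; apply/hS.
by apply: h1 => // [x xU h|f /hS[_ ]//]; apply/hU.
Qed.

Lemma dim_modE (V : vectType rat) (U W : {vspace V}) :
  (dim_mod U W + \dim W = \dim (U + W))%N.
Proof. by rewrite /dim_mod; have := dimv_cap_compl U W; have := dimv_sum_cap U W; lia. Qed.

(** [B] makes [S] the dual of the image of [U] in the quotient by [W]. *)
Record perfect_pairing (Q V : vectType rat) (S : {vspace Q}) (U W : {vspace V}) (B : Q -> V -> rat) : Prop :=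
  PerfectPairing {
    pp_l : forall x, linear (fun f => B f x : rat^o);
    pp_r : forall f, linear (fun x => B f x : rat^o);
    pp_W : forall f x, f \in S -> x \in W -> B f x = 0;
    pp_U : forall x, x \in U -> (forall f, f \in S -> B f x = 0) -> x \in W;
    pp_S : forall f, f \in S -> (forall x, x \in U -> B f x = 0) -> f = 0 }.

Lemma perfect_pairing_sum (Q V : vectType rat) (S : {vspace Q}) (U W : {vspace V}) B :
  perfect_pairing S U W B -> forall x, x \in (U + W)%VS -> (forall f, f \in S -> B f x = 0) -> x \in W.
Proof.
move=> P x /memv_addP[u uU [w wW ->]] h; apply: memvD (wW); apply: (pp_U P) => // f fS.
by have := h f fS; rewrite (pairingDr (pp_r P)) (pp_W P fS wW) addr0.
Qed.

Lemma perfect_pairing_dim (Q V : vectType rat) (S : {vspace Q}) (U W : {vspace V}) B :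
  perfect_pairing S U W B -> dim_mod U W = \dim S.
Proof.
move=> P; have h := @pairing_rank _ _ B (pp_l P) (pp_r P) S 0%VS U (U :&: W)%VS.
have := dimv_cap_compl U W; rewrite /dim_mod; move: h; rewrite dimv0 addn0 => h.
suff : (\dim S + \dim (U :&: W) = \dim U)%N by lia.
apply: h => [f|x].
  rewrite memv0; split=> [/eqP ->|[fS h]]; last by apply/eqP; apply: (pp_S P).
  split; first exact: mem0v.
  move=> x _; have := pp_l P x 0 0 0; rewrite scale0r addr0 => ->; rewrite scale0r add0r.
  by have := pp_l P x (-1) 0 0; rewrite scaler0 addr0 scaleN1r addNr.
rewrite memv_cap; split=> [/andP[xU xW]|[xU h]]; first by split=> // f fS; apply: (pp_W P).
by rewrite xU (pp_U P).
Qed.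

Section Homology.
Variables (Q0 Q1 Q2 V0 V1 V2 : vectType rat).
Variables (S0 : {vspace Q0}) (U0 W0 : {vspace V0}) (B0 : Q0 -> V0 -> rat).
Variables (S1 : {vspace Q1}) (U1 W1 : {vspace V1}) (B1 : Q1 -> V1 -> rat).
Variables (D0 : 'Hom(V1, V0)) (d0 : 'Hom(Q0, Q1)).
Hypotheses (P0 : perfect_pairing S0 U0 W0 B0) (P1 : perfect_pairing S1 U1 W1 B1).
Hypotheses (dS0 : (d0 @: S0 <= S1)%VS) (DU1 : (D0 @: U1 <= U0 + W0)%VS).
Hypothesis adj0 : forall f x, f \in S0 -> x \in U1 -> B0 f (D0 x) = B1 (d0 f) x.

Let Dcycle x : x \in U1 -> (D0 x \in W0) <-> forall f, f \in S0 -> B1 (d0 f) x = 0.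
Proof.
move=> xU; split=> [xW f fS|h]; first by rewrite -adj0 // (pp_W P0).
apply: (perfect_pairing_sum P0); last by move=> f fS; rewrite adj0 ?h.
by apply: (subvP DU1); exact: memv_img.
Qed.

Let pp0 (Q V : vectType rat) (S : {vspace Q}) (U W : {vspace V}) B (P : perfect_pairing S U W B) x : B 0 x = 0.
Proof.
by have := pp_l P x (-1) 0 0; rewrite scaler0 addr0 scaleN1r addNr.
Qed.

(** By adjunction the annihilator of [D0 @: U1] in [S0] is the kernel of [d0], so [D0] modulo [W0]
    has the rank of [d0]. *)
Lemma boundaries_dim : \dim (D0 @: U1 + W0) = (\dim W0 + \dim (d0 @: S0))%N.
Proof.
have h := @pairing_rank _ _ B0 (pp_l P0) (pp_r P0) S0 (S0 :&: lker d0)%VS (D0 @: U1)%VS (D0 @: U1 :&: W0)%VS.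
have {h} : (\dim S0 + \dim (D0 @: U1 :&: W0) = \dim (D0 @: U1) + \dim (S0 :&: lker d0))%N.
  apply: h => [f|x].
    rewrite memv_cap memv_ker; split=> [/andP[fS /eqP f0]|[fS h]].
      split=> // _ /memv_imgP[x xU ->]; by rewrite adj0 // f0 (pp0 P1).
    rewrite fS /=; apply/eqP; apply: (pp_S P1) => [|x xU].
      by apply: (subvP dS0); exact: memv_img.
    by rewrite -adj0 // h // memv_img.
  rewrite memv_cap; split=> [/andP[xU xW]|[xU h]]; first by split=> // f fS; apply: (pp_W P0).
  rewrite xU /=; apply: (perfect_pairing_sum P0) => //; exact: (subvP DU1).
have := limg_ker_dim d0 S0; have := dimv_sum_cap (D0 @: U1) W0; lia.
Qed.

Lemma homology0 : dim_mod U0 (D0 @: U1 + W0) = \dim (S0 :&: lker d0).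
Proof.
have := dim_modE U0 (D0 @: U1 + W0); have := dim_modE U0 W0; rewrite (perfect_pairing_dim P0) boundaries_dim.
have -> : (U0 + (D0 @: U1 + W0) = U0 + W0)%VS.
  apply/eqP; rewrite eqEsubv !subv_add addvSl addvSr DU1 /= addvSl.
  by rewrite (subv_trans (addvSr (D0 @: U1) W0)) ?addvSr.
have := limg_ker_dim d0 S0; lia.
Qed.

(** The cycles in [U1] are the annihilator of [d0 @: S0], hence of codimension rank [d0]. *)
Lemma cycles_dim : (\dim ((U1 :&: D0 @^-1: W0) + W1) + \dim (d0 @: S0) = \dim W1 + \dim S1)%N.
Proof.
set Z := (U1 :&: _)%VS.
have h := @pairing_rank _ _ (fun f => B1 (d0 f)) _ (fun f => pp_r P1 (d0 f)) S0 (S0 :&: lker d0)%VS U1 Z.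
have {h} : (\dim S0 + \dim Z = \dim U1 + \dim (S0 :&: lker d0))%N.
  apply: h => [x a f g|f|x].
  - by rewrite linearP (pp_l P1).
  - rewrite memv_cap memv_ker; split=> [/andP[fS /eqP f0]|[fS h]].
      by split=> // x _; rewrite f0 (pp0 P1).
    rewrite fS /=; apply/eqP; apply: (pp_S P1) => //; by apply: (subvP dS0); exact: memv_img.
  - rewrite memv_cap -memv_preim; split=> [/andP[xU /(Dcycle xU)]|[xU h]] //.
    by rewrite xU /=; apply/(Dcycle xU).
have ZW : (Z :&: W1 = U1 :&: W1)%VS.
  apply/eqP; rewrite eqEsubv; apply/andP; split; first exact: capvS (capvSl _ _) (subvv _).
  apply/subvP => x; rewrite !memv_cap -memv_preim => /andP[xU xW]; rewrite xU xW andbT /=.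
  apply/(Dcycle xU) => f fS; apply: (pp_W P1) => //; by apply: (subvP dS0); exact: memv_img.
have := limg_ker_dim d0 S0; have := dimv_sum_cap Z W1; have := dimv_sum_cap U1 W1.
have := dim_modE U1 W1; rewrite (perfect_pairing_dim P1) ZW; lia.
Qed.
End Homology.

Section Homology1.
Variables (Q0 Q1 Q2 V0 V1 V2 : vectType rat).
Variables (S0 : {vspace Q0}) (U0 W0 : {vspace V0}) (B0 : Q0 -> V0 -> rat).
Variables (S1 : {vspace Q1}) (U1 W1 : {vspace V1}) (B1 : Q1 -> V1 -> rat).
Variables (S2 : {vspace Q2}) (U2 W2 : {vspace V2}) (B2 : Q2 -> V2 -> rat).
Variables (D0 : 'Hom(V1, V0)) (d0 : 'Hom(Q0, Q1)) (D1 : 'Hom(V2, V1)) (d1 : 'Hom(Q1, Q2)).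
Hypotheses (P0 : perfect_pairing S0 U0 W0 B0) (P1 : perfect_pairing S1 U1 W1 B1)
  (P2 : perfect_pairing S2 U2 W2 B2).
Hypotheses (dS0 : (d0 @: S0 <= S1)%VS) (DU1 : (D0 @: U1 <= U0 + W0)%VS)
  (dS1 : (d1 @: S1 <= S2)%VS) (DU2 : (D1 @: U2 <= U1 + W1)%VS).
Hypothesis adj0 : forall f x, f \in S0 -> x \in U1 -> B0 f (D0 x) = B1 (d0 f) x.
Hypothesis adj1 : forall f x, f \in S1 -> x \in U2 -> B1 f (D1 x) = B2 (d1 f) x.
Hypothesis dd : forall f, f \in S0 -> d1 (d0 f) = 0.

(** Modulo [W1] the cycles have dimension dim S1 - rank [d0] by [cycles_dim], and the boundaries
    have dimension rank [d1] by [boundaries_dim]. *)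
Lemma homology1 :
  (dim_mod (U1 :&: D0 @^-1: W0) (D1 @: U2 + W1) + \dim (d0 @: S0) + \dim (d1 @: S1) = \dim S1)%N.
Proof.
set Z := (U1 :&: _)%VS.
have := dim_modE Z (D1 @: U2 + W1).
have -> : (Z + (D1 @: U2 + W1) = Z + W1)%VS.
  apply/eqP; rewrite eqEsubv !subv_add addvSl addvSr /= andbT; apply/andP; split; last first.
    by rewrite addvSl addvA addvSr.
  (* A boundary is a cycle up to [W1] because [d1] and [d0] compose to 0 on cochains: its pairing
     with every [d0 f] vanishes. *)
  apply/subvP => y yD; have /memv_imgP[x xU yE] := yD.
  have /memv_addP[u uU [w wW yuw]] := subvP DU2 _ yD.
  rewrite yuw; apply: memv_add (wW); rewrite memv_cap uU -memv_preim /=.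
  have d0f f : f \in S0 -> d0 f \in S1 by move=> fS; apply: (subvP dS0); exact: memv_img.
  apply: (perfect_pairing_sum P0); first by apply: (subvP DU1); exact: memv_img.
  move=> f fS; rewrite adj0 //.
  have : B1 (d0 f) y = 0.
    rewrite yE adj1 ?d0f // dd //.
    by have := pp_l P2 x (-1) 0 0; rewrite scaler0 addr0 scaleN1r addNr.
  by rewrite yuw (pairingDr (pp_r P1)) (pp_W P1 (d0f f fS) wW) addr0.
rewrite (boundaries_dim P1 P2 dS1 DU2 adj1).
have := cycles_dim P0 P1 dS0 DU1 adj0; rewrite -/Z; lia.
Qed.
End Homology1.

(** * Functions of three variables *)

(** Expanding [P f] in a basis of the image and exchanging the sums, the trace becomes the sum over
    i of the i-th coordinate of [P b_i = b_i], which is 1 each time. *)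
Lemma idempotent_trace (I : finType) (P : 'End({ffun I -> rat^o})) :
  (forall f, P (P f) = P f) ->
  (\dim (limg P))%:R = \sum_t P [ffun x => (x == t)%:R] t :> rat.
Proof.
move=> idP; pose b := vbasis (limg P).
have Pb f : P f = \sum_i coord b i (P f) *: b`_i by apply: coord_vbasis; exact: memv_img (memvf _).
under eq_bigr => t _ do rewrite Pb sum_ffunE.
rewrite exchange_big /=.
have E i : \sum_(t : I) (coord b i (P [ffun x => (x == t)%:R]) *: b`_i) t = 1.
  transitivity (coord b i (P (\sum_(t : I) (b`_i t : rat) *: [ffun x => (x == t)%:R]))).
    rewrite !linear_sum /=; apply: eq_bigr => t _; rewrite !linearZ /= ffunE mulrC //.
  have -> : \sum_t (b`_i t : rat) *: [ffun x => (x == t)%:R : rat^o] = b`_i.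
    apply/ffunP => x; rewrite sum_ffunE (bigD1 x) //= big1 ?addr0 => [|t /negbTE tx].
      by rewrite !ffunE eqxx; exact: mulr1.
    by rewrite !ffunE eq_sym tx; exact: mulr0.
  have bi : b`_i \in limg P by apply: vbasis_mem; rewrite mem_nth ?size_tuple.
  have -> : P b`_i = b`_i by case/memv_imgP: bi => f _ ->; rewrite idP.
  by rewrite (coord_free i i (basis_free (vbasisP _))) eqxx.
by rewrite (eq_bigr (fun=> 1)) ?sumr_const ?card_ord //.
Qed.

Definition fun3 := nat -> nat -> nat -> rat.
Definition eq3 (u h : fun3) := forall a b c, u a b c = h a b c.
Section Signs.
Implicit Types (u h : fun3).
Variables (x0 x1 : bool).

(* The sign of swapping p and q: (-1)^(p q) for (x0, x1) = (false, true), the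
   symmetric case for (false, false) and the alternating one for (true, false). *)
Definition chi (p : nat) : bool := x0 (+) (x1 && odd p).
Definition sg (p q : nat) : rat := (-1) ^+ (chi p && chi q).

Definition sym_inv u := forall a b c, u b a c = sg a b * u a b c /\ u a c b = sg b c * u a b c.

(** The average over the permutations of the variables, each with the product of [sg] over the pairs
    that it inverts. *)
Definition symz u : fun3 := fun a b c => 6%:R^-1 *
  (u a b c + sg a b * u b a c + sg b c * u a c b + sg a b * sg a c * sg b c * u c b a
   + sg a b * sg a c * u b c a + sg a c * sg b c * u c a b).

(** For (x0, x1) = (false, true) this is the operator D on cochains; for [x1 = false] all signs are
    1, which gives the operator on functions of the halves. *)
Definition ddiff u : fun3 := fun a b c =>
  u a.+1 b c + (-1) ^+ (x1 && chi a) * u a b.+1 c + (-1) ^+ (x1 && (chi a (+) chi b)) * u a b c.+1.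

Lemma sgn1 : (-1) ^+ true = -1 :> rat. Proof. by []. Qed.
Lemma sgn0 : (-1) ^+ false = 1 :> rat. Proof. by []. Qed.

Lemma sgC p q : sg p q = sg q p. Proof. by rewrite /sg andbC. Qed.
Lemma symz_inv u : sym_inv (symz u).
Proof.
move=> a b c; rewrite /symz (sgC b a) (sgC c b) /sg.
move: (u a b c) (u b a c) (u a c b) (u c b a) (u b c a) (u c a b) => u1 u2 u3 u4 u5 u6.
by case: (chi a) (chi b) (chi c) => [] [] []; split; rewrite /= ?sgn1 ?sgn0; ring.
Qed.

Lemma symz_id u : sym_inv u -> eq3 (symz u) u.
Proof.
move=> H a b c; rewrite /symz.
have E1 : u b a c = sg a b * u a b c by have [] := H a b c.
have E2 : u a c b = sg b c * u a b c by have [] := H a b c.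
have E3 : u b c a = sg a c * (sg a b * u a b c) by have [_ ->] := H b a c; rewrite E1.
have E4 : u c a b = sg a c * (sg b c * u a b c) by have [-> _] := H a c b; rewrite E2.
have E5 : u c b a = sg a b * (sg a c * (sg b c * u a b c)) by have [_ ->] := H c a b; rewrite E4.
rewrite E1 E2 E3 E4 E5.
rewrite /sg; move: (u a b c) => u1.
by case: (chi a) (chi b) (chi c) => [] [] []; rewrite /= ?sgn1 ?sgn0; field.
Qed.

(** Only the bits [chi] of the three variables enter the signs, so this is a linear identity in
    independent values for each choice of these bits. *)
Lemma symz_ddiff u : eq3 (ddiff (symz u)) (symz (ddiff u)).
Proof.
move=> a b c; rewrite /ddiff /symz /sg.
have chiS p : chi p.+1 = x1 (+) chi p by rewrite /chi /=; case: x0 x1 (odd p) => [] [] [].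
rewrite !chiS.
move: (u a.+1 b c) (u b a.+1 c) (u a.+1 c b) (u c b a.+1) (u b c a.+1) (u c a.+1 b) => p1 p2 p3 p4 p5 p6.
move: (u a b.+1 c) (u b.+1 a c) (u a c b.+1) (u c b.+1 a) (u b.+1 c a) (u c a b.+1) => q1 q2 q3 q4 q5 q6.
move: (u a b c.+1) (u b a c.+1) (u a c.+1 b) (u c.+1 b a) (u b c.+1 a) (u c.+1 a b) => r1 r2 r3 r4 r5 r6.
by case: (chi a) (chi b) (chi c) x1 => [] [] [] [] /=; rewrite ?sgn1 ?sgn0; ring.
Qed.

(* ddiff is inverted by recursion on the first variable. *)
Fixpoint antidiff (g : fun3) (a b c : nat) : rat :=
  if a is a'.+1 then g a' b c - (-1) ^+ (x1 && chi a') * antidiff g a' b.+1 c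
    - (-1) ^+ (x1 && (chi a' (+) chi b)) * antidiff g a' b c.+1
  else 0.

Lemma antidiffE g : eq3 (ddiff (antidiff g)) g.
Proof. by move=> a b c; rewrite /ddiff /= addrAC !subrK. Qed.

Lemma eq_symz u h : eq3 u h -> eq3 (symz u) (symz h).
Proof. by move=> E a b c; rewrite /symz !E. Qed.

Lemma ddiff_onto g : sym_inv g -> exists h, sym_inv h /\ eq3 (ddiff h) g.
Proof.
move=> gI; exists (symz (antidiff g)); split; first exact: symz_inv.
by move=> a b c; rewrite symz_ddiff (eq_symz (antidiffE g)) symz_id.
Qed.

Lemma ddiff_inv u : sym_inv u -> sym_inv (ddiff u).
Proof.
move=> H a b c.
have E x y z : ddiff u x y z = symz (ddiff u) x y z.
  by rewrite -symz_ddiff /ddiff !(symz_id H).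
by rewrite !E; exact: symz_inv.
Qed.
End Signs.

Definition index3 (k : nat) : finType := ('I_k.+1 * 'I_k.+1 * 'I_k.+1)%type.
Definition coch (k : nat) : vectType rat := {ffun index3 k -> rat^o}.

Section Evaluation.
Variables (k s : nat).
Implicit Types (f g : coch k) (u : fun3).

(* A cochain of Hodge degree k and defect s is a function on the triples with
   a + b + c + s = k; the other coordinates are junk. *)
Definition ev f : fun3 := fun a b c =>
  if (a + b + c + s == k)%N then f (inord a, inord b, inord c) else 0.

Definition res u : coch k := [ffun t : index3 k =>
  if (t.1.1 + t.1.2 + t.2 + s == k)%N then u t.1.1 t.1.2 t.2 else 0].

Lemma ev_res u a b c : ev (res u) a b c = if (a + b + c + s == k)%N then u a b c else 0.
Proof.
rewrite /ev; case: eqP => // h; rewrite ffunE /= !inordK ?h ?eqxx //; lia.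
Qed.

Lemma ev_out f a b c : (a + b + c + s == k)%N = false -> ev f a b c = 0.
Proof. by rewrite /ev => ->. Qed.

Lemma evP x f g a b c : ev (x *: f + g) a b c = x * ev f a b c + ev g a b c.
Proof. by rewrite /ev; case: ifP => _; rewrite ?mulr0 ?addr0 // !ffunE. Qed.

Lemma res_ev f : res (ev f) = [ffun t : index3 k =>
  if (t.1.1 + t.1.2 + t.2 + s == k)%N then f t else 0].
Proof.
apply/ffunP => -[[a b] c]; rewrite !ffunE /= /ev; case: (_ == k) => //.
by rewrite !inord_val.
Qed.

Lemma eq_res u h : eq3 u h -> res u = res h.
Proof. by move=> E; apply/ffunP => t; rewrite !ffunE E. Qed.
End Evaluation.

Section LinearMaps.
Variables (k k' s' : nat) (Phi : coch k -> fun3).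
Hypothesis PhiP : forall x f g a b c, Phi (x *: f + g) a b c = x * Phi f a b c + Phi g a b c.

Definition res_map (f : coch k) : coch k' := res k' s' (Phi f).

Lemma res_map_linear : linear res_map.
Proof.
move=> x f g; apply/ffunP => t; rewrite !ffunE; case: ifP => _; first exact: PhiP.
by rewrite [RHS]addr0; symmetry; exact: mulr0.
Qed.

Definition res_linear : {linear coch k -> coch k'} :=
  HB.pack res_map (GRing.isLinear.Build _ _ _ _ res_map res_map_linear).

Definition res_hom : 'Hom(coch k, coch k') := linfun res_linear.

Lemma res_homE f : res_hom f = res k' s' (Phi f).
Proof. by rewrite lfunE. Qed.
End LinearMaps.

Section Space.
Variables (x0 x1 : bool) (w : nat -> nat -> nat -> bool).
Hypothesis wS : forall a b c, w b a c = w a b c /\ w a c b = w a b c.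
Variables (k s : nat).

Definition sym_part (f : coch k) : fun3 := fun a b c => (w a b c)%:R * symz x0 x1 (ev s f) a b c.

Lemma sym_partP x f g a b c : sym_part (x *: f + g) a b c = x * sym_part f a b c + sym_part g a b c.
Proof. by rewrite /sym_part /symz !evP; ring. Qed.

Definition sym_proj : 'End(coch k) := res_hom k s sym_partP.
(** Given as the image of a projection, so that its dimension is a trace. *)
Definition Sp : {vspace coch k} := limg sym_proj.

Lemma sym_inv_perm (u : fun3) (p : nat -> nat -> nat -> bool) :
  (forall a b c, p b a c = p a b c /\ p a c b = p a b c) ->
  sym_inv x0 x1 u -> sym_inv x0 x1 (fun a b c => (p a b c)%:R * u a b c).
Proof.
move=> pS uI a b c; have [-> ->] := pS a b c; have [-> ->] := uI a b c.
by split; rewrite mulrCA.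
Qed.

Lemma sym_inv_out (u : fun3) (p : nat -> nat -> nat -> bool) :
  (forall a b c, p b a c = p a b c /\ p a c b = p a b c) ->
  sym_inv x0 x1 u -> sym_inv x0 x1 (fun a b c => if p a b c then u a b c else 0).
Proof.
move=> pS uI a b c; have [-> ->] := pS a b c; have [-> ->] := uI a b c.
by split; case: (p a b c); rewrite ?mulr0.
Qed.

Lemma sum_perm a b c : (b + a + c + s == k)%N = (a + b + c + s == k)%N /\ (a + c + b + s == k)%N = (a + b + c + s == k)%N.
Proof. by split; congr (_ == _); lia. Qed.

Lemma res_Sp u : sym_inv x0 x1 u ->
  (forall a b c, (a + b + c + s == k)%N -> ~~ w a b c -> u a b c = 0) -> res k s u \in Sp.
Proof.
move=> uI uw; pose f := res k s u.
suff E : sym_proj f = f by rewrite -/f -E; apply: memv_img; exact: memvf.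
rewrite res_homE; apply/ffunP => -[[a b] c]; rewrite !ffunE /=; case: ifP => // h.
have evI : sym_inv x0 x1 (ev s f).
  move=> a' b' c'; rewrite !ev_res; exact: (sym_inv_out sum_perm uI).
rewrite /sym_part (symz_id evI) ev_res h.
by case wt : (w a b c); rewrite ?mul1r // mul0r (uw _ _ _ h) ?wt.
Qed.

Lemma SpP f : f \in Sp -> [/\ sym_inv x0 x1 (ev s f), forall a b c, ~~ w a b c -> ev s f a b c = 0
  & res k s (ev s f) = f].
Proof.
case/memv_imgP => g _ ->; rewrite res_homE.
have E a b c : ev s (res k s (sym_part g)) a b c =
    if (a + b + c + s == k)%N then sym_part g a b c else 0 by exact: ev_res.
split.
- move=> a b c; rewrite !E.
  by apply: (sym_inv_out sum_perm (sym_inv_perm wS (symz_inv x0 x1 (ev s g)))).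
- by move=> a b c /negbTE wt; rewrite E /sym_part wt mul0r; case: ifP.
- by apply/ffunP => t; rewrite res_ev !ffunE; case: (_ == k).
Qed.

Lemma sym_proj_id f : sym_proj (sym_proj f) = sym_proj f.
Proof.
have : sym_proj f \in Sp by apply: memv_img; exact: memvf.
move=> /SpP[h1 h2 h3]; rewrite [LHS]res_homE -[RHS]h3; apply: eq_res => a b c.
rewrite /sym_part (symz_id h1); case wt : (w a b c); first by rewrite mul1r.
by rewrite mul0r h2 ?wt.
Qed.

Lemma Sp_eq0 f : f \in Sp -> (forall a b c, ev s f a b c = 0) -> f = 0.
Proof.
by move=> /SpP[_ _ E] h; rewrite -E; apply/ffunP => t; rewrite !ffunE h if_same.
Qed.

(** Diagonal entries of the projection: the identity gives 1, a swap counts when its two entries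
    agree, with the sign of swapping equal entries, and the two 3-cycles count, without sign, when
    all three agree. *)
Lemma dim_Sp : (\dim Sp)%:R = \sum_(t : index3 k)
  (if (t.1.1 + t.1.2 + t.2 + s == k)%N then (w t.1.1 t.1.2 t.2)%:R * (6%:R^-1 *
     (1 + (-1) ^+ chi x0 x1 t.1.1 * (t.1.1 == t.1.2)%:R + (-1) ^+ chi x0 x1 t.1.2 * (t.1.2 == t.2)%:R
      + (-1) ^+ chi x0 x1 t.1.1 * (t.1.1 == t.2)%:R + ((t.1.1 == t.1.2) && (t.1.2 == t.2))%:R *+ 2))
   else 0) :> rat.
Proof.
rewrite (idempotent_trace sym_proj_id); apply: eq_bigr => -[[a b] c] _.
rewrite res_homE ffunE /=; case: ifP => // h; rewrite /sym_part; congr (_ * (_ * _)).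
have E (x y z : 'I_k.+1) : (x + y + z + s == k)%N -> ev s [ffun t : index3 k => ((t == (a, b, c))%:R : rat^o)] x y z =
    [&& x == a, y == b & z == c]%:R.
  by rewrite /ev => ->; rewrite ffunE !inord_val !xpair_eqE andbA.
rewrite !E; try by apply/eqP; move: (eqP h) => /= ?; lia.
rewrite !eqxx /= andbT /sg.
have ss (x : bool) : (-1) ^+ (x && x) = (-1) ^+ x :> rat by rewrite andbb.
rewrite (eq_sym b a) (eq_sym c b) (eq_sym c a) -!(inj_eq val_inj) /=.
have [e1|e1] := eqVneq (val a) (val b); have [e2|e2] := eqVneq (val b) (val c).
- have e3 : nat_of_ord a = c by rewrite e1 e2.
  rewrite /= in e1 e2; rewrite -e2 -e1 eqxx !andbb /=.
  by case: (chi _ _ _); rewrite /= ?sgn1 ?sgn0; ring.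
- have e3 : (nat_of_ord a == c) = false by rewrite e1; exact: negbTE.
  rewrite /= in e1 e2; rewrite e3 -e1 ?andbb ?andbF /=; ring.
- have e3 : (nat_of_ord a == c) = false by rewrite -e2; exact: negbTE.
  rewrite /= in e1 e2; rewrite e3 -e2 ?andbb ?andbF /=; ring.
- have [e3|e3] := eqVneq (nat_of_ord a) c; last by rewrite /= ?andbF; ring.
  rewrite -e3 ?andbb /=.
  by case: (chi _ _ _) (chi _ _ _) => [] []; rewrite /= ?sgn1 ?sgn0; ring.
Qed.
End Space.

(** * Rational generating functions *)

Section Series.
Implicit Types (h f g : series) (p q r : {poly rat}).

(** Series are compared as polynomials modulo X^K for every K, which makes [ring] available. *)
Definition trunc (K : nat) h : {poly rat} := \poly_(i < K) h i.
Definition eqK (K : nat) p q := forall d, (d < K)%N -> p`_d = q`_d.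

Lemma truncE K h d : (d < K)%N -> (trunc K h)`_d = h d.
Proof. by rewrite coef_poly => ->. Qed.

Lemma coef_series K p q f g : (forall d, (d < K)%N -> p`_d = f d) -> (forall d, (d < K)%N -> q`_d = g d) ->
  forall d, (d < K)%N -> (p * q)`_d = series_mul f g d.
Proof.
move=> hp hq d dK; rewrite coefM /series_mul; apply: eq_bigr => i _.
by rewrite hp ?hq //; have := ltn_ord i; lia.
Qed.

Lemma eqK_mul K p q p' q' : eqK K p p' -> eqK K q q' -> eqK K (p * q) (p' * q').
Proof.
move=> hp hq d dK; rewrite !coefM; apply: eq_bigr => i _.
by rewrite hp ?hq //; have := ltn_ord i; lia.
Qed.

Lemma eqK_cancel K r p q : r`_0 != 0 -> eqK K (r * p) (r * q) -> eqK K p q.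
Proof.
move=> r0 h d; have [m] := ubnP d; elim: m d => // m IH d dm dK.
have := h d dK; rewrite !coefM !big_ord_recl /= !subn0.
rewrite [X in _ + X = _](eq_bigr (fun i : 'I_d => r`_(bump 0 i) * q`_(d - bump 0 i))); last first.
  move=> i _; rewrite IH //; rewrite /bump /=; have := ltn_ord i; lia.
by move=> /addIr/(mulfI r0).
Qed.

Lemma is_fractionP h p q : is_fraction h p q <-> q`_0 != 0 /\ forall K, eqK K (q * trunc K h) p.
Proof.
have E K d : (d < K)%N -> (q * trunc K h)`_d = series_mul (series_of_poly q) h d.
  by move=> dK; apply: (coef_series (K := K)) => // i; exact: truncE.
split=> -[q0 H]; split=> //.
  by move=> K d dK; rewrite E ?H.
by move=> d; rewrite -(E d.+1) // H.
Qed.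

Lemma frac_ext f g p q : f =1 g -> is_fraction f p q -> is_fraction g p q.
Proof.
move=> E [q0 H]; split=> // d; rewrite -H /series_mul; apply: eq_bigr => i _.
by rewrite E.
Qed.

(** Cross-multiplication; it reduces the closed formulas below to identities of polynomials. *)
Lemma frac_eq h p q p' q' : is_fraction h p q -> q'`_0 != 0 -> p * q' = p' * q -> is_fraction h p' q'.
Proof.
move=> /is_fractionP[q0 H] q'0 E; apply/is_fractionP; split=> // K.
apply: (eqK_cancel (r := q)) => //; rewrite mulrA (mulrC q) -mulrA [X in eqK _ _ X]mulrC -E mulrC [X in eqK _ X _]mulrC.
rewrite [X in eqK _ _ X]mulrC; apply: eqK_mul => //.
Qed.

Lemma frac_add f g p q p' q' : is_fraction f p q -> is_fraction g p' q' ->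
  is_fraction (fun d => f d + g d) (p * q' + p' * q) (q * q').
Proof.
move=> /is_fractionP[q0 H] /is_fractionP[q'0 H']; apply/is_fractionP.
split=> [|K d dK]; first by rewrite coef0M mulf_neq0.
have -> : q * q' * trunc K (fun d => f d + g d) = q * trunc K f * q' + q' * trunc K g * q.
  have -> : trunc K (fun d => f d + g d) = trunc K f + trunc K g.
    by apply/polyP => i; rewrite coefD !coef_poly; case: ifP; rewrite ?addr0.
  by ring.
by rewrite !coefD; congr (_ + _); apply: (eqK_mul (K := K)).
Qed.

Lemma frac_mul f g p q p' q' : is_fraction f p q -> is_fraction g p' q' ->
  is_fraction (series_mul f g) (p * p') (q * q').
Proof.
move=> /is_fractionP[q0 H] /is_fractionP[q'0 H']; apply/is_fractionP.
split=> [|K d dK]; first by rewrite coef0M mulf_neq0.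
have E : eqK K (trunc K (series_mul f g)) (trunc K f * trunc K g).
  by move=> i iK; rewrite truncE // (coef_series (K := K) (f := f) (g := g)) // => j; exact: truncE.
rewrite (eqK_mul (K := K) (p' := q * q') (q' := trunc K f * trunc K g)) //.
rewrite (_ : q * q' * _ = (q * trunc K f) * (q' * trunc K g)); last by ring.
exact: (eqK_mul (K := K)).
Qed.

Lemma frac_poly p : is_fraction (series_of_poly p) p 1.
Proof.
apply/is_fractionP; rewrite coefC eqxx oner_eq0; split=> // K d dK.
by rewrite mul1r truncE.
Qed.

Lemma frac_scale c h p q : is_fraction h p q -> is_fraction (fun d => c * h d) (c%:P * p) q.
Proof.
move=> /(frac_mul (frac_poly c%:P)) H; rewrite mul1r in H.
apply: frac_ext H => d; rewrite /series_mul big_ord_recl /= subn0 big1 ?addr0.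
  by rewrite /series_of_poly coefC.
by move=> i _; rewrite /series_of_poly coefC mul0r.
Qed.

Lemma frac_shift g r q : is_fraction g ('X * r) q -> is_fraction (fun d => g d.+1) r q.
Proof.
move=> [q0 H]; split=> // d.
have g0 : g 0%N = 0.
  have := H 0%N; rewrite /series_mul big_ord_recl big_ord0 addr0 /series_of_poly coefXM /= => /eqP.
  by rewrite mulf_eq0 (negbTE q0) => /eqP.
have := H d.+1; rewrite /series_mul big_ord_recr /= subnn g0 mulr0 addr0.
rewrite [X in _ = X]/series_of_poly coefXM /= /series_mul => E; rewrite -[RHS]E; apply: eq_bigr => i _.
by rewrite subSn //; have := ltn_ord i; lia.
Qed.

(** The coefficients of h(t^m), as they arise from m equal entries. *)
Definition dilate (m : nat) h : series := fun d => if (m %| d)%N then h (d %/ m)%N else 0.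

Lemma frac_dilate m h p q : (0 < m)%N -> is_fraction h p q ->
  is_fraction (dilate m h) (p \Po 'X^m) (q \Po 'X^m).
Proof.
move=> m0 /is_fractionP[q0 H]; apply/is_fractionP.
have cX r d : (r \Po 'X^m)`_d = if (m %| d)%N then r`_(d %/ m) else 0 by rewrite coef_comp_poly_Xn.
split=> [|K d dK]; first by rewrite cX dvdn0 div0n.
rewrite (eqK_mul (K := K) (p' := q \Po 'X^m) (q' := trunc K h \Po 'X^m)) //; last first.
  move=> i iK; rewrite truncE // cX /dilate; case: ifP => // _.
  by rewrite truncE // (leq_ltn_trans (leq_div _ _)).
rewrite -rmorphM /= !cX; case: ifP => // _; apply: (H K).
by rewrite (leq_ltn_trans (leq_div _ _)).
Qed.

Lemma coef_comp_opp r d : (r \Po - 'X)`_d = (-1) ^+ d * r`_d.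
Proof.
rewrite comp_polyE coef_sum.
transitivity (\sum_(i < size r) if (i == d :> nat) then (-1) ^+ d * r`_d else 0).
  apply: eq_bigr => i _.
  have -> : (- 'X) ^+ i = ((-1) ^+ i) *: 'X^i :> {poly rat}.
    by rewrite [LHS]exprNn -mul_polyC polyC_exp polyCN polyC1.
  rewrite !coefZ coefXn eq_sym.
  by case: eqP => [->|_]; rewrite ?mulr1 ?mulr0 // mulrC.
rewrite -big_mkcond /=; have [h|h] := ltnP d (size r).
  by rewrite (big_pred1 (Ordinal h)).
by rewrite big1 ?nth_default ?mulr0 // => i /eqP E; have := ltn_ord i; rewrite E ltnNge h.
Qed.

Lemma frac_alternate h p q : is_fraction h p q ->
  is_fraction (fun d => (-1) ^+ d * h d) (p \Po - 'X) (q \Po - 'X).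
Proof.
move=> /is_fractionP[q0 H]; apply/is_fractionP.
split=> [|K d dK]; first by rewrite coef_comp_opp mul1r.
rewrite (eqK_mul (K := K) (p' := q \Po - 'X) (q' := trunc K h \Po - 'X)) //; last first.
  by move=> i iK; rewrite truncE // coef_comp_opp truncE.
by rewrite -rmorphM /= !coef_comp_opp H.
Qed.

Lemma frac_one : is_fraction (fun=> 1) 1 (1 - 'X).
Proof.
split; first by rewrite coefB coefC coefX subr0 oner_eq0.
move=> d; rewrite /series_mul /series_of_poly big_ord_recl coefB coefC coefX subr0 mulr1 /=.
case: d => [|d]; first by rewrite big_ord0 addr0 coefC.
rewrite big_ord_recl big1 ?addr0 => [|i _]; last by rewrite coefB coefC coefX /= subr0 mul0r.
by rewrite coefB !coefC coefX /= sub0r mulr1 addrN.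
Qed.

Definition theta_sign (d : nat) : rat := (-1) ^+ odd (uphalf d).

(** The signs are +, -, -, + with period 4, and (1 - t - t^2 + t^3) / (1 - t^4) = (1 - t) / (1 +
    t^2). *)
Lemma frac_theta : is_fraction theta_sign (1 - 'X) (1 + 'X^2).
Proof.
have cq d : (1 + 'X^2 : {poly rat})`_d = (d == 0%N)%:R + (d == 2)%:R by rewrite coefD coefC coefXn; case: d.
split; first by rewrite cq addr0 oner_eq0.
move=> d; rewrite /series_mul /series_of_poly coefB coefC coefX.
case: d => [|[|d]]; first by rewrite big_ord_recl big_ord0 !cq /theta_sign /=; ring.
  by rewrite !big_ord_recl big_ord0 !cq /theta_sign /bump /=; ring.
rewrite big_ord_recl big_ord_recl big_ord_recl big1 => [|i _]; last by rewrite cq /bump /= addr0 mul0r.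
rewrite !cq /= /bump /= !subn0 /theta_sign /= !addn0 subn2 /=.
by case: (odd (uphalf d)); rewrite /= ?expr0 ?expr1; ring.
Qed.
End Series.

Section TripleSums.
Variables (K n : nat).
Hypothesis nK : (n < K)%N.
Implicit Types (f g h u : series).
Local Notation I3 := ('I_K * 'I_K * 'I_K)%type.

Lemma triple_sum_coef (F : I3 -> rat) :
  \sum_(t : I3) (if (t.1.1 + t.1.2 + t.2 == n)%N then F t else 0) =
  (\sum_(t : I3) F t *: 'X^(t.1.1 + t.1.2 + t.2))`_n.
Proof.
rewrite coef_sum; apply: eq_bigr => t _; rewrite coefZ coefXn eq_sym.
by case: eqP; rewrite ?mulr1 ?mulr0.
Qed.

Lemma triple_sum_mul f g h :
  \sum_(t : I3) (if (t.1.1 + t.1.2 + t.2 == n)%N then f t.1.1 * g t.1.2 * h t.2 else 0) =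
  series_mul (series_mul f g) h n.
Proof.
rewrite triple_sum_coef.
have -> : \sum_(t : I3) (f t.1.1 * g t.1.2 * h t.2) *: 'X^(t.1.1 + t.1.2 + t.2) =
    trunc K f * trunc K g * trunc K h.
  rewrite /trunc !poly_def big_distrlr [X in X * _]pair_bigA /= big_distrlr /= pair_bigA /=.
  apply: eq_bigr => -[[a b] c] _ /=.
  by rewrite !exprD -!mul_polyC !rmorphM /=; ring.
apply: (coef_series (K := K)) => // d dK; last exact: truncE.
by apply: (coef_series (K := K)) => // i; exact: truncE.
Qed.

Lemma coef_dilate m u d : (0 < m)%N -> (d < K)%N ->
  (\sum_(a < K) u a *: 'X^(m * a))`_d = dilate m u d.
Proof.
move=> m0 dK; rewrite coef_sum /dilate; case: ifP => [/dvdnP[q qE]|h].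
  have qK : (q < K)%N by apply: leq_ltn_trans dK; rewrite qE leq_pmulr.
  rewrite (bigD1 (Ordinal qK)) //= big1 ?addr0.
    by rewrite coefZ coefXn qE mulnC eqxx mulr1 mulKn.
  move=> i /eqP ne; rewrite coefZ coefXn qE mulnC eqn_pmul2l //.
  case: eqP => [E|]; last by rewrite mulr0.
  by case: ne; apply: val_inj.
rewrite big1 // => i _; rewrite coefZ coefXn; case: eqP => [E|]; last by rewrite mulr0.
by rewrite E dvdn_mulr in h.
Qed.

Lemma triple_sum_diag u h :
  \sum_(t : I3) (if (t.1.1 + t.1.2 + t.2 == n)%N then u t.1.1 * (t.1.1 == t.1.2)%:R * h t.2 else 0) =
  series_mul (dilate 2 u) h n.
Proof.
rewrite triple_sum_coef.
have -> : \sum_(t : I3) (u t.1.1 * (t.1.1 == t.1.2)%:R * h t.2) *: 'X^(t.1.1 + t.1.2 + t.2) =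
    (\sum_(a < K) u a *: 'X^(2 * a)) * trunc K h.
  rewrite /trunc poly_def big_distrlr /=.
  rewrite -(pair_bigA _ (fun (p : 'I_K * 'I_K) (c : 'I_K) =>
    (u p.1 * (p.1 == p.2)%:R * h c) *: 'X^(p.1 + p.2 + c))) /=.
  rewrite -(pair_bigA _ (fun (a b : 'I_K) => \sum_(c < K)
    (u a * (a == b)%:R * h c) *: 'X^(a + b + c))) /=.
  apply: eq_bigr => a _; rewrite (bigD1 a) //= [X in _ + X]big1 ?addr0.
    apply: eq_bigr => c _; rewrite eqxx mulr1 exprD addnn -mul2n.
    by rewrite -!mul_polyC !rmorphM /=; ring.
  move=> b /negbTE ba; rewrite big1 // => c _.
  by rewrite (eq_sym a) ba mulr0 mul0r scale0r.
apply: (coef_series (K := K)) => // d dK; last exact: truncE.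
by rewrite coef_dilate.
Qed.

Lemma triple_sum_diag3 u :
  \sum_(t : I3) (if (t.1.1 + t.1.2 + t.2 == n)%N
    then u t.1.1 * ((t.1.1 == t.1.2) && (t.1.2 == t.2))%:R else 0) = dilate 3 u n.
Proof.
rewrite triple_sum_coef -(coef_dilate _ (m := 3)) //.
suff -> : \sum_(t : I3) (u t.1.1 * ((t.1.1 == t.1.2) && (t.1.2 == t.2))%:R) *: 'X^(t.1.1 + t.1.2 + t.2) =
    \sum_(a < K) u a *: 'X^(3 * a) by [].
rewrite -(pair_bigA _ (fun (p : 'I_K * 'I_K) (c : 'I_K) =>
  (u p.1 * ((p.1 == p.2) && (p.2 == c))%:R) *: 'X^(p.1 + p.2 + c))) /=.
rewrite -(pair_bigA _ (fun (a b : 'I_K) => \sum_(c < K)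
  (u a * ((a == b) && (b == c))%:R) *: 'X^(a + b + c))) /=.
apply: eq_bigr => a _; rewrite (bigD1 a) //= [X in _ + X]big1 ?addr0.
  rewrite (bigD1 a) //= big1 ?addr0.
    by rewrite !eqxx mulr1 !mulSn mul0n addn0 addnA.
  move=> c /negbTE ca;
  by rewrite (eq_sym a) ca andbF mulr0 scale0r.
move=> b /negbTE ba; rewrite big1 // => c _.
by rewrite (eq_sym a) ba /= mulr0 scale0r.
Qed.
End TripleSums.

(* The trace of the averaging projector on the functions of sum n with weight
   o a * o b * o c: the identity, three swaps and two 3-cycles. *)
Definition molien (x0 x1 : bool) (o : series) : series := fun n => 6%:R^-1 *
  (series_mul (series_mul o o) o n
   + 3%:R * series_mul (dilate 2 (fun a => (-1) ^+ chi x0 x1 a * (o a * o a))) o n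
   + 2%:R * dilate 3 (fun a => o a * o a * o a) n).

Lemma molienE x0 x1 (o : series) K n : (n < K)%N ->
  \sum_(t : 'I_K * 'I_K * 'I_K)
    (if (t.1.1 + t.1.2 + t.2 == n)%N then o t.1.1 * o t.1.2 * o t.2 * (6%:R^-1 *
     (1 + (-1) ^+ chi x0 x1 t.1.1 * (t.1.1 == t.1.2)%:R + (-1) ^+ chi x0 x1 t.1.2 * (t.1.2 == t.2)%:R
      + (-1) ^+ chi x0 x1 t.1.1 * (t.1.1 == t.2)%:R + ((t.1.1 == t.1.2) && (t.1.2 == t.2))%:R *+ 2))
   else 0) = molien x0 x1 o n.
Proof.
move=> nK; pose u : series := fun a => (-1) ^+ chi x0 x1 a * (o a * o a).
rewrite /molien -/u -(triple_sum_mul nK) -(triple_sum_diag nK u) -(triple_sum_diag3 nK).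
(* The three swaps have the same trace, by a permutation of the variables. *)
have E1 : \sum_(t : 'I_K * 'I_K * 'I_K) (if (t.1.1 + t.1.2 + t.2 == n)%N then
    u t.1.1 * (t.1.1 == t.1.2)%:R * o t.2 else 0) =
  \sum_(t : 'I_K * 'I_K * 'I_K) (if (t.1.1 + t.1.2 + t.2 == n)%N then
    u t.1.2 * (t.1.2 == t.2)%:R * o t.1.1 else 0).
  rewrite (reindex (fun t : 'I_K * 'I_K * 'I_K => (t.1.2, t.2, t.1.1))) /=; last first.
    by exists (fun t => (t.2, t.1.1, t.1.2)) => -[[a b] c].
  by apply: eq_bigr => -[[a b] c] _ /=; rewrite (_ : b + c + a = a + b + c :> nat)%N //; lia.
have E2 : \sum_(t : 'I_K * 'I_K * 'I_K) (if (t.1.1 + t.1.2 + t.2 == n)%N then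
    u t.1.1 * (t.1.1 == t.1.2)%:R * o t.2 else 0) =
  \sum_(t : 'I_K * 'I_K * 'I_K) (if (t.1.1 + t.1.2 + t.2 == n)%N then
    u t.1.1 * (t.1.1 == t.2)%:R * o t.1.2 else 0).
  rewrite (reindex (fun t : 'I_K * 'I_K * 'I_K => (t.1.1, t.2, t.1.2))) /=; last first.
    by exists (fun t => (t.1.1, t.2, t.1.2)) => -[[a b] c].
  by apply: eq_bigr => -[[a b] c] _ /=; rewrite (_ : a + c + b = a + b + c :> nat)%N //; lia.
rewrite (_ : 3%:R * ?[x] = ?x + ?x + ?x); last by ring.
rewrite {2}E1 {2}E2 !mulr_sumr -!big_split mulr_sumr /=; apply: eq_bigr => -[[a b] c] _ /=.
case: ifP => _; last by rewrite !(mulr0, addr0).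
rewrite /u -!(inj_eq val_inj) /=; have [e1|e1] := eqVneq (nat_of_ord a) (nat_of_ord b); have [e2|e2] := eqVneq (nat_of_ord b) (nat_of_ord c).
- have e3 : nat_of_ord a = c by rewrite e1 e2.
  rewrite /= in e1 e2; rewrite -e2 -e1 ?eqxx /=; ring.
- have e3 : (nat_of_ord a == c) = false by rewrite e1; exact: negbTE.
  rewrite /= in e1 e2; rewrite e3 -e1 ?eqxx /=; ring.
- have e3 : (nat_of_ord a == c) = false by rewrite -e2; exact: negbTE.
  rewrite /= in e1 e2; rewrite e3 -e2 ?eqxx /=; ring.
- have [e3|e3] := eqVneq (nat_of_ord a) c; last by rewrite /=; ring.
  by rewrite -e3 /=; ring.
Qed.

Lemma dim_Sp_true x0 x1 k s : (\dim (Sp x0 x1 (fun _ _ _ => true) k s))%:R =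
  if (s <= k)%N then molien x0 x1 (fun=> 1) (k - s)%N else 0.
Proof.
rewrite (dim_Sp x0 x1 (w := fun _ _ _ => true)) //; case: leqP => sk.
  rewrite -(@molienE _ _ _ k.+1); last by lia.
  apply: eq_bigr => -[[a b] c] _ /=; rewrite !mul1r.
  by rewrite (_ : (_ == k) = (a + b + c == k - s)%N) //; apply/eqP/eqP; lia.
by rewrite big1 // => -[[a b] c] _ /=; case: eqP => // ?; lia.
Qed.

(** The support condition as an average of two products over the strands, the form that [molien]
    evaluates. *)
Lemma tau_theta a b c : (~~ tau a b c)%:R =
  2%:R^-1 * (1 + theta_sign a * theta_sign b * theta_sign c) :> rat.
Proof. by rewrite /tau /theta_sign; case: (odd _) (odd _) (odd _) => [] [] []; rewrite /= ?sgn1 ?sgn0; field. Qed.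

Lemma tau_perm a b c : ~~ tau b a c = ~~ tau a b c /\ ~~ tau a c b = ~~ tau a b c.
Proof. by rewrite /tau; case: (odd _) (odd _) (odd _) => [] [] []. Qed.

Lemma dim_Sp_tau x0 x1 k s : (\dim (Sp x0 x1 (fun a b c => ~~ tau a b c) k s))%:R =
  if (s <= k)%N then 2%:R^-1 * (molien x0 x1 (fun=> 1) (k - s)%N + molien x0 x1 theta_sign (k - s)%N) else 0.
Proof.
rewrite (dim_Sp x0 x1 tau_perm); case: leqP => sk.
  rewrite -!(@molienE _ _ _ k.+1); try by lia.
  rewrite -big_split mulr_sumr /=; apply: eq_bigr => -[[a b] c] _ /=; rewrite !mul1r tau_theta.
  rewrite (_ : (_ == k) = (a + b + c == k - s)%N); last by apply/eqP/eqP; lia.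
  case: ifP => _; last by rewrite !(addr0, mulr0).
  ring.
by rewrite big1 // => -[[a b] c] _ /=; case: eqP => // ?; lia.
Qed.

Lemma frac_molien x0 x1 o p q pv qv pu qu : is_fraction o p q ->
  is_fraction (fun a => (-1) ^+ chi x0 x1 a * (o a * o a)) pv qv ->
  is_fraction (fun a => o a * o a * o a) pu qu ->
  is_fraction (fun n => 6%:R * molien x0 x1 o n)
    (p ^+ 3 * ((qv \Po 'X^2) * q * (qu \Po 'X^3)) + 3%:R * (pv \Po 'X^2) * p * (q ^+ 3 * (qu \Po 'X^3))
     + 2%:R * (pu \Po 'X^3) * (q ^+ 3 * ((qv \Po 'X^2) * q)))
    (q ^+ 3 * ((qv \Po 'X^2) * q) * (qu \Po 'X^3)).
Proof.
move=> ho hv hu.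
have h1 := frac_mul (frac_mul ho ho) ho.
have h2 := frac_scale 3%:R (frac_mul (frac_dilate (m := 2) isT hv) ho).
have h3 := frac_scale 2%:R (frac_dilate (m := 3) isT hu).
have := frac_add (frac_add h1 h2) h3.
rewrite !polyC_natr => H.
have q0 : (q ^+ 3 * ((qv \Po 'X^2) * q) * (qu \Po 'X^3))`_0 != 0.
  by case: H => h _; rewrite (_ : q ^+ 3 = q * q * q) //; ring.
apply: (frac_eq (frac_ext _ H) q0) => [n|]; last by ring.
by rewrite /molien mulrA mulfV ?mul1r.
Qed.

(** * The dual complex *)

Definition sgt (a b c : nat) : rat := (-1) ^+ tau a b c.

Lemma ddiff_lin x0 x1 k s x (f g : coch k) a b c : ddiff x0 x1 (ev s (x *: f + g)) a b c =
  x * ddiff x0 x1 (ev s f) a b c + ddiff x0 x1 (ev s g) a b c.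
Proof. by rewrite /ddiff !evP; ring. Qed.

Definition dmap x0 x1 k s : 'Hom(coch k, coch k) := res_hom k s.+1 (@ddiff_lin x0 x1 k s).

Lemma dmapE x0 x1 k s f : dmap x0 x1 k s f = res k s.+1 (ddiff x0 x1 (ev s f)).
Proof. exact: res_homE. Qed.

Lemma ev_dmap x0 x1 k s f : eq3 (ev s.+1 (dmap x0 x1 k s f)) (ddiff x0 x1 (ev s f)).
Proof.
move=> a b c; rewrite dmapE ev_res; case: eqP => // ne.
by rewrite /ddiff !ev_out ?mulr0 ?addr0 //; apply/eqP => ?; apply: ne; lia.
Qed.

Lemma dmap_ker x0 x1 k s f : dmap x0 x1 k s f = 0 <-> eq3 (ddiff x0 x1 (ev s f)) (fun _ _ _ => 0).
Proof.
split=> [h a b c|h]; last by rewrite dmapE; apply/ffunP => t; rewrite !ffunE h if_same.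
by rewrite -ev_dmap h /ev; case: ifP; rewrite ?ffunE.
Qed.

Notation Spt x0 x1 := (Sp x0 x1 (fun _ _ _ => true)).

Lemma SptP x0 x1 k s f : f \in Spt x0 x1 k s -> sym_inv x0 x1 (ev s f) /\ res k s (ev s f) = f.
Proof. by case/SpP. Qed.

Lemma dmap_Spt x0 x1 k s w f : (forall a b c, w b a c = w a b c /\ w a c b = w a b c) ->
  f \in Sp x0 x1 w k s -> dmap x0 x1 k s f \in Spt x0 x1 k s.+1.
Proof.
move=> wS /(SpP wS)[fI _ _]; rewrite dmapE; apply: res_Sp => //; exact: ddiff_inv.
Qed.

(** Rank and nullity, where [ddiff_onto] gives the full rank. *)
Lemma dmap_ker_dim x0 x1 k s :
  (\dim (Spt x0 x1 k s :&: lker (dmap x0 x1 k s)) + \dim (Spt x0 x1 k s.+1) = \dim (Spt x0 x1 k s))%N.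
Proof.
rewrite -(limg_ker_dim (dmap x0 x1 k s) (Spt x0 x1 k s)); congr (_ + \dim _)%N.
apply/eqP; rewrite eqEsubv; apply/andP; split; apply/subvP => g; last first.
  by case/memv_imgP => f fS ->; apply: dmap_Spt fS.
case/SptP => gI gE; have [h [hI hE]] := ddiff_onto gI.
have -> : g = dmap x0 x1 k s (res k s h).
  rewrite -gE dmapE; apply/ffunP => -[[a b] c]; rewrite !ffunE /=; case: eqP => // E.
  rewrite -hE /ddiff !ev_res.
  have h1 : (a.+1 + b + c + s == k)%N by lia.
  have h2 : (a + b.+1 + c + s == k)%N by lia.
  have h3 : (a + b + c.+1 + s == k)%N by lia.
  by rewrite h1 h2 h3.
by apply: memv_img; apply: res_Sp.
Qed.

Lemma dim_bij (V W : vectType rat) (B : 'Hom(V, W)) (K : {vspace V}) (K' : {vspace W}) :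
  (forall h, h \in K -> B h \in K') -> (forall h, h \in K -> B h = 0 -> h = 0) ->
  (forall f, f \in K' -> exists2 h, h \in K & B h = f) -> \dim K' = \dim K.
Proof.
move=> h1 h2 h3; have -> : K' = (B @: K)%VS.
  apply/eqP; rewrite eqEsubv; apply/andP; split; apply/subvP => f.
    by case/h3 => h hK <-; apply: memv_img.
  by case/memv_imgP => h hK ->; apply: h1.
apply: limg_dim_eq; apply/eqP; rewrite -subv0; apply/subvP => h.
by rewrite memv_cap memv_ker memv0 => /andP[hK /eqP /(h2 h hK) ->].
Qed.

Section Differentials.
Variable k : nat.
Local Notation tw := (fun a b c => ~~ tau a b c).
(** For defects 0 and 2 both ends look alike, so their exchange acts on the function itself and
    forces it to vanish where [tau] holds. For defect 1 the exchange relates two labels and imposes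
    no condition on either. *)
Definition S0 := Sp false true tw k 0.
Definition S1 := Spt false true k 1.
Definition S2 := Sp false true tw k 2.
Definition delta0 : 'Hom(coch k, coch k) := dmap false true k 0.

(* A cochain of defect 1 is given by its values u for (d0, d1) = (true, false),
   and those for (false, true) are sgt * u; both ends of a graph with
   (d0, d1) = (true, true) can be split. *)
Definition dd1 (u : fun3) : fun3 := fun a b c =>
  (1 + sgt a b c) * ddiff false true (fun a b c => sgt a b c * u a b c) a b c.

Lemma dd1_lin x (f g : coch k) a b c : dd1 (ev 1 (x *: f + g)) a b c =
  x * dd1 (ev 1 f) a b c + dd1 (ev 1 g) a b c.
Proof. by rewrite /dd1 /ddiff !evP; ring. Qed.

Definition delta1 : 'Hom(coch k, coch k) := res_hom k 2 dd1_lin.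

Lemma ev_delta1 f : eq3 (ev 2 (delta1 f)) (dd1 (ev 1 f)).
Proof.
move=> a b c; rewrite res_homE ev_res; case: eqP => // ne.
by rewrite /dd1 /ddiff !ev_out ?mulr0 ?addr0 ?mulr0 //; apply/eqP => ?; apply: ne; lia.
Qed.

Lemma delta0_S0 f : f \in S0 -> delta0 f \in S1.
Proof. exact: (dmap_Spt tau_perm). Qed.

Lemma sgt_perm a b c : sgt b a c = sgt a b c /\ sgt a c b = sgt a b c.
Proof. by rewrite /sgt /tau; case: (odd _) (odd _) (odd _) => [] [] []. Qed.

Lemma sym_inv_mul (p u : fun3) : (forall a b c, p b a c = p a b c /\ p a c b = p a b c) ->
  sym_inv false true u -> sym_inv false true (fun a b c => p a b c * u a b c).
Proof.
move=> pS uI a b c; have [-> ->] := pS a b c; have [-> ->] := uI a b c.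
by split; rewrite mulrCA.
Qed.

Lemma dd1_inv u : sym_inv false true u -> sym_inv false true (dd1 u).
Proof.
move=> uI; apply: sym_inv_mul => [a b c|]; first by have [-> ->] := sgt_perm a b c.
by apply: ddiff_inv; apply: sym_inv_mul => //; exact: sgt_perm.
Qed.

Lemma delta1_S1 f : f \in S1 -> delta1 f \in S2.
Proof.
case/SptP=> fI _; rewrite res_homE; apply: res_Sp; first exact: dd1_inv.
by move=> a b c _; rewrite negbK /dd1 /sgt => ->; rewrite addrN mul0r.
Qed.

(** On the support of [g] the factor 1 + [sgt] is 2, so a preimage of [g] under D, multiplied by
    [sgt] and halved, is one under [delta1]. *)
Lemma delta1_onto : (delta1 @: S1)%VS = S2.
Proof.
apply/eqP; rewrite eqEsubv; apply/andP; split; apply/subvP => g.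
  by case/memv_imgP => f fS ->; apply: delta1_S1.
case/(SpP tau_perm) => gI g0 gE; have [h [hI hE]] := ddiff_onto gI.
pose u : fun3 := fun a b c => 2%:R^-1 * sgt a b c * h a b c.
have -> : g = delta1 (res k 1 u).
  rewrite -gE res_homE; apply/ffunP => -[[a b] c]; rewrite !ffunE /=; case: eqP => // E.
  have h1 : (a.+1 + b + c + 1 == k)%N by lia.
  have h2 : (a + b.+1 + c + 1 == k)%N by lia.
  have h3 : (a + b + c.+1 + 1 == k)%N by lia.
  rewrite /dd1 /ddiff !ev_res h1 h2 h3 /u.
  have ss x y z v : sgt x y z * (2%:R^-1 * sgt x y z * v) = 2%:R^-1 * v.
    by rewrite /sgt; case: (tau x y z); rewrite ?sgn1 ?sgn0; ring.
  rewrite !ss; have <- := hE a b c; rewrite /ddiff.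
  case ht : (tau a b c); last by rewrite /sgt ht; field.
  have := g0 a b c; rewrite ht => /(_ isT); rewrite -hE /ddiff => ->.
  by rewrite /sgt ht addrN mul0r.
apply: memv_img; apply: res_Sp => //; apply: sym_inv_mul => // a b c.
by have [-> ->] := sgt_perm a b c.
Qed.

(** [tau] depends only on residues modulo 4. Once [f] is written with the indicator of its support,
    the terms cancel for each choice of residues. *)
Lemma delta1_delta0 f : f \in S0 -> delta1 (delta0 f) = 0.
Proof.
case/(SpP tau_perm) => fI f0 _; rewrite res_homE; apply/ffunP => -[[a b] c].
rewrite !ffunE /=; case: ifP => // _; rewrite /dd1 /ddiff !ev_dmap /ddiff.
have E x y z : ev 0 f x y z = (~~ tau x y z)%:R * ev 0 f x y z.
  by case ht : (tau x y z); rewrite ?mul1r // f0 ?ht // mulr0.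
rewrite (E a.+2 b c) (E a b.+2 c) (E a b c.+2) (E a.+1 b.+1 c) (E a.+1 b c.+1) (E a b.+1 c.+1) /sgt /tau /chi /= !uphalf_half !oddD /=.
move: (ev 0 f a.+2 b c) (ev 0 f a b.+2 c) (ev 0 f a b c.+2) => p1 p2 p3.
move: (ev 0 f a.+1 b.+1 c) (ev 0 f a.+1 b c.+1) (ev 0 f a b.+1 c.+1) => q1 q2 q3.
by case: (odd a) (odd b) (odd c) (odd a./2) (odd b./2) (odd c./2) => [] [] [] [] [] [];
  rewrite /= ?sgn1 ?sgn0; ring.
Qed.

Lemma S0_kerP f : f \in (S0 :&: lker delta0)%VS -> let u := ev 0 f in
  [/\ sym_inv false true u, forall a b c, tau a b c -> u a b c = 0,
      forall a b c, u a.+1 b c + (-1) ^+ odd a * u a b.+1 c + (-1) ^+ (odd a (+) odd b) * u a b c.+1 = 0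
    & forall a b c, u a.+1 b c + (-1) ^+ odd b * u a b.+1 c + (-1) ^+ (odd b (+) odd c) * u a b c.+1 = 0].
Proof.
rewrite memv_cap memv_ker => /andP[/(SpP tau_perm)[fI f0 _] /eqP/dmap_ker fd] u.
have u0 a b c : tau a b c -> u a b c = 0 by move=> ht; apply: f0; rewrite ht.
split=> // a b c; have := fd a b c; rewrite /ddiff /chi /= -/u //.
have E x y z : u x y z = (~~ tau x y z)%:R * u x y z.
  by case ht : (tau x y z); rewrite ?mul1r // u0 // mulr0.
rewrite (E a.+1 b c) (E a b.+1 c) (E a b c.+1) /tau /= !uphalf_half !oddD /=.
move: (u a.+1 b c) (u a b.+1 c) (u a b c.+1) => p1 p2 p3.
by case: (odd a) (odd b) (odd c) (odd a./2) (odd b./2) (odd c./2) => [] [] [] [] [] [];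
  rewrite /= ?sgn1 ?sgn0; lra.
Qed.
End Differentials.

(** * The kernel of [delta0] in terms of functions of the halves *)

Lemma parityE a : a = (odd a + a./2.*2)%N. Proof. by rewrite odd_double_half. Qed.

Definition Kspace x0 d : {vspace coch d} := (Spt x0 false d 0 :&: lker (dmap x0 false d 0))%VS.

Lemma KspaceP x0 d h : h \in Kspace x0 d -> [/\ sym_inv x0 false (ev 0 h),
  forall x y z, ev 0 h x.+1 y z + ev 0 h x y.+1 z + ev 0 h x y z.+1 = 0 & res d 0 (ev 0 h) = h].
Proof.
rewrite memv_cap memv_ker => /andP[/SptP[hI hE] /eqP/dmap_ker hd]; split=> // x y z.
by have := hd x y z; rewrite /ddiff /= !mul1r.
Qed.

Lemma res_Kspace x0 d (u : fun3) : sym_inv x0 false u ->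
  (forall x y z, u x.+1 y z + u x y.+1 z + u x y z.+1 = 0) -> res d 0 u \in Kspace x0 d.
Proof.
move=> uI ud; rewrite memv_cap memv_ker res_Sp //=; apply/eqP/dmap_ker => a b c.
rewrite /ddiff /= !mul1r !ev_res.
rewrite (_ : (a + b.+1 + c + 0 == d) = (a.+1 + b + c + 0 == d))%N; last by congr (_ == _); lia.
rewrite (_ : (a + b + c.+1 + 0 == d) = (a.+1 + b + c + 0 == d))%N; last by congr (_ == _); lia.
by case: (_ == d); rewrite ?ud ?addr0.
Qed.

Lemma res_S0_ker k (u : fun3) : sym_inv false true u ->
  (forall a b c, (a + b + c = k)%N -> tau a b c -> u a b c = 0) ->
  (forall a b c, (a + b + c + 1 = k)%N ->
    u a.+1 b c + (-1) ^+ odd a * u a b.+1 c + (-1) ^+ (odd a (+) odd b) * u a b c.+1 = 0) ->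
  res k 0 u \in (S0 k :&: lker (delta0 k))%VS.
Proof.
move=> uI ut ud; rewrite memv_cap memv_ker; apply/andP; split.
  by apply: res_Sp => // a b c; rewrite addn0 negbK => /eqP; exact: ut.
apply/eqP/dmap_ker => a b c; rewrite /ddiff /chi /= !ev_res.
rewrite (_ : (a + b.+1 + c + 0 == k) = (a.+1 + b + c + 0 == k))%N; last by congr (_ == _); lia.
rewrite (_ : (a + b + c.+1 + 0 == k) = (a.+1 + b + c + 0 == k))%N; last by congr (_ == _); lia.
by case: eqP => [E|_]; rewrite ?mulr0 ?addr0 // ud //; lia.
Qed.

Section OddDegree.
Variable d' : nat.
Let d := d'.+1.
Let k := d'.*2.+1.

Definition one_odd a b c := [|| [&& odd a, ~~ odd b & ~~ odd c], [&& ~~ odd a, odd b & ~~ odd c]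
  | [&& ~~ odd a, ~~ odd b & odd c]].

Lemma one_odd_uphalf a b c : one_odd a b c -> (uphalf a + uphalf b + uphalf c).*2 = (a + b + c).+1.
Proof.
rewrite !uphalf_half; have := odd_double_half a; have := odd_double_half b; have := odd_double_half c.
by rewrite /one_odd; case: (odd a) (odd b) (odd c) => [] [] [] //=; lia.
Qed.

(** In odd degree the other triples have three odd entries. There the two relations at the triple
    with first entry lowered by 1 add up to twice the value. *)
Lemma ker_odd0 f : f \in (S0 k :&: lker (delta0 k))%VS -> forall a b c, ~~ one_odd a b c -> ev 0 f a b c = 0.
Proof.
move=> /S0_kerP[_ _ r1 r2] a b c; case: (boolP (a + b + c + 0 == k)%N) => [/eqP E|/negbTE/ev_out -> //].
case: a E => [|a] E; first by move: E; rewrite /one_odd /k /=; case ob : (odd b); case oc : (odd c) => //=; lia.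
have : (odd a.+1 (+) odd b (+) odd c) by rewrite -!oddD -[(_ + c)%N]addn0 E /k /= odd_double.
have := r1 a b c; have := r2 a b c; rewrite /one_odd /=.
by case: (odd a) (odd b) (odd c) => [] [] [] //=; rewrite ?sgn1 ?sgn0; lra.
Qed.

(* In odd degree the kernel of delta0 lives on the triples with one odd entry,
   where it depends on the rounded up halves only. *)
Definition lift_odd (h : fun3) : fun3 := fun a b c =>
  if one_odd a b c then h (uphalf a) (uphalf b) (uphalf c) else 0.

Lemma lift_odd_lin x (f g : coch d) a b c : lift_odd (ev 0 (x *: f + g)) a b c =
  x * lift_odd (ev 0 f) a b c + lift_odd (ev 0 g) a b c.
Proof. by rewrite /lift_odd; case: ifP; rewrite ?evP ?mulr0 ?addr0. Qed.

(** On the triples of [ker_odd0] the rounded up halves have sum [d], so [tau] is the parity of [d]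
    and an odd [d] leaves nothing. For even [d], [lift_odd] identifies the kernel with symmetric
    functions of the halves. *)
Lemma ker_odd_dim : \dim (S0 k :&: lker (delta0 k)) = if odd d then 0%N else \dim (Kspace false d).
Proof.
case: ifP => dodd.
  apply/eqP; rewrite dimv_eq0 -subv0; apply/subvP => f fK; rewrite memv0; apply/eqP.
  have [_ ut _ _] := S0_kerP fK.
  apply: (Sp_eq0 tau_perm (k := k) (s := 0)); first by move: fK; rewrite memv_cap => /andP[h _]; exact: h.
  move=> a b c; have [oo|] := boolP (one_odd a b c); last exact: ker_odd0.
  have [/eqP E|/negbTE/ev_out -> //] := boolP (a + b + c + 0 == k)%N.
  apply: ut; rewrite /tau -!oddD (_ : (_ + _)%N = d) //.
  by have := one_odd_uphalf oo; move: E; rewrite /k /d; lia.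
pose B := res_hom k 0 lift_odd_lin.
apply: (dim_bij (B := B)) => [h|h|f].
- case/KspaceP => hI hd _; rewrite res_homE; apply: res_S0_ker => [a b c|a b c E ht|a b c E].
  + have [h1 h2] := hI (uphalf a) (uphalf b) (uphalf c); rewrite /lift_odd h1 h2 /one_odd /sg /chi /=.
    by case: (odd a) (odd b) (odd c) => [] [] [] /=; rewrite ?expr0 ?mul1r ?mulr0.
  + rewrite /lift_odd; case: ifP => // oo; have : odd d; last by rewrite dodd.
    suff <- : (uphalf a + uphalf b + uphalf c)%N = d by rewrite !oddD.
    by have := one_odd_uphalf oo; move: E; rewrite /k /d; lia.
  + have : ~~ (odd a (+) odd b (+) odd c).
      by rewrite -!oddD; have : odd (a + b + c).+1 by rewrite -addn1 E /k /= odd_double.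
    have := hd a./2 b./2 c./2; rewrite /lift_odd /one_odd /= !uphalf_half.
    by case: (odd a) (odd b) (odd c) => [] [] [] //=; rewrite ?add0n ?add1n ?sgn1 ?sgn0; lra.
- case/KspaceP => hI hd hE Bh; rewrite -hE; apply/ffunP => -[[x y] z]; rewrite !ffunE /=.
  case: eqP => // E.
  have Z a b c : (a + b + c + 0 == k)%N -> one_odd a b c -> ev 0 h (uphalf a) (uphalf b) (uphalf c) = 0.
    move=> E' oo; have := congr1 (fun f => ev 0 f a b c) Bh.
    by rewrite res_homE ev_res E' /lift_odd oo => ->; rewrite /ev; case: ifP; rewrite ?ffunE.
  (* (p+1, q, r) are the rounded up halves of (2p+1, 2q, 2r). Symmetry brings a nonzero entry to the
     front, and there is one because d > 0. *)
  have Zx p q r : (p.+1 + q + r + 0)%N = d -> ev 0 h p.+1 q r = 0.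
    move=> E'; have := Z p.*2.+1 q.*2 r.*2.
    rewrite /one_odd /= !odd_double /= doubleK !uphalf_double; apply=> //.
    by apply/eqP; rewrite /k; move: E'; rewrite /d; lia.
  have swap p q r : ev 0 h p q r = 0 -> ev 0 h q p r = 0 /\ ev 0 h p r q = 0.
    by move=> h0; have [-> ->] := hI p q r; rewrite h0 mulr0.
  case: (nat_of_ord x) E => [|p] E; last exact: Zx.
  case: (nat_of_ord y) E => [|p] E; first case: (nat_of_ord z) E => [|p] E //.
    by apply: (swap _ _ _ _).2; apply: (swap _ _ _ _).1; apply: Zx; lia.
  by apply: (swap _ _ _ _).1; apply: Zx; lia.
- move=> fK; have [uI _ r1 r2] := S0_kerP fK; set u := ev 0 f in uI r1 r2.
  have f0 := ker_odd0 fK; rewrite -/u in f0.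
  (* The halves (x, y, z) come from up to three triples, one for each nonzero entry p + 1, taken as
     the rounded up half of 2p + 1. [h] uses the first; [mv], [mv23] and [mv13] show that all
     agree. *)
  pose h : fun3 := fun x y z => match x, y, z with
    | p.+1, _, _ => u p.*2.+1 y.*2 z.*2
    | _, p.+1, _ => u 0%N p.*2.+1 z.*2
    | _, _, p.+1 => u 0%N 0%N p.*2.+1
    | _, _, _ => 0 end.
  have sw a b c : ~~ odd a || ~~ odd b -> u b a c = u a b c.
    have [-> _] := uI a b c; rewrite /sg /chi /=.
    by case: (odd a) (odd b) => [] [] //= _; rewrite mul1r.
  have sw2 a b c : ~~ odd b || ~~ odd c -> u a c b = u a b c.
    have [_ ->] := uI a b c; rewrite /sg /chi /=.
    by case: (odd b) (odd c) => [] [] //= _; rewrite mul1r.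
  (* The sum of the two relations at (2p+1, 2q+1, 2z) moves the odd entry without changing the
     rounded up halves. *)
  have mv p q z : u p.*2.+1 q.*2.+2 z.*2 = u p.*2.+2 q.*2.+1 z.*2.
    have := r1 p.*2.+1 q.*2.+1 z.*2; have := r2 p.*2.+1 q.*2.+1 z.*2.
    by rewrite /= !odd_double /= ?sgn1 ?sgn0; lra.
  have mv23 x p q : u x.*2 p.*2.+1 q.*2.+2 = u x.*2 p.*2.+2 q.*2.+1.
    have := r1 x.*2 p.*2.+1 q.*2.+1; have := r2 x.*2 p.*2.+1 q.*2.+1.
    by rewrite /= !odd_double /= ?sgn1 ?sgn0; lra.
  have mv13 p y q : u p.*2.+1 y.*2 q.*2.+2 = u p.*2.+2 y.*2 q.*2.+1.
    have := r1 p.*2.+1 y.*2 q.*2.+1; have := r2 p.*2.+1 y.*2 q.*2.+1.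
    by rewrite /= !odd_double /= ?sgn1 ?sgn0; lra.
  have hX p y z : h p.+1 y z = u p.*2.+1 y.*2 z.*2 by [].
  have hY x p z : h x p.+1 z = u x.*2 p.*2.+1 z.*2.
    by case: x => [|x] //=; rewrite doubleS mv.
  have hZ x y p : h x y p.+1 = u x.*2 y.*2 p.*2.+1.
    case: y => [|y]; last by rewrite hY !doubleS mv23.
    by case: x => [|x] //=; rewrite doubleS (mv13 x 0%N).
  exists (res d 0 h).
    apply: res_Kspace => [a b c|x y z].
      rewrite /sg /chi /= !mul1r; split.
        case: a => [|a]; last by rewrite hX hY sw /= ?odd_double ?orbT.
        case: b => [|b] //; by rewrite hX hY sw /= ?odd_double ?orbT.
      case: b => [|b]; last by rewrite hZ hY sw2 /= ?odd_double ?orbT.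
      by case: c => [|c] //; rewrite hZ hY sw2 /= ?odd_double ?orbT.
    rewrite hX hY hZ; have := r1 x.*2 y.*2 z.*2.
    by rewrite !odd_double /= ?sgn1 ?sgn0 !mul1r.
  have [_ _ fE] := SpP tau_perm (subvP (capvSl _ _) _ fK).
  rewrite res_homE -[RHS]fE; apply/ffunP => -[[a b] c]; rewrite !ffunE /=.
  case: eqP => // E; rewrite /lift_odd -/u; case: ifPn => [oo|/f0 -> //].
  rewrite ev_res ifT; last first.
    by apply/eqP; have := one_odd_uphalf oo; move: E; rewrite /k /d /=; lia.
  move: oo; rewrite /one_odd /= -/u; case oa : (odd a); case ob : (odd b); case oc : (odd c) => //= _;
    by rewrite !uphalf_half oa ob oc ?add1n ?add0n ?hX ?hY ?hZ; congr (u _ _ _);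
      rewrite [RHS]parityE ?oa ?ob ?oc.
Qed.
End OddDegree.

Section EvenDegree.
Variable d : nat.
Let k := d.*2.+2.

Definition two_odd a b c := [|| [&& ~~ odd a, odd b & odd c], [&& odd a, ~~ odd b & odd c]
  | [&& odd a, odd b & ~~ odd c]].

Lemma two_odd_half a b c : two_odd a b c -> (a./2 + b./2 + c./2).*2.+2 = (a + b + c)%N.
Proof.
have := odd_double_half a; have := odd_double_half b; have := odd_double_half c.
by rewrite /two_odd; case: (odd a) (odd b) (odd c) => [] [] [] //=; lia.
Qed.

(** In even degree the other triples have three even entries. With a positive entry in front, the
    two relations for that entry lowered by 1 add up to twice the value; symmetry brings such an
    entry to the front. *)
Lemma ker_even0 f : f \in (S0 k :&: lker (delta0 k))%VS -> forall a b c, ~~ two_odd a b c -> ev 0 f a b c = 0.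
Proof.
move=> /S0_kerP[uI _ r1 r2].
have E1 a b c : ~~ odd a.+1 -> ~~ odd b -> ~~ odd c -> ev 0 f a.+1 b c = 0.
  have := r1 a b c; have := r2 a b c.
  by rewrite /=; case: (odd a) (odd b) (odd c) => [] [] [] //=; rewrite ?sgn1 ?sgn0; lra.
move=> a b c; case: (boolP (a + b + c + 0 == k)%N) => [/eqP E|/negbTE/ev_out -> //] te.
have : ~~ (odd a (+) odd b (+) odd c) by rewrite -!oddD -[(_ + c)%N]addn0 E /k /= odd_double.
case oa : (odd a) te; case ob : (odd b); case oc : (odd c); rewrite /two_odd oa ob oc //= => _ _.
have nb x : odd x = false -> ~~ odd x by move=> ->.
case: a E oa => [|a] E oa; last by apply: E1; exact: nb.
case: b E ob => [|b] E ob.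
  case: c E oc => [|c] E oc //.
  have [_ ->] := uI 0%N c.+1 0%N; have [-> _] := uI c.+1 0%N 0%N; rewrite E1 ?mulr0 //; exact: nb.
by have [-> _] := uI b.+1 0%N c; rewrite E1 ?mulr0 //; exact: nb.
Qed.

(* In even degree the kernel lives on the triples with two odd entries. *)
Definition lift_even (h : fun3) : fun3 := fun a b c =>
  if two_odd a b c then (-1) ^+ (~~ odd b) * h a./2 b./2 c./2 else 0.

Lemma lift_even_lin x (f g : coch d) a b c : lift_even (ev 0 (x *: f + g)) a b c =
  x * lift_even (ev 0 f) a b c + lift_even (ev 0 g) a b c.
Proof. by rewrite /lift_even; case: ifP => _; rewrite ?evP; ring. Qed.

(** On these triples [tau] is the parity of [d]. A function in the kernel is determined by its
    values h at (2x, 2y+1, 2z+1): the relations give the opposite value if the even entry is in the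
    middle and the same value if it is last. As swapping two odd entries has sign -1, h is
    alternating. *)
Lemma ker_even_dim : \dim (S0 k :&: lker (delta0 k)) = if odd d then 0%N else \dim (Kspace true d).
Proof.
have tauE a b c : two_odd a b c -> (a + b + c)%N = k -> tau a b c = odd d.
  move=> te E; have := two_odd_half te; rewrite E /k => - [] /double_inj <-.
  rewrite /tau !uphalf_half !oddD; move: te; rewrite /two_odd.
  by case: (odd a) (odd b) (odd c) (odd a./2) (odd b./2) (odd c./2) => [] [] [] [] [] [].
case: ifP => dodd.
  apply/eqP; rewrite dimv_eq0 -subv0; apply/subvP => f fK; rewrite memv0; apply/eqP.
  have [_ ut _ _] := S0_kerP fK.
  apply: (Sp_eq0 tau_perm (k := k) (s := 0)); first by move: fK; rewrite memv_cap => /andP[h _]; exact: h.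
  move=> a b c; have [oo|] := boolP (two_odd a b c); last exact: ker_even0.
  have [/eqP E|/negbTE/ev_out -> //] := boolP (a + b + c + 0 == k)%N.
  by apply: ut; rewrite tauE //; move: E; rewrite addn0.
pose B := res_hom k 0 lift_even_lin.
apply: (dim_bij (B := B)) => [h|h|f].
- case/KspaceP => hI hd _; rewrite res_homE; apply: res_S0_ker => [a b c|a b c E ht|a b c E].
  + have [h1 h2] := hI a./2 b./2 c./2; rewrite /lift_even h1 h2 /two_odd /sg /chi /=.
    by case: (odd a) (odd b) (odd c) => [] [] [] ; split; rewrite /= ?sgn1 ?sgn0; ring.
  + by rewrite /lift_even; case: ifP => // te; rewrite tauE ?dodd in ht.
  + have : odd a (+) odd b (+) odd c.
      have : odd (a + b + c).+1 = false by rewrite -addn1 E /k /= negbK odd_double.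
      by rewrite /= -!oddD => /negbFE.
    have := hd a./2 b./2 c./2; rewrite /lift_even /two_odd /= !uphalf_half.
    by case: (odd a) (odd b) (odd c) => [] [] [] //=; rewrite ?add0n ?add1n ?sgn1 ?sgn0; lra.
- case/KspaceP => hI hd hE Bh; rewrite -hE; apply/ffunP => -[[x y] z]; rewrite !ffunE /=.
  case: eqP => // E.
  have := congr1 (fun f => ev 0 f x.*2 y.*2.+1 z.*2.+1) Bh.
  rewrite res_homE ev_res ifT; last by apply/eqP; move: E; rewrite /k; lia.
  rewrite /lift_even /two_odd /= !odd_double /= !doubleK !uphalf_double mul1r => ->.
  by rewrite /ev; case: ifP; rewrite ?ffunE.
- move=> fK; have [uI _ r1 r2] := S0_kerP fK; set u := ev 0 f in uI r1 r2.
  have f0 := ker_even0 fK; rewrite -/u in f0.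
  pose h : fun3 := fun x y z => u x.*2 y.*2.+1 z.*2.+1.
  have hY x y z : u x.*2.+1 y.*2 z.*2.+1 = - h x y z.
    have := r1 x.*2 y.*2 z.*2.+1; have := r2 x.*2 y.*2 z.*2.+1.
    by rewrite /h /= !odd_double /= ?sgn1 ?sgn0; lra.
  have hZ x y z : u x.*2.+1 y.*2.+1 z.*2 = h x y z.
    have := r1 x.*2 y.*2.+1 z.*2; have := r2 x.*2 y.*2.+1 z.*2.
    by rewrite /h /= !odd_double /= ?sgn1 ?sgn0; lra.
  exists (res d 0 h).
    apply: res_Kspace => [a b c|x y z].
      have [_] := uI a.*2 b.*2.+1 c.*2.+1; have [] := uI b.*2 a.*2.+1 c.*2.+1.
      rewrite hY /h /sg /chi /= !odd_double /= ?sgn1 ?sgn0 => h1 _ h2; split; last exact: h2.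
      by rewrite mulN1r -[u a.*2 _ _]opprK h1 mul1r opprK.
    have e1 : h x.+1 y z = u x.*2.+2 y.*2.+1 z.*2.+1 by [].
    have e2 : h x y.+1 z = - u x.*2.+1 y.*2.+2 z.*2.+1 by rewrite -doubleS hY opprK.
    have e3 : h x y z.+1 = u x.*2.+1 y.*2.+1 z.*2.+2 by rewrite -doubleS hZ.
    have := r1 x.*2.+1 y.*2.+1 z.*2.+1; rewrite e1 e2 e3.
    by rewrite /= !odd_double /= ?sgn1 ?sgn0; lra.
  have [_ _ fE] := SpP tau_perm (subvP (capvSl _ _) _ fK).
  rewrite res_homE -[RHS]fE; apply/ffunP => -[[a b] c]; rewrite !ffunE /=.
  case: eqP => // E; rewrite /lift_even -/u; case: ifPn => [te|/f0 -> //].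
  rewrite ev_res ifT; last first.
    by apply/eqP; have := two_odd_half te; move: E; rewrite /k /=; lia.
  move: te; rewrite /two_odd /= -/u.
  case oa : (odd a); case ob : (odd b); case oc : (odd c) => //= _;
    rewrite ?sgn1 ?sgn0 ?mul1r ?mulN1r; [rewrite -hZ|rewrite -hY|rewrite /h];
    by congr (u _ _ _); rewrite [RHS]parityE ?oa ?ob ?oc.
Qed.
End EvenDegree.

(** * Closed forms of the generating functions *)

Section MoreSeries.
Implicit Types (h : series) (p q : {poly rat}).
Lemma frac_up s h p q : is_fraction h p q ->
  is_fraction (fun d => if (s <= d)%N then h (d - s)%N else 0) ('X^s * p) q.
Proof.
move=> /(frac_mul (frac_poly 'X^s)); rewrite mul1r; apply: frac_ext => d.
rewrite /series_mul /series_of_poly; case: leqP => sd.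
  rewrite (bigD1 (Ordinal (sd : (s < d.+1)%N))) //= big1 ?addr0 => [|i ne]; first by rewrite coefXn eqxx mul1r.
  rewrite coefXn; case: eqP => [E|]; last by rewrite mul0r.
  by case/eqP: ne; apply: val_inj.
rewrite big1 // => i _; rewrite coefXn; case: eqP => [E|]; last by rewrite mul0r.
by have := ltn_ord i; rewrite E ltnS leqNgt sd.
Qed.

Lemma frac_div n h p q : (0 < n)%N -> is_fraction (fun d => n%:R * h d) (n%:R * p) q -> is_fraction h p q.
Proof.
move=> n0 /(frac_scale n%:R^-1); rewrite mulrA -(polyC_natr _ n) -polyCM mulVf ?pnatr_eq0 -?lt0n // mul1r.
by apply: frac_ext => d; rewrite mulKf ?pnatr_eq0 -?lt0n.
Qed.

Lemma frac_opp h p q : is_fraction h p q -> is_fraction (fun d => - h d) (- p) q.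
Proof.
move=> /(frac_scale (-1)); rewrite polyCN mulN1r; apply: frac_ext => d; exact: mulN1r.
Qed.

Lemma frac_even h p q : is_fraction h p q ->
  is_fraction (fun d => 2%:R * (if odd d then 0 else h d)) (p * (q \Po - 'X) + (p \Po - 'X) * q) (q * (q \Po - 'X)).
Proof.
move=> H; apply: frac_ext (frac_add H (frac_alternate H)) => d.
by rewrite -signr_odd; case: (odd d); rewrite ?sgn1 ?sgn0; ring.
Qed.
End MoreSeries.

Ltac coef0 := rewrite -horner_coef0 !hornerE ?expr0n /= ?(subr0, mulr1, addr0, expr1n) ?oner_eq0.

Lemma comp_1subX n : (1 - 'X) \Po 'X^n = 1 - 'X^n :> {poly rat}.
Proof. by rewrite rmorphB rmorph1 /= comp_polyX. Qed.

Lemma comp_1addX n : (1 + 'X) \Po 'X^n = 1 + 'X^n :> {poly rat}.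
Proof. by rewrite rmorphD rmorph1 /= comp_polyX. Qed.

Lemma comp_1addX2 n : (1 + 'X^2) \Po 'X^n = 1 + 'X^n ^+ 2 :> {poly rat}.
Proof. by rewrite rmorphD rmorph1 rmorphXn /= comp_polyX. Qed.

Lemma comp_1 (q : {poly rat}) : 1 \Po q = 1.
Proof. by rewrite rmorph1. Qed.

(** The Hilbert series of the symmetric polynomials in three variables, which are generated in
    degrees 1, 2 and 3. *)
Lemma frac_mol_sym : is_fraction (molien false false (fun=> 1)) 1 ((1 - 'X) * (1 - 'X^2) * (1 - 'X^3)).
Proof.
apply: (frac_div (n := 6)) => //.
have h1 : is_fraction (fun a => (-1) ^+ chi false false a * (1 * 1)) 1 (1 - 'X).
  by apply: frac_ext frac_one => d; rewrite !mulr1.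
have h2 : is_fraction (fun a : nat => 1 * 1 * 1 : rat) 1 (1 - 'X) by exact: frac_one.
apply: (frac_eq (frac_molien frac_one h1 h2)); first by coef0.
by rewrite !comp_1 !comp_1subX; ring.
Qed.

(** Alternating polynomials are the symmetric ones times the Vandermonde product, of degree 3. *)
Lemma frac_mol_alt : is_fraction (molien true false (fun=> 1)) 'X^3 ((1 - 'X) * (1 - 'X^2) * (1 - 'X^3)).
Proof.
apply: (frac_div (n := 6)) => //.
have h1 : is_fraction (fun a => (-1) ^+ chi true false a * (1 * 1)) (-1) (1 - 'X).
  by apply: frac_ext (frac_opp frac_one) => d; rewrite /= sgn1 !mulr1.
have h2 : is_fraction (fun a : nat => 1 * 1 * 1 : rat) 1 (1 - 'X) by exact: frac_one.
apply: (frac_eq (frac_molien frac_one h1 h2)); first by coef0.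
by rewrite !(rmorphN, comp_1) /= !comp_1subX; ring.
Qed.

Lemma frac_sign : is_fraction (fun a => (-1) ^+ chi false true a) 1 (1 + 'X).
Proof.
have := frac_alternate frac_one; rewrite comp_1 rmorphB rmorph1 /= comp_polyX opprK.
by apply: frac_ext => d; rewrite mulr1 -signr_odd.
Qed.

Definition mol_one := molien false true (fun=> 1).
Definition mol_theta := molien false true theta_sign.

Lemma frac_mol_one : is_fraction (fun d => 6%:R * mol_one d)
  ((1 + 'X^2) * (1 - 'X^3) + 3%:R * ((1 - 'X) ^+ 2 * (1 - 'X^3)) + 2%:R * ((1 + 'X^2) * (1 - 'X) ^+ 3))
  ((1 - 'X) ^+ 3 * (1 + 'X^2) * (1 - 'X^3)).
Proof.
have h1 : is_fraction (fun a => (-1) ^+ chi false true a * (1 * 1)) 1 (1 + 'X).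
  by apply: frac_ext frac_sign => d; rewrite !mulr1.
have h2 : is_fraction (fun a : nat => 1 * 1 * 1 : rat) 1 (1 - 'X) by exact: frac_one.
apply: (frac_eq (frac_molien frac_one h1 h2)); first by coef0.
by rewrite !comp_1 !comp_1subX !comp_1addX; ring.
Qed.

Lemma theta_sign2 d : theta_sign d * theta_sign d = 1.
Proof. by rewrite -expr2 sqrr_sign. Qed.

Lemma frac_mol_theta : is_fraction (fun d => 6%:R * mol_theta d)
  ((1 - 'X) ^+ 3 * (1 + 'X^6) + 3%:R * ((1 - 'X) * (1 + 'X^2) * (1 + 'X^6)) + 2%:R * ((1 - 'X^3) * (1 + 'X^2) ^+ 3))
  ((1 + 'X^2) ^+ 3 * (1 + 'X^6)).
Proof.
have h1 : is_fraction (fun a => (-1) ^+ chi false true a * (theta_sign a * theta_sign a)) 1 (1 + 'X).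
  by apply: frac_ext frac_sign => d; rewrite theta_sign2 !mulr1.
have h2 : is_fraction (fun a => theta_sign a * theta_sign a * theta_sign a) (1 - 'X) (1 + 'X^2).
  by apply: frac_ext frac_theta => d; rewrite theta_sign2 !mul1r.
apply: (frac_eq (frac_molien frac_theta h1 h2)); first by coef0.
by rewrite !comp_1 !comp_1subX !comp_1addX !comp_1addX2; ring.
Qed.

Lemma Kspace_dim x0 d : (\dim (Kspace x0 d))%:R =
  molien x0 false (fun=> 1) d - (if (1 <= d)%N then molien x0 false (fun=> 1) (d - 1)%N else 0).
Proof.
have := dmap_ker_dim x0 false d 0 => /(congr1 (fun n => n%:R : rat)).
by rewrite natrD !dim_Sp_true subn0 /= => <-; rewrite addrK.
Qed.

(** The operator lowers the degree by 1 and is onto, so its kernel has the series multiplied by 1 -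
    t, which cancels the first factor. *)
Lemma frac_Kspace x0 p : is_fraction (molien x0 false (fun=> 1)) p ((1 - 'X) * (1 - 'X^2) * (1 - 'X^3)) ->
  is_fraction (fun d => (\dim (Kspace x0 d))%:R) p ((1 - 'X^2) * (1 - 'X^3)).
Proof.
move=> H; have K := frac_ext (fun d => esym (Kspace_dim x0 d)) (frac_add H (frac_opp (frac_up 1 H))).
by apply: (frac_eq K); [coef0 | ring].
Qed.

Definition even_part (h : series) : series := fun d => if odd d then 0 else h d.
Definition Keven x0 : series := dilate 2 (even_part (fun d => (\dim (Kspace x0 d))%:R)).

(** 1 / ((1 - t^2)(1 - t^3)) = (1 + t^3) / ((1 - t^2)(1 - t^6)); the even part drops t^3, and the
    passage from halves to hairs doubles the degrees. *)
Lemma frac_Keven_sym : is_fraction (Keven false) 1 ((1 - 'X^4) * (1 - 'X^12)).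
Proof.
have H := frac_even (frac_Kspace frac_mol_sym).
have {}H : is_fraction (even_part (fun d => (\dim (Kspace false d))%:R)) 1 ((1 - 'X^2) * (1 - 'X^6)).
  apply: (frac_div (n := 2)) => //; apply: (frac_eq H); first by coef0.
  rewrite !(rmorphM, rmorphB, rmorph1, rmorphXn) /= !comp_polyX; ring.
apply: (frac_eq (frac_dilate (m := 2) isT H)); first by coef0.
by rewrite !(rmorphM, rmorphB, rmorph1, rmorphXn) /= !comp_polyX; ring.
Qed.

(** As in the symmetric case, with t^3 + t^6 as numerator: the even part is t^6, and doubling the
    degrees gives t^12. *)
Lemma frac_Keven_alt : is_fraction (Keven true) 'X^12 ((1 - 'X^4) * (1 - 'X^12)).
Proof.
have H := frac_even (frac_Kspace frac_mol_alt).
have {}H : is_fraction (even_part (fun d => (\dim (Kspace true d))%:R)) 'X^6 ((1 - 'X^2) * (1 - 'X^6)).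
  apply: (frac_div (n := 2)) => //; apply: (frac_eq H); first by coef0.
  rewrite !(rmorphM, rmorphB, rmorph1, rmorphXn) /= !comp_polyX; ring.
apply: (frac_eq (frac_dilate (m := 2) isT H)); first by coef0.
by rewrite !(rmorphM, rmorphB, rmorph1, rmorphXn) /= !comp_polyX; ring.
Qed.

Definition ker_dim k : rat := (\dim (S0 k :&: lker (delta0 k)))%:R.

(** The sum of the halves is (k+1)/2 for odd k and (k-2)/2 for even k, so the symmetric series is
    shifted down by 1 and the alternating one up by 2. Subtracting the constant 1 removes the term
    of sum 0, which would belong to k = -1. *)
Lemma genfun_ker k : genfun ker_dim k =
  (Keven false k.+1 - series_of_poly 1 k.+1) + (if (2 <= k)%N then Keven true (k - 2)%N else 0).
Proof.
rewrite /series_of_poly coefC subr0 /Keven /dilate /even_part /genfun /ker_dim.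
case: k => [|k]; first by rewrite addr0.
have := odd_double_half k; case: (odd k) => /= kE.
  move: (k./2) kE => d <-; rewrite add1n [X in _ = X + _](_ : _ = 0); last first.
    by case: ifP => //; rewrite dvdn2 /= negbK odd_double.
  rewrite add0r ker_even_dim (_ : (d.*2.+2 - 2)%N = (d * 2)%N) ?dvdn_mull // ?mulnK //; last by lia.
  by case: (odd d).
move: (k./2) kE => d <-; rewrite add0n ker_odd_dim.
rewrite (_ : d.*2.+2 = (d.+1 * 2)%N) ?dvdn_mull // ?mulnK //; last by lia.
rewrite [X in _ = _ + X](_ : _ = 0) ?addr0; last first.
  by case: d => [|d] //=; rewrite subSS subn1 dvdn2 /= odd_double.
by rewrite /=; case: (odd d).
Qed.

Lemma frac_ker : is_fraction (genfun ker_dim)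
  ('X^3 + 'X^11 + 'X^14 - 'X^15) ((1 - 'X^4) * (1 - 'X^12)).
Proof.
pose q : {poly rat} := (1 - 'X^4) * (1 - 'X^12).
have H1 : is_fraction (fun d => Keven false d + - series_of_poly 1 d) ('X * ('X^3 + 'X^11 - 'X^15)) q.
  apply: (frac_eq (frac_add frac_Keven_sym (frac_opp (frac_poly 1)))); first by coef0.
  by rewrite /q; ring.
apply: (frac_ext (fun k => esym (genfun_ker k))).
apply: (frac_eq (frac_add (frac_shift H1) (frac_up 2 frac_Keven_alt))); first by coef0.
by rewrite /q; ring.
Qed.

Definition euler_rat k : rat := (\dim (S0 k))%:R - (\dim (S1 k))%:R + (\dim (S2 k))%:R.

Lemma frac_euler : is_fraction euler_rat
  ((1 + 'X^2) * (1 - 'X^12) - 'X + 'X^11 + 'X^13 + 'X^14) ((1 + 'X^2) * (1 - 'X^12)).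
Proof.
have H0 := frac_add frac_mol_one frac_mol_theta.
(* The common factor is 12: 6 from the average over permutations and 2 from that over the exchange
   of the ends. Defect 1 has only the first average, hence the -2. *)
have H := frac_add (frac_add H0 (frac_scale (-2%:R) (frac_up 1 frac_mol_one))) (frac_up 2 H0).
apply: (frac_div (n := 12)) => //.
apply: (frac_eq (frac_ext _ H)) => [d||]; first last.
- rewrite polyCN polyC_natr; ring.
- by coef0.
rewrite /euler_rat dim_Sp_true !dim_Sp_tau subn0 /= -/mol_one -/mol_theta.
by case: (1 <= d)%N (2 <= d)%N => [] []; field.
Qed.

Lemma frac_genfun h p q : is_fraction h p q -> is_fraction (genfun h) (p - (h 0%N)%:P * q) q.
Proof.
move=> H; have [q0 _] := H.
apply: (frac_eq (frac_ext _ (frac_add H (frac_opp (frac_poly (h 0%N)%:P))))) => [d|//|].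
  by case: d => [|d]; rewrite /series_of_poly coefC /= ?subrr ?subr0.
ring.
Qed.

(** The contribution of the triple (0, 0, 0), which has to be subtracted because [genfun] starts at
    k = 1. *)
Lemma euler_rat0 : euler_rat 0 = 1.
Proof.
have [_ /(_ 0%N)] := frac_euler.
by rewrite /series_mul /series_of_poly big_ord_recl big_ord0 -!horner_coef0 !hornerE /= ?expr0n /=.

Qed.

(** The factor (-1)^k reflects the parity of the total degree; it substitutes -t for t. *)
Lemma frac_alternate_euler : is_fraction (genfun (fun k => (-1) ^+ k * euler_rat k))
  ('X - 'X^11 - 'X^13 + 'X^14) ((1 + 'X^2) * (1 - 'X^12)).
Proof.
apply: (frac_eq (frac_genfun (frac_alternate frac_euler))); first by coef0.
rewrite /= euler_rat0 (_ : (-1) ^+ 0 * 1 = 1 :> rat) // polyC1.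
by rewrite !(rmorphM, rmorphB, rmorphD, rmorph1, rmorphXn) /= !comp_polyX; ring.
Qed.

Lemma frac_cohomology1 : is_fraction (genfun (fun k => ker_dim k - euler_rat k))
  ('X + 'X^16) ((1 - 'X^4) * (1 - 'X^12)).
Proof.
have H := frac_add frac_ker (frac_opp (frac_genfun frac_euler)).
apply: (frac_eq (frac_ext _ H)) => [d||]; first by case: d => [|d] //=; rewrite subr0.
  by coef0.
by rewrite euler_rat0 polyC1; ring.
Qed.

(** * The pairing with graphs *)

Section Values.
Variables (k n e : nat).
Hypothesis k_gt0 : (0 < k)%N.
Implicit Types (g : ograph k n e) (F : bool -> bool -> fun3).

Definition hairy_ograph g := two_loop_hairy g.1 && total_order g.2.

Definition is_standard g (t : bool * bool * (nat * nat * nat) * bool) : Prop :=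
  exists f : iso (Th t.1.1.1 t.1.1.2 t.1.2.1.1 t.1.2.1.2 t.1.2.2) (obj g), isgn f = t.2.

(* The choice does not depend on F, which makes value linear in F. *)
Definition standard g := ClassicalEpsilon.epsilon (inhabits (false, false, (0, 0, 0), false)%N) (is_standard g).

(** Extended by 0 to the other graphs, because the relations run over all admissible ones. *)
Definition value F g : rat := if hairy_ograph g then
  let t := standard g in (-1) ^+ t.2 * F t.1.1.1 t.1.1.2 t.1.2.1.1 t.1.2.1.2 t.1.2.2 else 0.

Lemma Th_hairy g d0 d1 a b c (f : iso (Th d0 d1 a b c) (obj g)) : two_loop_hairy g.1.
Proof. exact: theta_two_loop_hairy f k_gt0. Qed.

Lemma hairy_Th g : two_loop_hairy g.1 -> exists d0 d1 a b c (f : iso (Th d0 d1 a b c) (obj g)), True.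
Proof. by case: g => G L hG; exact: classification hG L. Qed.

Lemma iso_transport g g' d0 d1 a b c d0' d1' a' b' c' (h : iso (obj g) (obj g'))
    (f : iso (Th d0 d1 a b c) (obj g)) (f' : iso (Th d0' d1' a' b' c') (obj g')) F :
  total_order g.2 -> total_order g'.2 -> theta_invariant F ->
  (-1) ^+ isgn f' * F d0' d1' a' b' c' = (-1) ^+ isgn h * ((-1) ^+ isgn f * F d0 d1 a b c).
Proof.
move=> tg tg' FI; have tT := theta_tournament; have t1 := obj_tournament tg; have t2 := obj_tournament tg'.
have [r [sr _ _ _]] := iso_sym f' (tT _ _) t2.
rewrite (rigidity (iso_comp r (iso_comp h f)) FI).
rewrite (isgn_comp _ _ (tT _ _) t2 (tT _ _)) (isgn_comp _ _ (tT _ _) t1 t2) sr.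
rewrite !mulrA -!signr_addb_rat; congr (_ ^+ nat_of_bool _ * _).
by case: (isgn f) (isgn h) (isgn f') => [] [] [].
Qed.

Lemma valueP F g d0 d1 a b c (f : iso (Th d0 d1 a b c) (obj g)) :
  theta_invariant F -> total_order g.2 -> value F g = (-1) ^+ isgn f * F d0 d1 a b c.
Proof.
move=> FI tg; rewrite /value /hairy_ograph (Th_hairy f) tg /=.
have : is_standard g (standard g).
  apply: ClassicalEpsilon.epsilon_spec.
  by exists (d0, d1, (a, b, c), isgn f); exists f.
case=> f' <-; rewrite (iso_transport (iso_id _) f f') //.
by rewrite isgn_id mul1r.
Qed.

(** That isomorphisms preserve two-loop hairiness follows by passing through a theta graph: one
    graph is classified, the other one realizes the same theta graph. *)
Lemma value_iso F g g' (f : iso (obj g) (obj g')) : theta_invariant F ->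
  admissible_ograph g -> admissible_ograph g' -> value F g' = (-1) ^+ isgn f * value F g.
Proof.
move=> FI /andP[_ tg] /andP[_ tg'].
have [hg|hg] := boolP (two_loop_hairy g.1).
  have [d0 [d1 [a [b [c [h _]]]]]] := hairy_Th hg.
  rewrite (valueP h) // (valueP (iso_comp f h)) //.
  rewrite (isgn_comp _ _ (@theta_tournament _ _) (obj_tournament tg) (obj_tournament tg')).
  by rewrite addbC signr_addb_rat mulrA.
rewrite /value /hairy_ograph (negbTE hg) mulr0; case: ifP => // /andP[hg' _].
have [d0 [d1 [a [b [c [h _]]]]]] := hairy_Th hg'.
have [r _] := iso_sym f (obj_tournament tg) (obj_tournament tg').
by rewrite (Th_hairy (iso_comp r h)) in hg.
Qed.
End Values.

Lemma hairy_support k n e i (x : chain k n e) g : x \in hairy k n e i -> x g != 0 ->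
  [/\ two_loop_hairy g.1, total_order g.2 & defect g.1 = i].
Proof.
move=> xh xg; suff : [&& two_loop_hairy g.1, total_order g.2 & defect g.1 == i].
  by case/and3P => ? ? /eqP.
apply: contraNT xg => ng; rewrite /hairy in xh.
rewrite (coord_span xh) sum_ffunE big1 // => j _; rewrite ffunE.
have : (image_tuple (@gen k n e) [pred g0 | [&& two_loop_hairy g0.1, total_order g0.2 & defect g0.1 == i]])`_j
    \in [seq gen g0 | g0 : ograph k n e in [pred g0 | [&& two_loop_hairy g0.1, total_order g0.2 & defect g0.1 == i]]].
  by apply: mem_nth; rewrite size_tuple.
case/imageP => g'; rewrite inE => hg' ->; rewrite ffunE.
case: eqP => [E|_]; last exact: mulr0.
by move: ng; rewrite E hg'.
Qed.

Lemma chain_gen k n e (x : chain k n e) : x = \sum_g (x g : rat) *: gen g.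
Proof.
apply/ffunP => g; rewrite sum_ffunE (bigD1 g) //= big1 ?addr0 => [|g' ne].
  by rewrite !ffunE eqxx; symmetry; exact: mulr1.
by rewrite !ffunE eq_sym (negbTE ne); exact: mulr0.
Qed.

Lemma gen_hairy k n e i (g : ograph k n e) :
  two_loop_hairy g.1 -> total_order g.2 -> defect g.1 = i -> gen g \in hairy k n e i.
Proof. by move=> h1 h2 h3; apply: memv_span; apply: image_f; rewrite inE h1 h2 h3 eqxx. Qed.

Lemma hairy_admissible k n e (G : graph k n e) : two_loop_hairy G -> admissible G.
Proof. by case/and4P. Qed.

Lemma Th_sizes k n e (g : ograph k n e) d0 d1 a b c : iso (Th d0 d1 a b c) (obj g) ->
  [/\ (d0 + d1 + (a + b + c) = k)%N, n = (a + b + c).+2 & e = (n + k).+1].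
Proof. by move=> f; have [h1 h2 h3] := theta_sizes f; rewrite card_thair in h1. Qed.

Section Cochains.
Variables (k i : nat).

Definition wt (a b c : nat) := (i == 1)%N || ~~ tau a b c.
Definition Scoch : {vspace coch k} := Sp false true wt k i.

Lemma wt_perm a b c : wt b a c = wt a b c /\ wt a c b = wt a b c.
Proof. by rewrite /wt; have [-> ->] := tau_perm a b c. Qed.

(** The cochain itself gives the values for the labels with the hairs first at the end [false]; the
    label (false, true) is reached by the exchange of the ends, which contributes [sgt]. *)
Definition extend (f : coch k) (d0 d1 : bool) : fun3 := fun a b c =>
  if (d0 + d1 == i)%N then (if ~~ d0 && d1 then sgt a b c else 1) * ev i f a b c else 0.

Lemma extend_invariant f : f \in Scoch -> theta_invariant (extend f).
Proof.
case/(SpP wt_perm) => fI f0 _; split=> d0 d1 a b c; rewrite /extend.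
- have [-> _] := sgt_perm a b c; have [-> _] := fI a b c; rewrite /sg /chi /=.
  by case: ifP => _; rewrite ?mulr0 // mulrCA.
- have [_ ->] := sgt_perm a b c; have [_ ->] := fI a b c; rewrite /sg /chi /=.
  by case: ifP => _; rewrite ?mulr0 // mulrCA.
rewrite addnC; case: eqP => [E|_]; last by rewrite mulr0.
have := f0 a b c; rewrite /wt /sgt; case: (tau a b c); last by rewrite !if_same !mul1r.
case: d0 d1 E => [] [] /= <- /= h; rewrite ?sgn1 ?mul1r ?mulN1r ?opprK //.
- by rewrite h // oppr0.
- by rewrite h // oppr0.
Qed.

Lemma extendP x f g d0 d1 a b c :
  extend (x *: f + g) d0 d1 a b c = x * extend f d0 d1 a b c + extend g d0 d1 a b c.
Proof. by rewrite /extend; case: ifP => _; rewrite ?evP; ring. Qed.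

Section Pairing.
Variables (n e : nat).

Definition pairing (f : coch k) (x : chain k n e) : rat := \sum_g (x g : rat) * value (extend f) g.

Lemma pairing_l x : linear (fun f => pairing f x : rat^o).
Proof.
move=> a f g; rewrite /pairing scaler_sumr -big_split /=; apply: eq_bigr => h _.
rewrite /value; case: ifP => _; last by rewrite !mulr0 scaler0 addr0.
rewrite extendP.
have E (w s p q : rat) : w * (s * (a * p + q)) = a * (w * (s * p)) + w * (s * q) by ring.
exact: E.
Qed.

Lemma pairing_r f : linear (fun x => pairing f x : rat^o).
Proof.
move=> a x y; rewrite /pairing scaler_sumr -big_split /=; apply: eq_bigr => h _.
by rewrite !ffunE /= mulrDl -mulrA.
Qed.

Lemma pairing_gen f g : pairing f (gen g) = value (extend f) g.
Proof.
rewrite /pairing (bigD1 g) //= big1 ?addr0 => [|h /negbTE ne]; first by rewrite ffunE eqxx mul1r.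
by rewrite ffunE ne mul0r.
Qed.
End Pairing.
End Cochains.

(** * Duality between cochains and two-loop hairy graphs *)

Section PerfectPairing.
Variables (m N k n e i : nat).
Hypotheses (m_even : ~~ odd m) (N_odd : odd N) (k_gt0 : (0 < k)%N).
Hypotheses (n_eq : (n + i = k + 2)%N) (e_eq : (e + i = k.*2 + 3)%N) (i_le2 : (i <= 2)%N).
Implicit Types (g : ograph k n e).

Lemma Th_defect g d0 d1 a b c (f : iso (Th d0 d1 a b c) (obj g)) :
  [/\ (d0 + d1)%N = i, (a + b + c + i)%N = k & defect g.1 = i].
Proof.
have [h1 h2 h3] := Th_sizes f; have [h4 _] := two_loop_hairy_size (Th_hairy k_gt0 f) (erefl _).
split; lia.
Qed.

Lemma Th_realize (d0 d1 : bool) (a b c : nat) : (d0 + d1)%N = i -> (a + b + c + i)%N = k ->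
  exists g, total_order g.2 /\ exists f : iso (Th d0 d1 a b c) (obj g), True.
Proof.
move=> hd hk; apply: theta_realize.
- by rewrite card_thair; change (d0 + d1 + (a + b + c) = k)%N; lia.
- by rewrite card_tvert; change ((a + b + c).+2 = n)%N; lia.
- by rewrite card_sum card_tedge card_thair; change ((a + b + c) + 3 + (d0 + d1 + (a + b + c)) = e)%N; lia.
Qed.

Lemma Th_gen_hairy g d0 d1 a b c (f : iso (Th d0 d1 a b c) (obj g)) : total_order g.2 ->
  gen g \in hairy k n e i.
Proof. by move=> tg; have [_ _ h] := Th_defect f; apply: gen_hairy (Th_hairy k_gt0 f) tg h. Qed.

Lemma Th_admissible g d0 d1 a b c (f : iso (Th d0 d1 a b c) (obj g)) : total_order g.2 ->
  admissible_ograph g.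
Proof. by move=> tg; rewrite /admissible_ograph tg (hairy_admissible (Th_hairy k_gt0 f)). Qed.

Lemma pairing_relations f x : f \in Scoch k i -> x \in relations k n e m N -> pairing i f x = 0.
Proof.
move=> fS xR; apply: (sub_relations_kernel m_even N_odd _ xR) => g g' h ag ag'.
by apply: value_iso => //; exact: extend_invariant fS.
Qed.

Lemma pairing_faithful f : f \in Scoch k i -> (forall x, x \in hairy k n e i -> pairing i f x = 0) -> f = 0.
Proof.
move=> fS h; apply: (Sp_eq0 (@wt_perm i) fS) => a b c.
have [/eqP E|/negbTE/ev_out -> //] := boolP (a + b + c + i == k)%N.
(* (0 < i, 1 < i) is the label with i hairs at the ends, the end [false] being served first. *)
have dE : ((0 < i) + (1 < i))%N = i by case: (i) i_le2 => [|[|[|]]].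
have [g [tg [r _]]] := Th_realize dE E.
have := h _ (Th_gen_hairy r tg); rewrite pairing_gen (valueP k_gt0 r (extend_invariant fS) tg) => /eqP.
rewrite mulf_eq0 signr_eq0 /= /extend dE eqxx => /eqP.
by case: (i) i_le2 => [|[|[|]]] //= _; rewrite mul1r.
Qed.

Section Dual.
Variable psi : ograph k n e -> rat.
Hypothesis psiP : forall g g' (f : iso (obj g) (obj g')), admissible_ograph g -> admissible_ograph g' ->
  psi g' = (-1) ^+ isgn f * psi g.

Definition is_theta_value (d0 d1 : bool) (a b c : nat) (v : rat) : Prop :=
  exists g (f : iso (Th d0 d1 a b c) (obj g)), total_order g.2 /\ v = (-1) ^+ isgn f * psi g.

(** Reads [psi] on some numbered graph that realizes the theta graph; [theta_valueP] shows that the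
    choice does not matter. *)
Definition theta_value (d0 d1 : bool) : fun3 := fun a b c =>
  if (d0 + d1 == i)%N && (a + b + c + i == k)%N
  then ClassicalEpsilon.epsilon (inhabits 0) (is_theta_value d0 d1 a b c) else 0.

Lemma theta_valueP g d0 d1 a b c (f : iso (Th d0 d1 a b c) (obj g)) : total_order g.2 ->
  theta_value d0 d1 a b c = (-1) ^+ isgn f * psi g.
Proof.
move=> tg; have [h1 h2 _] := Th_defect f; rewrite /theta_value h1 h2 !eqxx /=.
have : is_theta_value d0 d1 a b c (ClassicalEpsilon.epsilon (inhabits 0) (is_theta_value d0 d1 a b c)).
  by apply: ClassicalEpsilon.epsilon_spec; exists ((-1) ^+ isgn f * psi g), g, f.
case=> g' [f' [tg' ->]].
have tT := theta_tournament; have t1 := obj_tournament tg; have t2 := obj_tournament tg'.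
have [r [sr _ _ _]] := iso_sym f (tT _ _) t1.
rewrite (psiP (iso_comp f' r)) ?(Th_admissible f) ?(Th_admissible f') //.
rewrite (isgn_comp _ _ t1 (tT _ _) t2) sr mulrA -signr_addb_rat.
by congr (_ ^+ nat_of_bool _ * _); case: (isgn f) (isgn f') => [] [].
Qed.

Lemma theta_value_iso (d0 d1 : bool) (a b c : nat) d0' d1' a' b' c' (r : iso (Th d0' d1' a' b' c') (Th d0 d1 a b c)) :
  (d0 + d1 = i)%N -> (a + b + c + i = k)%N ->
  theta_value d0' d1' a' b' c' = (-1) ^+ isgn r * theta_value d0 d1 a b c.
Proof.
move=> hd hk; have [g [tg [f _]]] := Th_realize hd hk; have tT := theta_tournament.
rewrite (theta_valueP f tg) (theta_valueP (iso_comp f r) tg).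
rewrite (isgn_comp _ _ (tT _ _) (tT _ _) (obj_tournament tg)).
by rewrite signr_addb_rat mulrA.
Qed.

Lemma theta_value_out (d0 d1 : bool) (a b c : nat) : (d0 + d1 == i)%N && (a + b + c + i == k)%N = false ->
  theta_value d0 d1 a b c = 0.
Proof. by rewrite /theta_value => ->. Qed.

Lemma theta_value_invariant : theta_invariant theta_value.
Proof.
split=> d0 d1 a b c; case h : ((d0 + d1 == i)%N && (a + b + c + i == k)%N);
  try (by rewrite !theta_value_out ?mulr0 //; move: h => /=; lia).
- have [/eqP hd /eqP hk] := andP h.
  by have [r [_ _ <-]] := swap01_iso d0 d1 a b c; exact: theta_value_iso.
- have [/eqP hd /eqP hk] := andP h.
  by have [r [_ _ <-]] := swap12_iso d0 d1 a b c; exact: theta_value_iso.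
- have [/eqP hd /eqP hk] := andP h.
  by have [r [_ <-]] := flip_iso_Th d0 d1 a b c; exact: theta_value_iso.
Qed.

Definition dual_cochain : coch k := res k i (theta_value (0 < i)%N (1 < i)%N).

(** For i = 0 and i = 2 the flip fixes the label, so where [tau] holds the value equals its own
    negative. *)
Lemma dual_cochain_mem : dual_cochain \in Scoch k i.
Proof.
have [I1 I2 I3] := theta_value_invariant.
apply: res_Sp => [a b c|a b c _]; first by split; [exact: I1 | exact: I2].
rewrite /wt negb_or negbK => /andP[i1 ht].
have := I3 (0 < i)%N (0 < i)%N a b c; rewrite ht sgn1 mulN1r.
have -> : (1 < i)%N = (0 < i)%N by move: i1 i_le2; case: (i) => [|[|[|]]].
by move=> /eqP; rewrite -addr_eq0 -mulr2n mulrn_eq0 /= => /eqP.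
Qed.

Lemma extend_dual d0 d1 a b c : extend i dual_cochain d0 d1 a b c = theta_value d0 d1 a b c.
Proof.
rewrite /extend; case: eqP => [hd|hd]; last by rewrite theta_value_out //; apply/andP => -[/eqP].
rewrite ev_res; case: eqP => hk; last by rewrite mulr0 theta_value_out //; apply/andP => -[_ /eqP].
have [_ _ I3] := theta_value_invariant; rewrite -hd.
by case: d0 d1 {hd} => [] [] /=; rewrite ?mul1r // /sgt -I3.
Qed.

(** Every function that obeys the sign law thus comes from a cochain, which is what separates chains
    modulo the relations. *)
Lemma value_dual g : two_loop_hairy g.1 -> total_order g.2 -> value (extend i dual_cochain) g = psi g.
Proof.
move=> hg tg; have [d0 [d1 [a [b [c [f _]]]]]] := hairy_Th hg.
rewrite (valueP k_gt0 f (extend_invariant dual_cochain_mem) tg) extend_dual (theta_valueP f tg).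
by rewrite mulrA -expr2 sqrr_sign mul1r.
Qed.
End Dual.

Lemma pairing_separates x : x \in hairy k n e i ->
  (forall f, f \in Scoch k i -> pairing i f x = 0) -> x \in relations k n e m N.
Proof.
(* The coordinates of a projection with kernel W are values of cochains. *)
set W := relations _ _ _ _ _ => xh hx; pose p := (\1 - projv W)%VF.
have pE y : p y = y - projv W y by rewrite /p !lfunE /= !lfunE.
have pW y : y \in W -> p y = 0 by move=> yW; rewrite pE projv_id ?subrr.
suff : p x = 0 by rewrite pE => /subr0_eq ->; exact: memv_proj.
apply/ffunP => h; pose psi g : rat := p (gen g) h.
have psiP g g' (f : iso (obj g) (obj g')) : admissible_ograph g -> admissible_ograph g' ->
    psi g' = (-1) ^+ isgn f * psi g.
  move=> ag ag'; have /pW := relations_iso m_even N_odd f ag ag'.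
  by rewrite linearB linearZ /= => /subr0_eq E; rewrite /psi E ffunE.
have := hx _ (dual_cochain_mem psiP); rewrite ffunE => <-.
rewrite {1}(chain_gen x) linear_sum sum_ffunE; apply: eq_bigr => g _; rewrite linearZ ffunE.
have [->|xg] := eqVneq (x g : rat) 0; first by rewrite mul0r; exact: mul0r.
by have [h1 h2 h3] := hairy_support xh xg; rewrite (value_dual psiP).
Qed.

Lemma perfect : perfect_pairing (Scoch k i) (hairy k n e i) (relations k n e m N) (@pairing k i n e).
Proof.
split; [exact: pairing_l|exact: pairing_r|exact: pairing_relations|exact: pairing_separates|exact: pairing_faithful].
Qed.
End PerfectPairing.

Lemma diffE k n e (x : chain k n e) : diff k n e x = \sum_g (x g : rat) *: diff_gen g.
Proof. by rewrite lfunE. Qed.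

Section Adjunction.
Variables (k n e i : nat).
Hypotheses (k_gt0 : (0 < k)%N) (n_eq : (n + i.+1 = k + 2)%N) (e_eq : (e + i.+1 = k.*2 + 3)%N).
Implicit Types (g : ograph k n e) (f : coch k).

(* diff_value applied to the indicator of the graphs that are not two-loop
   hairy, which vanishes on theta graphs: a sum of nonnegative terms is zero. *)
Lemma split_two_loop_hairy g v P : two_loop_hairy g.1 -> total_order g.2 -> splitting g.1 v P ->
  two_loop_hairy (split_graph g.1 v (new_block P)).
Proof.
move=> hg tg sP; have [d0 [d1 [a [b [c [f _]]]]]] := hairy_Th hg.
pose phi (g' : ograph k n.+1 e.+1) : rat := (~~ two_loop_hairy g'.1)%:R.
have FI : theta_invariant (fun _ _ _ _ _ => 0) by split=> *; rewrite mulr0.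
have phiP (g' : ograph k n.+1 e.+1) d0' d1' a' b' c' (f' : iso (Th d0' d1' a' b' c') (obj g')) : total_order g'.2 ->
    phi g' = (-1) ^+ isgn f' * 0 by rewrite mulr0 /phi (Th_hairy k_gt0 f').
have /eqP := diff_value tg FI phiP f.
rewrite /theta_diff /= !(mulr0, addr0) !if_same !(mulr0, addr0) psumr_eq0; last first.
  by move=> w _; apply: sumr_ge0 => Q _; rewrite ler0n.
move/allP/(_ v (mem_index_enum _)); rewrite /= psumr_eq0 => [|Q _]; last by rewrite ler0n.
by move/allP/(_ P (mem_index_enum _)); rewrite sP /phi /=; case: (two_loop_hairy _); rewrite ?oner_eq0.
Qed.

(** The defect drops by 1 because it is determined by k and the number of internal vertices. *)
Lemma diff_gen_hairy g : two_loop_hairy g.1 -> total_order g.2 -> diff_gen g \in hairy k n.+1 e.+1 i.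
Proof.
move=> hg tg; apply: memv_suml => v _; apply: memv_suml => P sP.
have hs := split_two_loop_hairy hg tg sP.
apply: gen_hairy => //; first exact: split_order_total.
have [h _] := two_loop_hairy_size hs (erefl _); move: h => /=; move: n_eq; lia.
Qed.

Lemma diff_hairy : (diff k n e @: hairy k n e i.+1 <= hairy k n.+1 e.+1 i)%VS.
Proof.
apply/subvP => y /memv_imgP[x xh ->]; rewrite diffE; apply: memv_suml => g _.
have [->|xg] := eqVneq (x g : rat) 0; first by rewrite scale0r mem0v.
by have [h1 h2 _] := hairy_support xh xg; rewrite memvZ // diff_gen_hairy.
Qed.

(** The condition on [f'] is the right side of [diff_value], so the adjunction holds graph by
    graph. *)
Lemma pairing_diff f f' x : f \in Scoch k i -> f' \in Scoch k i.+1 ->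
  (forall (d0 d1 : bool) (a b c : nat), (d0 + d1 = i.+1)%N ->
    extend i.+1 f' d0 d1 a b c =
    (if d0 then theta_diff (extend i f) false d1 a b c else 0) +
    (if d1 then sgt a b c * theta_diff (extend i f) false d0 a b c else 0)) ->
  x \in hairy k n e i.+1 -> pairing i f (diff k n e x) = pairing i.+1 f' x.
Proof.
move=> fS fS' E xh; rewrite diffE; have BR := @pairing_r k i n.+1 e.+1.
rewrite (pairing_sum BR).
apply: eq_bigr => g _; rewrite (pairingZr BR).
have [->|xg] := eqVneq (x g : rat) 0; first by rewrite !mul0r.
have [hg tg _] := hairy_support xh xg; congr (_ * _).
rewrite (pairing_sum BR).
under eq_bigr => v _.
  rewrite (pairing_sum BR).
  under eq_bigr => P _ do rewrite pairing_gen.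
  over.
have [d0 [d1 [a [b [c [h _]]]]]] := hairy_Th hg.
have FI := extend_invariant fS.
have phiP (g' : ograph k n.+1 e.+1) d0' d1' a' b' c' (r : iso (Th d0' d1' a' b' c') (obj g')) (tg' : total_order g'.2) :=
  valueP k_gt0 r FI tg'.
rewrite (diff_value tg FI phiP h) (valueP k_gt0 h (extend_invariant fS') tg) E //.
by have [h1 h2 _] := Th_sizes h; move: n_eq; lia.
Qed.
End Adjunction.

Lemma extend_delta0 k f (d0' d1' : bool) (a b c : nat) : (d0' + d1' = 1)%N ->
    extend 1 (delta0 k f) d0' d1' a b c =
    (if d0' then theta_diff (extend 0 f) false d1' a b c else 0) +
    (if d1' then sgt a b c * theta_diff (extend 0 f) false d0' a b c else 0).
Proof.
rewrite /extend /theta_diff /= ev_dmap /ddiff /chi /=; case: d0' d1' => [] [] //= _.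
  by rewrite !mul1r addr0 -(signr_odd _ a) -(signr_odd _ (a + b)) oddD.
by rewrite !mul1r add0r -(signr_odd _ a) -(signr_odd _ (a + b)) oddD.
Qed.

Lemma extend_delta1 k f (d0' d1' : bool) (a b c : nat) : (d0' + d1' = 2)%N ->
    extend 2 (delta1 k f) d0' d1' a b c =
    (if d0' then theta_diff (extend 1 f) false d1' a b c else 0) +
    (if d1' then sgt a b c * theta_diff (extend 1 f) false d0' a b c else 0).
Proof.
rewrite /extend /theta_diff /= ev_delta1 /dd1 /ddiff /chi /=; case: d0' d1' => [] [] //= _.
by rewrite !mul1r -(signr_odd _ a) -(signr_odd _ (a + b)) oddD mulrDl mul1r.
Qed.

(** Defect 0 means that internal vertices are trivalent, while a splitting takes valence at least
    4. *)
Lemma diff_defect0 k n e : (hairy k n e 0 <= diff k n e @^-1: 0)%VS.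
Proof.
apply/subvP => x xh; rewrite -memv_preim memv0 diffE; apply/eqP/big1 => g _.
have [->|xg] := eqVneq (x g : rat) 0; first by rewrite scale0r.
have [hg _ dg] := hairy_support xh xg; rewrite /diff_gen big1 ?scaler0 // => v _.
rewrite big_pred0 // => P; apply/negP => /splitting_valence.
move/eqP: dg; rewrite /defect sum_nat_eq0 => /forallP/(_ v) /=; lia.
Qed.

(** * Dimensions of the homology and the Euler characteristic *)

Section Dimensions.
Variables (m N k : nat).
Hypotheses (m_even : ~~ odd m) (N_odd : odd N) (k_gt0 : (0 < k)%N).

Lemma perfect0 : perfect_pairing (S0 k) (hairy k k.+2 k.*2.+3 0) (relations k k.+2 k.*2.+3 m N)
  (@pairing k 0 k.+2 k.*2.+3).
Proof. by apply: (perfect (i := 0)) => //; lia. Qed.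

Lemma perfect1 : perfect_pairing (S1 k) (hairy k k.+1 k.*2.+2 1) (relations k k.+1 k.*2.+2 m N)
  (@pairing k 1 k.+1 k.*2.+2).
Proof. by apply: (perfect (i := 1)) => //; lia. Qed.

Lemma perfect2 : perfect_pairing (S2 k) (hairy k k k.*2.+1 2) (relations k k k.*2.+1 m N)
  (@pairing k 2 k k.*2.+1).
Proof. by apply: (perfect (i := 2)) => //; lia. Qed.

Lemma adjunction0 f x : f \in S0 k -> x \in hairy k k.+1 k.*2.+2 1 ->
  pairing 0 f (diff k k.+1 k.*2.+2 x) = pairing 1 (delta0 k f) x.
Proof.
move=> fS; apply: pairing_diff => //; try lia; first exact: delta0_S0.
by move=> ? ? ? ? ?; exact: extend_delta0.
Qed.

Lemma adjunction1 f x : f \in S1 k -> x \in hairy k k k.*2.+1 2 ->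
  pairing 1 f (diff k k k.*2.+1 x) = pairing 2 (delta1 k f) x.
Proof.
move=> fS; apply: pairing_diff => //; try lia; first exact: delta1_S1.
by move=> ? ? ? ? ?; exact: extend_delta1.
Qed.

Let dS0 : (delta0 k @: S0 k <= S1 k)%VS.
Proof. by apply/subvP => y /memv_imgP[f fS ->]; exact: delta0_S0. Qed.

Let D0 : (diff k k.+1 k.*2.+2 @: hairy k k.+1 k.*2.+2 1 <=
  hairy k k.+2 k.*2.+3 0 + relations k k.+2 k.*2.+3 m N)%VS.
Proof. by apply: subv_trans (addvSl _ _); apply: diff_hairy; lia. Qed.

Let D1 : (diff k k k.*2.+1 @: hairy k k k.*2.+1 2 <=
  hairy k k.+1 k.*2.+2 1 + relations k k.+1 k.*2.+2 m N)%VS.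
Proof. by apply: subv_trans (addvSl _ _); apply: diff_hairy; lia. Qed.

Lemma H0_dimE : (H0_dim m N k)%:R = ker_dim k.
Proof.
rewrite /H0_dim /homology_dim /cycles /boundaries (capv_idPl _).
  by rewrite (homology0 perfect0 perfect1 dS0 D0 adjunction0).
apply: subv_trans (diff_defect0 _ _ _) _; apply/subvP => x; rewrite -!memv_preim memv0 => /eqP ->.
exact: mem0v.
Qed.

(** As [delta1] is onto, rank and nullity of [delta0] turn dim S1 - rank [delta0] - rank [delta1]
    into dim ker [delta0] - (dim S0 - dim S1 + dim S2). *)
Lemma H1_dimE : (H1_dim m N k)%:R = ker_dim k - euler_rat k.
Proof.
have dS1 : (delta1 k @: S1 k <= S2 k)%VS by rewrite delta1_onto.
have := homology1 perfect0 perfect1 perfect2 dS0 D0 dS1 D1 adjunction0 adjunction1 (@delta1_delta0 k).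
rewrite delta1_onto -/(boundaries m N k k k.*2.+1 1) -/(cycles m N k k.+1 k.*2.+2 1).
rewrite -/(homology_dim m N k k k.*2.+1 1) -/(H1_dim m N k) => h.
have := limg_ker_dim (delta0 k) (S0 k); rewrite /ker_dim /euler_rat -h => <-.
by rewrite !natrD; ring.
Qed.

(** Only internal vertices have odd degree, so the sign of a bidegree is (-1)^n, with n = k, k + 1,
    k + 2 for the defects 2, 1, 0. *)
Lemma euler_charE : euler_char m N k = (-1) ^+ k * euler_rat k.
Proof.
rewrite /euler_char /hairy_dim (perfect_pairing_dim perfect0) (perfect_pairing_dim perfect1)
  (perfect_pairing_dim perfect2) /euler_rat.
have sgE n e : (-1) ^ total_degree m N k n e = (-1) ^+ n :> rat.
  rewrite /total_degree (big_morph (fun z : int => (-1) ^ z : rat) (op1 := *%R) (id1 := 1)) //; last first.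
    by move=> x y; rewrite exprzDr ?unitrN1.
  rewrite big_sumType big_sumType /= [X in X * _ * _]big1 => [|x _]; last by apply: signz_even; lia.
  rewrite [X in _ * X]big1 => [|x _]; last by apply: signz_even; lia.
  rewrite mul1r mulr1 (eq_bigr (fun=> -1)) => [|x _]; last by apply: signz_odd; lia.
  by rewrite prodr_const card_ord.
by rewrite !sgE !exprS; ring.
Qed.
End Dimensions.

Theorem theorem5p14 (m N : nat) (m_gt0 : (0 < m)%N) (N_gt0 : (0 < N)%N)
    (m_even : ~~ odd m) (N_odd : odd N) :
  [/\ is_fraction (genfun (fun k => (H0_dim m N k)%:R))
        ('X^3 + 'X^11 + 'X^14 - 'X^15) ((1 - 'X^4) * (1 - 'X^12)),
      is_fraction (genfun (fun k => (H1_dim m N k)%:R))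
        ('X + 'X^16) ((1 - 'X^4) * (1 - 'X^12))
    & is_fraction (genfun (euler_char m N))
        ('X - 'X^11 - 'X^13 + 'X^14) ((1 + 'X^2) * (1 - 'X^12))].
Proof.
split.
- by apply: frac_ext frac_ker => -[|k] //=; rewrite (H0_dimE m_even N_odd).
- by apply: frac_ext frac_cohomology1 => -[|k] //=; rewrite (H1_dimE m_even N_odd).
- by apply: frac_ext frac_alternate_euler => -[|k] //=; rewrite (euler_charE m_even N_odd).
Qed.
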